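(* Let $x_1,x_2$ be two distinct points of $\mathbb{S}^2$. For all $i\in\mathbb{N}$ ($i\geq 1$), $$(B_2(\mathbb{S}^2\setminus\{x_1,x_2\}))^{(i)}\cong\pi\left((\mathbb{Z}\ast\mathbb{Z})^{(i)}\right),$$ where $\pi:\mathbb{Z}\ast\mathbb{Z}\to\mathbb{Z}_2\ast\mathbb{Z}$ is the homomorphism obtained by taking the first factor modulo $2$.
   Context: For a surface $M$, $F_m(M)=\{(y_1,\ldots,y_m)\in M^m: y_i\neq y_j\text{ if }i\neq j\}$, and $B_m(M)=\pi_1(F_m(M)/S_m)$ is the $m$-string braid group of $M$. Derived series: $G^{(0)}=G$, $G^{(i)}=[G^{(i-1)},G^{(i-1)}]$. $\mathbb{Z}_2$ is the cyclic group of order $2$, $\ast$ denotes free product, and $\mathbb{N}$ is the set of positive integers. *)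

(* Defs.v *)
From HB Require Import structures.
From mathcomp Require Import all_boot all_order all_algebra perm.
From mathcomp Require Import boolp classical_sets functions reals set_interval.
From mathcomp Require Import topology normedtype continuous_path.
From mathcomp Require Import ring lra.
From Stdlib Require Import Relations.Relation_Operators.

Set Implicit Arguments.
Unset Strict Implicit.
Unset Printing Implicit Defensive.

Import Order.TTheory GRing.Theory Num.Theory numFieldNormedType.Exports.
Local Open Scope classical_set_scope.
Local Open Scope ring_scope.
Local Open Scope quotient_scope.

Section derived_series.
Context {G : groupType}.
Local Open Scope group_scope.

Definition is_subgroup (A : set G) : Prop :=
  A 1 /\ forall x y, A x -> A y -> A (x / y).

Definition subgroup_generated (S : set G) : set G := smallest is_subgroup S.

Definition commutator_subgroup (A B : set G) : set G :=
  subgroup_generated [set [~ a, b] | a in A & b in B].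

Fixpoint derived_series (i : nat) : set G :=
  if i is j.+1 then
    commutator_subgroup (derived_series j) (derived_series j)
  else setT.

End derived_series.
Arguments derived_series : clear implicits.

(* For [A] and [B] subgroups: a group isomorphism from [A] onto [B]; the values
   of [f] outside [A] are irrelevant. *)
Definition isomorphic_subgroups {G H : groupType} (A : set G) (B : set H) :
    Prop :=
  exists f : G -> H,
    {in A &, {morph f : x y / (x * y)%g}} /\ set_bij A B f.

(* The additive group of [A], as a multiplicative [groupType]. *)
Definition mult_of (A : zmodType) : Type := A.

Section mult_of.
Variable A : zmodType.
HB.instance Definition _ := Choice.on (mult_of A).
HB.instance Definition _ := isGroup.Build (mult_of A)
  (@addrA A) (@add0r A) (@addr0 A) (@addNr A) (@addrN A).
End mult_of.

Definition Zgroup : groupType := mult_of int.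
Definition Z2group : groupType := mult_of 'Z_2.

Definition mod2 (n : Zgroup) : Z2group := ((n : int)%:~R : 'Z_2).

Fact mod2_is_morphism : {morph mod2 : x y / (x / y)%g}.
Proof. exact: (@intrB 'Z_2). Qed.
HB.instance Definition _ := isGroupMorphism.Build Zgroup Z2group mod2
  mod2_is_morphism.

Section free_product.
Context (G H : groupType).
Local Open Scope group_scope.

Notation word := (seq (G + H)).
Implicit Types (u v w : word).

(* The free product is the set of words in the disjoint union of [G] and [H]
   modulo the congruence generated by the multiplication tables of [G] and [H]
   and the deletion of identity letters. *)
Inductive fp_step : word -> word -> Prop :=
| fp_mull u v (a b : G) :
    fp_step (u ++ [:: inl a, inl b & v]) (u ++ inl (a * b) :: v)
| fp_mulr u v (a b : H) :
    fp_step (u ++ [:: inr a, inr b & v]) (u ++ inr (a * b) :: v)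
| fp_onel u v : fp_step (u ++ inl 1 :: v) (u ++ v)
| fp_oner u v : fp_step (u ++ inr 1 :: v) (u ++ v).

Definition fp_equiv : word -> word -> Prop := clos_refl_sym_trans word fp_step.

Definition fp_rel : rel word := fun u v => `[< fp_equiv u v >].

Fact fp_rel_refl : reflexive fp_rel.
Proof. by move=> u; apply/asboolP; exact: rst_refl. Qed.

Fact fp_rel_sym : symmetric fp_rel.
Proof. by move=> u v; apply/asboolP/asboolP; exact: rst_sym. Qed.

Fact fp_rel_trans : transitive fp_rel.
Proof.
by move=> v u w /asboolP uv /asboolP vw; apply/asboolP; exact: rst_trans uv vw.
Qed.

Canonical fp_equiv_rel :=
  EquivRel fp_rel fp_rel_refl fp_rel_sym fp_rel_trans.

Definition free_product : Type := {eq_quot fp_rel}.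

HB.instance Definition _ := Choice.on free_product.

Definition fp_word w : free_product := \pi_({eq_quot fp_rel}) w.

Lemma fp_wordP u v : fp_word u = fp_word v <-> fp_equiv u v.
Proof.
split=> [uv|uv]; last by apply/eqmodP/asboolP.
by apply/asboolP; move/eqmodP: uv.
Qed.

Lemma fp_word_repr (x : free_product) : exists w, x = fp_word w.
Proof. by exists (repr x); rewrite /fp_word reprK. Qed.

Definition fp_repr (x : free_product) : word := repr x.

Lemma fp_reprK (x : free_product) : fp_word (fp_repr x) = x.
Proof. by rewrite /fp_word /fp_repr reprK. Qed.

Lemma fp_repr_word w : fp_equiv (fp_repr (fp_word w)) w.
Proof. by apply/fp_wordP; rewrite fp_reprK. Qed.

Definition letter_inv (a : G + H) : G + H :=
  match a with inl g => inl g^-1 | inr h => inr h^-1 end.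

Definition word_inv w : word := rev (map letter_inv w).

Lemma fp_equiv_homo (f : word -> word) :
  (forall u v, fp_step u v -> fp_equiv (f u) (f v)) ->
  forall u v, fp_equiv u v -> fp_equiv (f u) (f v).
Proof.
move=> fP u v; elim=> {u v} [u v /fP //|u|u v _ IH|u v w _ uv _ vw].
- exact: rst_refl.
- exact: rst_sym.
- exact: rst_trans uv vw.
Qed.

Lemma fp_equiv_cat u u' v v' :
  fp_equiv u u' -> fp_equiv v v' -> fp_equiv (u ++ v) (u' ++ v').
Proof.
move=> uu' vv'; apply: (@rst_trans _ _ _ (u' ++ v)).
  apply: (fp_equiv_homo (f := cat^~ v)) uu' => _ _ [] * /=;
    by rewrite -!catA /=; apply: rst_step; constructor.
apply: (fp_equiv_homo (f := cat u')) vv' => _ _ [] * /=;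
  by rewrite !(catA u'); apply: rst_step; constructor.
Qed.

Lemma fp_equiv_inv u v : fp_equiv u v -> fp_equiv (word_inv u) (word_inv v).
Proof.
apply: fp_equiv_homo => _ _ [] *; rewrite /word_inv !map_cat !rev_cat /=;
  rewrite ?rev_cons -?cats1 -?catA /= ?invg1 ?invgM; apply: rst_step;
  by constructor.
Qed.

Lemma fp_equiv_invr w : fp_equiv (w ++ word_inv w) [::].
Proof.
elim: w => [|a w IH]; first by rewrite /word_inv /=; exact: rst_refl.
rewrite /word_inv /= rev_cons -cats1 -/(word_inv w).
apply: (@rst_trans _ _ _ [:: a; letter_inv a]).
  rewrite -[_ :: _ ++ _]/([:: a] ++ _ ++ _) -[[:: a; _]]/([:: a] ++ [::] ++ _).
  apply: fp_equiv_cat; first exact: rst_refl.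
  by rewrite catA; apply: fp_equiv_cat; [exact: IH | exact: rst_refl].
case: a => a /=.
- apply: rst_trans (rst_step _ _ _ _ (fp_mull [::] [::] _ _)) _ => /=.
  by rewrite mulgV; apply: rst_step; exact: (fp_onel [::] [::]).
- apply: rst_trans (rst_step _ _ _ _ (fp_mulr [::] [::] _ _)) _ => /=.
  by rewrite mulgV; apply: rst_step; exact: (fp_oner [::] [::]).
Qed.

Lemma word_invK : involutive word_inv.
Proof.
move=> w; rewrite /word_inv map_rev revK -map_comp map_id_in //.
by case=> a _ /=; rewrite invgK.
Qed.

Definition fp_mul (x y : free_product) : free_product :=
  fp_word (fp_repr x ++ fp_repr y).
Definition fp_inv (x : free_product) : free_product :=
  fp_word (word_inv (fp_repr x)).
Definition fp_one : free_product := fp_word [::].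

Lemma fp_mulE u v : fp_mul (fp_word u) (fp_word v) = fp_word (u ++ v).
Proof. by apply/fp_wordP/fp_equiv_cat; exact: fp_repr_word. Qed.

Lemma fp_invE u : fp_inv (fp_word u) = fp_word (word_inv u).
Proof. by apply/fp_wordP/fp_equiv_inv/fp_repr_word. Qed.

Fact fp_mulA : associative fp_mul.
Proof.
move=> x y z; have [[u ->] [v ->] [w ->]] :=
  And3 (fp_word_repr x) (fp_word_repr y) (fp_word_repr z).
by rewrite !fp_mulE catA.
Qed.

Fact fp_mul1 : left_id fp_one fp_mul.
Proof. by move=> x; have [u ->] := fp_word_repr x; rewrite fp_mulE. Qed.

Fact fp_mulr1 : right_id fp_one fp_mul.
Proof. by move=> x; have [u ->] := fp_word_repr x; rewrite fp_mulE cats0. Qed.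

Fact fp_mulV : right_inverse fp_one fp_inv fp_mul.
Proof.
move=> x; have [u ->] := fp_word_repr x; rewrite fp_invE fp_mulE.
by apply/fp_wordP; exact: fp_equiv_invr.
Qed.

Fact fp_mulVl : left_inverse fp_one fp_inv fp_mul.
Proof.
move=> x; have [u ->] := fp_word_repr x; rewrite fp_invE fp_mulE.
apply/fp_wordP; rewrite -{2}(word_invK u); exact: fp_equiv_invr.
Qed.

HB.instance Definition _ :=
  isGroup.Build free_product fp_mulA fp_mul1 fp_mulr1 fp_mulVl fp_mulV.

Definition fp_inl (a : G) : free_product := fp_word [:: inl a].
Definition fp_inr (b : H) : free_product := fp_word [:: inr b].

End free_product.

Section free_product_map.
Context (G H G' H' : groupType).
Variables (f : UMagmaMorphism.type G G') (g : UMagmaMorphism.type H H').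
Local Open Scope group_scope.

Definition letter_map (a : G + H) : G' + H' :=
  match a with inl x => inl (f x) | inr y => inr (g y) end.

Definition free_product_map (x : free_product G H) : free_product G' H' :=
  fp_word (map letter_map (fp_repr x)).

Lemma free_product_mapE w :
  free_product_map (fp_word w) = fp_word (map letter_map w).
Proof.
apply/fp_wordP; have := fp_repr_word w; move: (fp_repr _) => v.
elim=> {w v} [u v uv|u|u v _ IH|u v w _ uv _ vw].
- apply: rst_step; case: uv => * /=; rewrite !map_cat /= ?gmulf1 ?gmulfM;
    by constructor.
- exact: rst_refl.
- exact: rst_sym.
- exact: rst_trans uv vw.
Qed.

Fact free_product_map_is_morphism : monoid.monoid_morphism free_product_map.
Proof.
split=> [|x y]; first by rewrite (free_product_mapE [::]).
have [[u ->] [v ->]] := conj (fp_word_repr x) (fp_word_repr y).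
by rewrite [_ * _ in LHS]fp_mulE !free_product_mapE map_cat [RHS]fp_mulE.
Qed.
HB.instance Definition _ := isUMagmaMorphism.Build
  (free_product G H) (free_product G' H') free_product_map
  free_product_map_is_morphism.

Lemma free_product_map_inl a :
  free_product_map (fp_inl H a) = fp_inl H' (f a).
Proof. exact: free_product_mapE. Qed.

Lemma free_product_map_inr b :
  free_product_map (fp_inr G b) = fp_inr G' (g b).
Proof. exact: free_product_mapE. Qed.

End free_product_map.

Definition mod2_first :
    free_product Zgroup Zgroup -> free_product Z2group Zgroup :=
  free_product_map mod2 idfun.

Section pasting.
Context {R : realType} {T X : topologicalType}.

Lemma pasting_continuous (c : T -> R) (r : R) (F G : T -> X) :
  continuous c -> continuous F -> continuous G ->
  (forall t, c t = r -> F t = G t) ->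
  continuous (fun t => if c t <= r then F t else G t).
Proof.
move=> cc cF cG FG t U tU.
suff: \forall s \near t, U (if c s <= r then F s else G s) by [].
move: tU; case: (ltgtP (c t) r) => [ctr|ctr|ctr] Ut.
- have Us : \forall s \near t, U (F s) := cF t _ Ut.
  have cr : \forall s \near t, c s < r := cc t _ (lt_nbhsl ctr).
  near=> s; have csr : c s < r by near: s.
  by rewrite (ltW csr); near: s.
- have Us : \forall s \near t, U (G s) := cG t _ Ut.
  have cr : \forall s \near t, r < c s := cc t _ (lt_nbhsr ctr).
  near=> s; have csr : r < c s by near: s.
  by rewrite leNgt csr; near: s.
- have Us : \forall s \near t, U (F s) := cF t _ Ut.
  have Vs : \forall s \near t, U (G s) by apply: cG; rewrite -FG.
  by near=> s; case: ifP => _; near: s.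
Unshelve. all: by end_near. Qed.

Lemma continuous_pair {Y : topologicalType} (f : T -> X) (g : T -> Y) :
  continuous f -> continuous g -> continuous (fun t => (f t, g t)).
Proof. by move=> cf cg t; apply: cvg_pair; [exact: cf|exact: cg]. Qed.

Lemma continuous_compose {Y : topologicalType} (f : T -> X) (g : X -> Y) :
  continuous f -> continuous g -> continuous (fun t => g (f t)).
Proof. by move=> cf cg t; exact: (continuous_comp (cf t) (cg (f t))). Qed.

End pasting.

Section unit_interval.
Variable R : realType.

Definition unit_interval : Type := set_type `[0, 1 : R]%classic.
HB.instance Definition _ := Topological.on unit_interval.

Fact itv01_proof (r : R) : 0 <= r <= 1 -> r \in `[0, 1]%classic.
Proof. by move=> r01; rewrite mem_setE in_itv. Qed.

Definition itv01 (r : R) (r01 : 0 <= r <= 1) : unit_interval :=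
  exist _ r (itv01_proof r01).

Fact itv01_0_proof : (0 : R) <= (0 : R) <= 1. Proof. by rewrite lexx ler01. Qed.
Fact itv01_1_proof : (0 : R) <= (1 : R) <= 1. Proof. by rewrite lexx ler01. Qed.

Fact itv01_0_neq1 : itv01 itv01_0_proof != itv01 itv01_1_proof.
Proof. by apply/eqP => /(congr1 val) /eqP /=; rewrite eq_sym oner_eq0. Qed.

HB.instance Definition _ := isBiPointed.Build unit_interval itv01_0_neq1.

Fact itv01_clamp_proof (r : R) : 0 <= Num.max 0 (Num.min r 1) <= 1.
Proof. by rewrite le_max lexx ge_max ler01 ge_min lexx orbT. Qed.

(* The retraction of [R] onto the unit interval; it lets piecewise affine
   functions on [R] serve as changes of parameter. *)
Definition itv01_clamp (r : R) : unit_interval := itv01 (itv01_clamp_proof r).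

Definition itv01_val (t : unit_interval) : R := \val t.

Lemma itv01_valP t : 0 <= itv01_val t <= 1.
Proof. by have := set_mem (valP t); rewrite /= in_itv. Qed.

Lemma itv01_valK : cancel itv01_val itv01_clamp.
Proof.
move=> t; apply/val_inj; have /andP[t0 t1] := itv01_valP t.
by rewrite /= (min_idPl t1) (max_idPr t0).
Qed.

Lemma itv01_val0 : itv01_val zero = 0. Proof. by []. Qed.
Lemma itv01_val1 : itv01_val one = 1. Proof. by []. Qed.

Lemma itv01_clamp_le0 r : r <= 0 -> itv01_clamp r = zero.
Proof.
move=> r0; apply/val_inj => /=; apply/max_idPl.
by rewrite ge_min r0.
Qed.

Lemma itv01_clamp_ge1 r : 1 <= r -> itv01_clamp r = one.
Proof.
by move=> r1; apply/val_inj => /=; rewrite (min_idPr r1); apply/max_idPr.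
Qed.

Lemma itv01_val_continuous : continuous itv01_val.
Proof. exact: initial_continuous. Qed.

Lemma itv01_clamp_continuous : continuous itv01_clamp.
Proof.
apply: continuous_comp_initial => r.
have c0 : {for r, continuous (cst (0 : R) : R -> R^o)} by exact: cvg_cst.
have c1 : {for r, continuous (cst (1 : R) : R -> R^o)} by exact: cvg_cst.
have ci : {for r, continuous (id : R -> R^o)} by exact: cvg_id.
exact: continuous_max c0 (continuous_min ci c1).
Qed.

End unit_interval.
Arguments itv01_val {R}.
Arguments itv01_clamp {R}.

Section path_homotopy.
Context (R : realType) (X : topologicalType).
Notation I := (unit_interval R).
Implicit Types x y z : X.

Definition path_homotopic x y (p q : {path I from x to y}) : Prop :=
  exists K : I * I -> X,
    [/\ continuous K,
        forall t, K (zero, t) = p t,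
        forall t, K (one, t) = q t,
        forall s, K (s, zero) = x &
        forall s, K (s, one) = y].

Lemma path_homotopic_refl x y (p : {path I from x to y}) : path_homotopic p p.
Proof.
exists (p \o snd); split=> //= [st|_|_]; rewrite ?path_zero ?path_one //.
by apply: continuous_comp; [exact: cvg_snd|exact: cts_fun].
Qed.

Lemma clamp_affine_continuous (T : topologicalType) (c : T -> R) (a b : R) :
  continuous c -> continuous (fun t => itv01_clamp (a * c t + b)).
Proof.
move=> cc; apply: continuous_compose (@itv01_clamp_continuous R) => t.
apply: cvgD; last exact: cvg_cst.
by apply: cvgM; [exact: cvg_cst|exact: cc].
Qed.

Lemma val_fst_continuous : continuous (fun st : I * I => itv01_val st.1).
Proof.
by apply: continuous_compose (@itv01_val_continuous R) => st; exact: cvg_fst.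
Qed.

Lemma val_snd_continuous : continuous (fun st : I * I => itv01_val st.2).
Proof.
by apply: continuous_compose (@itv01_val_continuous R) => st; exact: cvg_snd.
Qed.

Lemma path_homotopic_sym x y (p q : {path I from x to y}) :
  path_homotopic p q -> path_homotopic q p.
Proof.
move=> [K [cK K0 K1 Kx Ky]].
exists (fun st => K (itv01_clamp (-1 * itv01_val st.1 + 1), st.2)).
split=> [|t|t|s|s] /=.
- apply: continuous_compose cK; apply: continuous_pair => [|st].
    exact/clamp_affine_continuous/val_fst_continuous.
  exact: cvg_snd.
- by rewrite itv01_val0 itv01_clamp_ge1 ?K1 //; lra.
- by rewrite itv01_val1 itv01_clamp_le0 ?K0 //; lra.
- exact: Kx.
- exact: Ky.
Qed.

Lemma path_homotopic_trans x y (p q r : {path I from x to y}) :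
  path_homotopic p q -> path_homotopic q r -> path_homotopic p r.
Proof.
move=> [K [cK K0 K1 Kx Ky]] [L [cL L0 L1 Lx Ly]].
exists (fun st => if itv01_val st.1 <= 2^-1
  then K (itv01_clamp (2 * itv01_val st.1 + 0), st.2)
  else L (itv01_clamp (2 * itv01_val st.1 + -1), st.2)).
split=> [|t|t|s|s].
- apply: pasting_continuous; first exact: val_fst_continuous.
  + apply: continuous_compose cK; apply: continuous_pair => [|st].
      exact/clamp_affine_continuous/val_fst_continuous.
    exact: cvg_snd.
  + apply: continuous_compose cL; apply: continuous_pair => [|st].
      exact/clamp_affine_continuous/val_fst_continuous.
    exact: cvg_snd.
  + move=> st ->; rewrite itv01_clamp_ge1 ?itv01_clamp_le0; [|lra..].
    by rewrite K1 L0.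
- by rewrite itv01_val0 ifT ?itv01_clamp_le0 ?K0 //; lra.
- by rewrite itv01_val1 ifF ?itv01_clamp_ge1 ?L1 //; lra.
- by rewrite Kx Lx if_same.
- by rewrite Ky Ly if_same.
Qed.

Section concatenation.
Context (x y z : X) (p : {path I from x to y}) (q : {path I from y to z}).

Definition concat_path (t : I) : X :=
  if itv01_val t <= 2^-1
  then p (itv01_clamp (2 * itv01_val t + 0))
  else q (itv01_clamp (2 * itv01_val t + -1)).

Fact concat_path_zero : concat_path zero = x.
Proof.
rewrite /concat_path itv01_val0 ifT ?itv01_clamp_le0 ?path_zero //; lra.
Qed.

Fact concat_path_one : concat_path one = z.
Proof.
rewrite /concat_path itv01_val1 ifF ?itv01_clamp_ge1 ?path_one //; lra.
Qed.

Fact concat_path_continuous : continuous concat_path.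
Proof.
apply: pasting_continuous; first exact: itv01_val_continuous.
- apply: continuous_compose (@cts_fun _ _ _).
  exact/clamp_affine_continuous/itv01_val_continuous.
- apply: continuous_compose (@cts_fun _ _ _).
  exact/clamp_affine_continuous/itv01_val_continuous.
- move=> t ->; rewrite itv01_clamp_ge1 ?itv01_clamp_le0; [|lra..].
  by rewrite path_one path_zero.
Qed.

HB.instance Definition _ := isContinuous.Build I X concat_path
  concat_path_continuous.
HB.instance Definition _ := isPath.Build I X x z concat_path
  concat_path_zero concat_path_one.

End concatenation.

Section reversal.
Context (x y : X) (p : {path I from x to y}).

Definition reverse_path (t : I) : X :=
  p (itv01_clamp (-1 * itv01_val t + 1)).

Fact reverse_path_zero : reverse_path zero = y.
Proof.
rewrite /reverse_path itv01_val0 itv01_clamp_ge1 ?path_one //; lra.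
Qed.

Fact reverse_path_one : reverse_path one = x.
Proof.
rewrite /reverse_path itv01_val1 itv01_clamp_le0 ?path_zero //; lra.
Qed.

Fact reverse_path_continuous : continuous reverse_path.
Proof.
apply: continuous_compose (@cts_fun _ _ _).
exact/clamp_affine_continuous/itv01_val_continuous.
Qed.

HB.instance Definition _ := isContinuous.Build I X reverse_path
  reverse_path_continuous.
HB.instance Definition _ := isPath.Build I X y x reverse_path
  reverse_path_zero reverse_path_one.

End reversal.

Lemma concat_path_homotopic x y z (p p' : {path I from x to y})
    (q q' : {path I from y to z}) :
  path_homotopic p p' -> path_homotopic q q' ->
  path_homotopic [the {path I from x to z} of concat_path p q]
                 [the {path I from x to z} of concat_path p' q'].
Proof.
move=> [K [cK K0 K1 Kx Ky]] [L [cL L0 L1 Lx Ly]].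
exists (fun st => if itv01_val st.2 <= 2^-1
  then K (st.1, itv01_clamp (2 * itv01_val st.2 + 0))
  else L (st.1, itv01_clamp (2 * itv01_val st.2 + -1))).
split=> [|t|t|s|s].
- apply: pasting_continuous; first exact: val_snd_continuous.
  + apply: continuous_compose cK; apply: continuous_pair => [st|].
      exact: cvg_fst.
    exact/clamp_affine_continuous/val_snd_continuous.
  + apply: continuous_compose cL; apply: continuous_pair => [st|].
      exact: cvg_fst.
    exact/clamp_affine_continuous/val_snd_continuous.
  + move=> st ->; rewrite itv01_clamp_ge1 ?itv01_clamp_le0; [|lra..].
    by rewrite Ky Lx.
- by rewrite /= /concat_path K0 L0.
- by rewrite /= /concat_path K1 L1.
- by rewrite itv01_val0 ifT ?itv01_clamp_le0 ?Kx //; lra.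
- by rewrite itv01_val1 ifF ?itv01_clamp_ge1 ?Ly //; lra.
Qed.

(* Two reparametrizations of one path are homotopic as soon as they have the
   same endpoints, by linear interpolation of the parameters. *)
Lemma reparam_homotopic x y x' y' (f : {path I from x' to y'}) (a b : R -> R)
    (p q : {path I from x to y}) :
  continuous a -> continuous b -> a 0 = b 0 -> a 1 = b 1 ->
  (forall t, p t = f (itv01_clamp (a (itv01_val t)))) ->
  (forall t, q t = f (itv01_clamp (b (itv01_val t)))) ->
  path_homotopic p q.
Proof.
move=> ca cb ab0 ab1 pE qE.
exists (fun st => f (itv01_clamp ((1 - itv01_val st.1) * a (itv01_val st.2) +
   itv01_val st.1 * b (itv01_val st.2)))).
split=> [|t|t|s|s] /=.
- apply: continuous_compose (@cts_fun _ _ _).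
  apply: continuous_compose (@itv01_clamp_continuous R) => st.
  have := val_fst_continuous (x := st); have := val_snd_continuous (x := st).
  move=> c2 c1; apply: cvgD; apply: cvgM.
  + by apply: cvgB; [exact: cvg_cst|exact: c1].
  + exact: (continuous_compose val_snd_continuous ca).
  + exact: c1.
  + exact: (continuous_compose val_snd_continuous cb).
- by rewrite itv01_val0 pE; congr (f (itv01_clamp _)); ring.
- by rewrite itv01_val1 qE; congr (f (itv01_clamp _)); ring.
- rewrite -[RHS](path_zero (s := p)) pE itv01_val0 ab0.
  by congr (f (itv01_clamp _)); ring.
- rewrite -[RHS](path_one (s := p)) pE itv01_val1 ab1.
  by congr (f (itv01_clamp _)); ring.
Qed.

End path_homotopy.

Section fundamental_group.
Context (R : realType) (X : topologicalType) (x0 : X).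
Notation I := (unit_interval R).

Definition loop : Type := {path I from x0 to x0}.
HB.instance Definition _ := Choice.on loop.

Implicit Types p q r : loop.

Definition loop_mul p q : loop := concat_path p q.
Definition loop_inv p : loop := reverse_path p.
Definition loop_one : loop := [the {path I from x0 to x0} of cst x0].

Definition loop_rel : rel loop := fun p q => `[< path_homotopic p q >].

Fact loop_rel_refl : reflexive loop_rel.
Proof. by move=> p; apply/asboolP; exact: path_homotopic_refl. Qed.

Fact loop_rel_sym : symmetric loop_rel.
Proof. by move=> p q; apply/asboolP/asboolP; exact: path_homotopic_sym. Qed.

Fact loop_rel_trans : transitive loop_rel.
Proof.
move=> q p r /asboolP pq /asboolP qr.
by apply/asboolP; exact: path_homotopic_trans pq qr.
Qed.

Canonical loop_equiv_rel :=
  EquivRel loop_rel loop_rel_refl loop_rel_sym loop_rel_trans.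

Definition fundamental_group : Type := {eq_quot loop_rel}.
HB.instance Definition _ := Choice.on fundamental_group.

Definition loop_class p : fundamental_group := \pi_({eq_quot loop_rel}) p.

Lemma loop_classP p q : loop_class p = loop_class q <-> path_homotopic p q.
Proof.
split=> [pq|pq]; last by apply/eqmodP/asboolP.
by apply/asboolP; move/eqmodP: pq.
Qed.

Definition loop_repr (a : fundamental_group) : loop := repr a.

Lemma loop_reprK a : loop_class (loop_repr a) = a.
Proof. by rewrite /loop_class /loop_repr reprK. Qed.

Lemma loop_classW (P : fundamental_group -> Prop) :
  (forall p, P (loop_class p)) -> forall a, P a.
Proof. by move=> Pp a; rewrite -(loop_reprK a). Qed.

Lemma loop_repr_class p : path_homotopic (loop_repr (loop_class p)) p.
Proof. by apply/loop_classP; rewrite loop_reprK. Qed.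

Lemma affine_continuous (a b : R) : continuous (fun t : R => a * t + b).
Proof.
move=> t; apply: cvgD; last exact: cvg_cst.
by apply: cvgM; [exact: cvg_cst|exact: cvg_id].
Qed.

Lemma loop_mul_clamp p q (r : R) : loop_mul p q (itv01_clamp r) =
  if r <= 2^-1 then p (itv01_clamp (2 * r + 0))
  else q (itv01_clamp (2 * r + -1)).
Proof.
rewrite /loop_mul /= /concat_path.
have [r0|r0] := lerP r 0.
  rewrite (itv01_clamp_le0 r0) itv01_val0 !ifT; [|lra..].
  by rewrite !itv01_clamp_le0 //; lra.
have [r1|r1] := lerP 1 r.
  rewrite (itv01_clamp_ge1 r1) itv01_val1 !ifF; [|lra..].
  by rewrite !itv01_clamp_ge1 //; lra.
suff -> : itv01_val (itv01_clamp r) = r by [].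
by rewrite /itv01_val /= (min_idPl (ltW r1)) (max_idPr (ltW r0)).
Qed.

Lemma loop_mulE p q (t : I) : loop_mul p q t =
  if itv01_val t <= 2^-1 then p (itv01_clamp (2 * itv01_val t + 0))
  else q (itv01_clamp (2 * itv01_val t + -1)).
Proof. by []. Qed.

Lemma loop_inv_clamp p (r : R) :
  loop_inv p (itv01_clamp r) = p (itv01_clamp (-1 * r + 1)).
Proof.
rewrite /loop_inv /= /reverse_path.
have [r0|r0] := lerP r 0.
  rewrite (itv01_clamp_le0 r0) itv01_val0 !itv01_clamp_ge1 //; lra.
have [r1|r1] := lerP 1 r.
  rewrite (itv01_clamp_ge1 r1) itv01_val1 !itv01_clamp_le0 //; lra.
suff -> : itv01_val (itv01_clamp r) = r by [].
by rewrite /itv01_val /= (min_idPl (ltW r1)) (max_idPr (ltW r0)).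
Qed.

Lemma loop_mulA p q r :
  path_homotopic (loop_mul p (loop_mul q r)) (loop_mul (loop_mul p q) r).
Proof.
apply: path_homotopic_sym; pose f := loop_mul p (loop_mul q r).
apply: (reparam_homotopic (f := f)
  (a := fun t => if t <= 2^-1 then (if t <= 4^-1 then 2 * t + 0
                                    else 1 * t + 4^-1) else 2^-1 * t + 2^-1)
  (b := fun t => 1 * t + 0)).
- apply: (pasting_continuous (c := id)); [by move=> t; exact: cvg_id| | |].
  + apply: (pasting_continuous (c := id)); [by move=> t; exact: cvg_id| | |].
    * exact: affine_continuous.
    * exact: affine_continuous.
    * by move=> t ->; lra.
  + exact: affine_continuous.
  + by move=> t -> /=; case: lerP => ?; lra.
- exact: affine_continuous.
- by case: (lerP _ 4^-1) => ?; case: lerP => ?; lra.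
- by case: (lerP _ 4^-1) => ?; case: lerP => ?; lra.
- move=> t; rewrite loop_mulE !loop_mul_clamp; move: (itv01_val t) => s.
  case: (lerP s 4^-1) => ?; case: (lerP s 2^-1) => ?;
  repeat (case: lerP => ?);
  solve [exfalso; lra | congr (p (itv01_clamp _)); lra
        | congr (q (itv01_clamp _)); lra | congr (r (itv01_clamp _)); lra].
- by move=> t; rewrite mul1r addr0 itv01_valK.
Qed.

Lemma loop_mul1 p : path_homotopic (loop_mul loop_one p) p.
Proof.
apply: (reparam_homotopic (f := p)
  (a := fun t => if t <= 2^-1 then 0 * t + 0 else 2 * t + -1)
  (b := fun t => 1 * t + 0)).
- apply: (pasting_continuous (c := id)); [by move=> t; exact: cvg_id| | |].
  + exact: affine_continuous.
  + exact: affine_continuous.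
  + by move=> t ->; lra.
- exact: affine_continuous.
- by case: lerP => ?; lra.
- by case: lerP => ?; lra.
- move=> t; rewrite loop_mulE; case: lerP => // _.
  by rewrite [in RHS]itv01_clamp_le0 ?path_zero //; lra.
- by move=> t; rewrite mul1r addr0 itv01_valK.
Qed.

Lemma loop_mulr1 p : path_homotopic (loop_mul p loop_one) p.
Proof.
apply: (reparam_homotopic (f := p)
  (a := fun t => if t <= 2^-1 then 2 * t + 0 else 0 * t + 1)
  (b := fun t => 1 * t + 0)).
- apply: (pasting_continuous (c := id)); [by move=> t; exact: cvg_id| | |].
  + exact: affine_continuous.
  + exact: affine_continuous.
  + by move=> t ->; lra.
- exact: affine_continuous.
- by case: lerP => ?; lra.
- by case: lerP => ?; lra.
- move=> t; rewrite loop_mulE; case: lerP => // _.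
  by rewrite [in RHS]itv01_clamp_ge1 ?path_one //; lra.
- by move=> t; rewrite mul1r addr0 itv01_valK.
Qed.

Lemma loop_mulV p : path_homotopic (loop_mul p (loop_inv p)) loop_one.
Proof.
apply: (reparam_homotopic (f := p)
  (a := fun t => if t <= 2^-1 then 2 * t + 0 else (- 2) * t + 2)
  (b := fun t => 0 * t + 0)).
- apply: (pasting_continuous (c := id)); [by move=> t; exact: cvg_id| | |].
  + exact: affine_continuous.
  + exact: affine_continuous.
  + by move=> t ->; lra.
- exact: affine_continuous.
- by case: lerP => ?; lra.
- by case: lerP => ?; lra.
- move=> t; rewrite loop_mulE loop_inv_clamp; case: lerP => // _.
  by congr (p (itv01_clamp _)); ring.
- by move=> t; rewrite itv01_clamp_le0 ?path_zero //; lra.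
Qed.

Definition pi1_mul (a b : fundamental_group) : fundamental_group :=
  loop_class (loop_mul (loop_repr a) (loop_repr b)).
Definition pi1_inv (a : fundamental_group) : fundamental_group :=
  loop_class (loop_inv (loop_repr a)).
Definition pi1_one : fundamental_group := loop_class loop_one.

Lemma pi1_mulE p q :
  pi1_mul (loop_class p) (loop_class q) = loop_class (loop_mul p q).
Proof. by apply/loop_classP/concat_path_homotopic; exact: loop_repr_class. Qed.

Fact pi1_mulA : associative pi1_mul.
Proof.
elim/loop_classW => p; elim/loop_classW => q; elim/loop_classW => r.
by rewrite !pi1_mulE; apply/loop_classP; exact: loop_mulA.
Qed.

Fact pi1_mul1 : left_id pi1_one pi1_mul.
Proof.
elim/loop_classW => p; rewrite pi1_mulE.
by apply/loop_classP; exact: loop_mul1.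
Qed.

Fact pi1_mulr1 : right_id pi1_one pi1_mul.
Proof.
elim/loop_classW => p; rewrite pi1_mulE.
by apply/loop_classP; exact: loop_mulr1.
Qed.

Fact pi1_mulV : right_inverse pi1_one pi1_inv pi1_mul.
Proof.
move=> a; rewrite -[a in pi1_mul a]loop_reprK pi1_mulE.
by apply/loop_classP; exact: loop_mulV.
Qed.

Fact pi1_mulVl : left_inverse pi1_one pi1_inv pi1_mul.
Proof.
move=> a; rewrite -[LHS]pi1_mulr1 -{1}(pi1_mulV (pi1_inv a)).
rewrite -[LHS]pi1_mulA [X in pi1_mul _ X]pi1_mulA pi1_mulV pi1_mul1.
exact: pi1_mulV.
Qed.

HB.instance Definition _ := isGroup.Build fundamental_group
  pi1_mulA pi1_mul1 pi1_mulr1 pi1_mulVl pi1_mulV.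

End fundamental_group.

Section braid_group.
Context (R : realType) (m : nat) (M : topologicalType).

Definition ordered_configuration : Type :=
  set_type [set y : {ptws 'I_m -> M} | forall i j, i != j -> y i <> y j].
HB.instance Definition _ := Topological.on ordered_configuration.

Definition permuted (y z : ordered_configuration) : Prop :=
  exists s : 'S_m, forall i, \val z i = \val y (s i).

Definition permuted_rel : rel ordered_configuration :=
  fun y z => `[< permuted y z >].

Fact permuted_rel_refl : reflexive permuted_rel.
Proof. by move=> y; apply/asboolP; exists 1%g => i; rewrite perm1. Qed.

Fact permuted_rel_sym : symmetric permuted_rel.
Proof.
by move=> y z; apply/asboolP/asboolP => -[s sP]; exists s^-1%g => i;
  rewrite sP permKV.
Qed.

Fact permuted_rel_trans : transitive permuted_rel.
Proof.
move=> z y w /asboolP[s sP] /asboolP[s' s'P]; apply/asboolP.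
by exists (s' * s)%g => i; rewrite s'P sP permM.
Qed.

Canonical permuted_equiv_rel := EquivRel permuted_rel
  permuted_rel_refl permuted_rel_sym permuted_rel_trans.

Definition unordered_configuration : Type :=
  quotient_topology {eq_quot permuted_rel}.
HB.instance Definition _ := Topological.on unordered_configuration.

Definition braid_group (b : unordered_configuration) : groupType :=
  fundamental_group R b.

End braid_group.
Arguments braid_group : clear implicits.

Definition sphere2 (R : realType) : Type :=
  set_type [set x : 'rV[R]_3 | \sum_i x 0 i ^+ 2 = 1].
HB.instance Definition _ (R : realType) := Topological.on (sphere2 R).

Definition twice_punctured_sphere (R : realType) (x1 x2 : sphere2 R) : Type :=
  set_type (~` [set x1; x2]).
HB.instance Definition _ (R : realType) (x1 x2 : sphere2 R) :=
  Topological.on (twice_punctured_sphere x1 x2).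

(* Main.v *)
(* The configuration {z1, z2} in C^* (the twice punctured sphere) is determined
   by s = z1 + z2 and p = z1 z2, subject to p <> 0 and s^2 <> 4p.  With q a square
   root of p and v = s / (2 q), the pair (v, q) runs over (C - {1, -1}) x C^*, up
   to the simultaneous change of sign of v and q.  Lifting the argument of q, and
   recording in Z_2 * Z how v crosses the cuts (-oo, -1] and [1, +oo), where a
   half turn of q exchanges the two cuts, gives two monodromies of the braid
   group: a surjective one onto Z_2 * Z, and the variation of the argument of q,
   with values in R.  They are jointly injective: when both are trivial, v is a
   loop in C - {1, -1} with trivial crossing word, hence null-homotopic, and q
   contracts along its logarithm.  As R is abelian, the kernel of the first
   monodromy meets the commutator subgroup trivially, so the derived subgroups of
   the braid group are isomorphic to those of Z_2 * Z, which are the images of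
   those of Z * Z. *)

From HB Require Import structures.
Require Import Defs.
From mathcomp Require Import all_boot all_order all_algebra perm.
From mathcomp Require Import boolp classical_sets functions reals set_interval.
From mathcomp Require Import topology normedtype continuous_path.
From mathcomp Require Import complex trigo realfun ring lra.
From Stdlib Require Import Relations.Relation_Operators.

Set Implicit Arguments.
Unset Strict Implicit.
Unset Printing Implicit Defensive.

Import Order.TTheory GRing.Theory Num.Theory numFieldNormedType.Exports.
Local Open Scope classical_set_scope.
Local Open Scope ring_scope.
Local Open Scope quotient_scope.

(** * Derived series and free products *)

(** Labels do the work of a covering space. Over each of three charts of the plane minus the
    punctures a label is a constant times a prescribed [weight], so whether two lifts agree is
    locally constant; existence and uniqueness along paths and squares follow by moving in small
    steps. Label jumps multiply on the right and the group part of a deck transformation on the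
    left, and because the two commute, monodromy is multiplicative. The obstacle is that the shape v
    is known only up to sign. Crossings are therefore recorded in a group where the sign change is
    inner: a crossing of the right cut is t, one of the left cut is s t s, and conjugation by s is
    the effect of v -> -v. Injectivity asks that the label of a loop determine its homotopy class.
    For this Z_2 * Z acts on two copies of the fundamental group of the punctured plane, with t and
    s t s acting on the first copy as the loops around the two punctures. Along a path, the action
    of the label change is compared chart by chart with multiplication by the class of the path. *)

Section derived_series_theory.
Local Open Scope group_scope.

Lemma subgroup_generated_subgroup (G : groupType) (S : set G) :
  is_subgroup (subgroup_generated S).
Proof.
split=> [A [[A1 _] _] //|x y Sx Sy A AS].
by have [[_ AV] _] := AS; apply: AV; [exact: Sx|exact: Sy].
Qed.

Lemma sub_subgroup_generated (G : groupType) (S : set G) :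
  S `<=` subgroup_generated S.
Proof. by move=> x Sx A [_]; apply. Qed.

Lemma subgroup_generated_min (G : groupType) (S A : set G) :
  is_subgroup A -> S `<=` A -> subgroup_generated S `<=` A.
Proof. by move=> sA SA x; apply. Qed.

Lemma derived_series_subgroup (G : groupType) i :
  is_subgroup (derived_series G i).
Proof. by case: i => [|i] //; exact: subgroup_generated_subgroup. Qed.

Section morphism.
Context (G H : groupType) (f : G -> H).
Hypothesis fM : {morph f : x y / x * y}.

Lemma morph1 : f 1 = 1.
Proof. by apply: (@mulgI _ (f 1)); rewrite -fM !mulg1. Qed.

Lemma morphV : {morph f : x / x^-1}.
Proof. by move=> x; apply: (@mulgI _ (f x)); rewrite -fM !mulgV morph1. Qed.

Lemma morph_commg : {morph f : x y / [~ x, y]}.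
Proof. by move=> x y; rewrite /commg /conjg !(fM, morphV). Qed.

Lemma image_subgroup (A : set G) : is_subgroup A -> is_subgroup (f @` A).
Proof.
move=> [A1 AV]; split; first by exists 1 => //; exact: morph1.
by move=> _ _ [x Ax <-] [y Ay <-]; exists (x / y); rewrite ?fM ?morphV; auto.
Qed.

Lemma preimage_subgroup (A : set H) : is_subgroup A -> is_subgroup (f @^-1` A).
Proof.
by move=> [A1 AV]; split=> [|x y]; rewrite /preimage/= ?morph1 ?fM ?morphV; auto.
Qed.

Lemma image_subgroup_generated (S : set G) :
  f @` subgroup_generated S = subgroup_generated (f @` S).
Proof.
apply/seteqP; split.
  suff SfS : subgroup_generated S `<=` f @^-1` subgroup_generated (f @` S).
    by move=> _ [x Sx <-]; exact: SfS.
  apply: subgroup_generated_min.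
    by apply: preimage_subgroup; exact: subgroup_generated_subgroup.
  by move=> x Sx; apply: sub_subgroup_generated; exists x.
apply: (@subgroup_generated_min H).
  by apply: image_subgroup; exact: subgroup_generated_subgroup.
by apply: image_subset; exact: sub_subgroup_generated.
Qed.

(** Surjectivity enters at stage 0 only; from then on commutators of images are images of
    commutators. *)
Lemma image_derived_series i :
  f @` [set: G] = [set: H] -> f @` derived_series G i = derived_series H i.
Proof.
move=> fT; elim: i => //= i IH.
rewrite /commutator_subgroup image_subgroup_generated -IH.
congr (@subgroup_generated H _).
apply/seteqP; split=> [_ [_ [a Aa [b Ab <-]] <-]|_ [_ [a Aa <-] [_ [b Ab <-] <-]]].
  by exists (f a); [exists a|exists (f b); [exists b|rewrite morph_commg]].
by exists [~ a, b]; [exists a => //; exists b|rewrite morph_commg].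
Qed.

End morphism.

(** [chi] kills commutators, so it vanishes on every derived subgroup of positive index; there the
    joint hypothesis says that [phi] alone has trivial kernel. *)
Lemma isomorphic_derived_series (B Q : groupType) (A : zmodType)
    (phi : B -> Q) (chi : B -> A) i :
  {morph phi : x y / x * y} -> phi @` setT = setT ->
  {morph chi : x y / x * y >-> (x + y)%R} ->
  (forall x, phi x = 1 -> chi x = 0%R -> x = 1) -> (0 < i)%N ->
  isomorphic_subgroups (derived_series B i) (derived_series Q i).
Proof.
move=> phiM phiT chiM phichi; case: i => // i _.
have chi0 : derived_series B i.+1 `<=` [set x | chi x = 0%R].
  have chi1 : chi 1 = 0%R by apply: (addrI (chi 1)); rewrite -chiM mulg1 addr0.
  have chiV x : chi x^-1 = (- chi x)%R.
    by apply: (addrI (chi x)); rewrite -chiM mulgV chi1 addrN.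
  apply: subgroup_generated_min; first split=> //= x y x0 y0.
    by rewrite chiM chiV x0 y0 subr0.
  move=> _ [a _ [b _ <-]] /=.
  by rewrite /commg /conjg !(chiM, chiV) addrCA addKr addNr.
exists phi; split; first by move=> x y _ _; exact: phiM.
split=> [x Dx|x y /set_mem Dx /set_mem Dy phixy|].
- by rewrite -(image_derived_series phiM _ phiT); exists x.
- rewrite -(divgK y x); suff -> : x / y = 1 by rewrite mul1g.
  have [_ Dxy] := derived_series_subgroup B i.+1.
  apply: phichi; last exact: (chi0 _ (Dxy _ _ Dx Dy)).
  by rewrite phiM (morphV phiM) phixy mulgV.
- by rewrite -(image_derived_series phiM _ phiT).
Qed.

End derived_series_theory.

Section free_product_theory.
Local Open Scope group_scope.
Context (G H : groupType).

Lemma fp_inlM : {morph @fp_inl G H : a b / a * b}.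
Proof.
move=> a b; rewrite [RHS]fp_mulE; apply/esym/fp_wordP/rst_step.
exact: (fp_mull [::] [::]).
Qed.

Lemma fp_inrM : {morph @fp_inr G H : a b / a * b}.
Proof.
move=> a b; rewrite [RHS]fp_mulE; apply/esym/fp_wordP/rst_step.
exact: (fp_mulr [::] [::]).
Qed.

(** A word is the product of its letters, and inverses of letters are again letters, so closure
    under products suffices. *)
Lemma free_product_subgroupT (A : set (free_product G H)) :
  (forall x y, A x -> A y -> A (x * y)) -> A 1 ->
  (forall a, A (fp_inl H a)) -> (forall b, A (fp_inr G b)) -> A = setT.
Proof.
move=> AM A1 Al Ar; apply/seteqP; split=> // x _.
have [w ->] := fp_word_repr x; elim: w => // -[a|b] w IH.
  by rewrite (_ : fp_word _ = fp_inl H a * fp_word w) ?[RHS]fp_mulE; auto.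
by rewrite (_ : fp_word _ = fp_inr G b * fp_word w) ?[RHS]fp_mulE; auto.
Qed.

Section action.
Context (S : Type) (actl : S -> G -> S) (actr : S -> H -> S).
Hypotheses (actl1 : forall x, actl x 1 = x) (actr1 : forall x, actr x 1 = x).
Hypotheses (actlM : forall x a b, actl x (a * b) = actl (actl x a) b).
Hypotheses (actrM : forall x a b, actr x (a * b) = actr (actr x a) b).

Definition letter_act x (l : G + H) :=
  match l with inl a => actl x a | inr b => actr x b end.

Definition fp_act (x : S) (g : free_product G H) : S :=
  foldl letter_act x (fp_repr g).

(** The four generating steps of the congruence on words are matched by the four axioms of the two
    actions, so the choice of representative does not matter. This is the universal property of the
    free product, for right actions. *)
Lemma fp_act_word x w : fp_act x (fp_word w) = foldl letter_act x w.
Proof.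
rewrite /fp_act; have := fp_repr_word w; move: (fp_repr _) => v vw.
elim: vw x => {v w} [_ _ [] u v *|//|u v _ IH y|u v w _ uv _ vw y].
- by rewrite !foldl_cat /= actlM.
- by rewrite !foldl_cat /= actrM.
- by rewrite !foldl_cat /= actl1.
- by rewrite !foldl_cat /= actr1.
- by rewrite IH.
- by rewrite uv vw.
Qed.

Lemma fp_actM x g h : fp_act x (g * h) = fp_act (fp_act x g) h.
Proof.
have [[u ->] [v ->]] := conj (fp_word_repr g) (fp_word_repr h).
by rewrite [_ * _]fp_mulE !fp_act_word foldl_cat.
Qed.

Lemma fp_act1 x : fp_act x 1 = x.
Proof. exact: (fp_act_word x [::]). Qed.

Lemma fp_act_inl x a : fp_act x (fp_inl H a) = actl x a.
Proof. exact: (fp_act_word x [:: inl a]). Qed.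

Lemma fp_act_inr x b : fp_act x (fp_inr G b) = actr x b.
Proof. exact: (fp_act_word x [:: inr b]). Qed.

End action.

End free_product_theory.

Lemma mod2_first_surjective : mod2_first @` setT = setT.
Proof.
apply: free_product_subgroupT => [x y [a _ <-] [b _ <-]||a|b].
- by exists (a * b)%g => //; exact: gmulfM.
- by exists 1%g => //; exact: gmulf1.
- exists (fp_inl Zgroup ((val a)%:Z : Zgroup)) => //.
  rewrite [LHS]free_product_map_inl; congr (fp_inl _ _).
  exact: natr_Zp.
- by exists (fp_inr Zgroup b) => //; exact: free_product_map_inr.
Qed.

(** * The path groupoid *)

(** Compactness of [c, d] as an induction principle: with [S] the set of points reached from [c], a
    point of [S] close to [sup S] can be prolonged past [sup S], which is absurd, unless [d] is
    already within its reach. *)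
Lemma interval_induction (R : realType) (c d : R) (Q : R -> R -> Prop) :
  c <= d ->
  (forall x, c <= x <= d -> exists2 e, 0 < e &
    forall a b, x - e < a -> a <= b -> b < x + e -> Q a b) ->
  (forall x y z, x <= y -> y <= z -> Q x y -> Q y z -> Q x z) ->
  Q c d.
Proof.
move=> cd loc add; pose S : set R := [set x | c <= x <= d /\ Q c x].
have Qc : Q c c.
  have [|e e0 He] := loc c; first by rewrite lexx.
  by apply: He => //; lra.
have Sc : S c by split=> //; rewrite lexx.
have supS : has_sup S by split; [exists c|exists d => x [/andP[]]].
have /andP[cs sd] : c <= sup S <= d.
  rewrite (ub_le_sup supS.2 Sc) /=.
  by apply: ge_sup; [exists c|move=> x [/andP[]]].
have [|e e0 He] := loc (sup S); first by rewrite cs.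
have [y [/andP[cy yd] Qy] ye] := sup_adherent e0 supS.
have ys : y <= sup S by apply: ub_le_sup; [exact: supS.2|split; rewrite ?cy].
have [ds|ds] := leP (sup S + e / 2) d.
  suff Sx : S (sup S + e / 2).
    by have := ub_le_sup supS.2 Sx; lra.
  split; first by apply/andP; split; lra.
  by apply: (add _ y) => //; [lra|apply: He; lra].
by apply: (add _ y) => //; apply: He => //; lra.
Qed.

Section path_groupoid.
Context (R : realType) (X : topologicalType).
Notation I := (unit_interval R).
Implicit Types x y z w : X.

Definition hpath_rel x y : rel {path I from x to y} :=
  fun p q => `[< path_homotopic p q >].

Fact hpath_rel_refl x y : reflexive (@hpath_rel x y).
Proof. by move=> p; apply/asboolP; exact: path_homotopic_refl. Qed.

Fact hpath_rel_sym x y : symmetric (@hpath_rel x y).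
Proof. by move=> p q; apply/asboolP/asboolP; exact: path_homotopic_sym. Qed.

Fact hpath_rel_trans x y : transitive (@hpath_rel x y).
Proof.
move=> q p r /asboolP pq /asboolP qr.
by apply/asboolP; exact: path_homotopic_trans pq qr.
Qed.

Canonical hpath_equiv_rel x y := EquivRel (@hpath_rel x y)
  (@hpath_rel_refl x y) (@hpath_rel_sym x y) (@hpath_rel_trans x y).

(** Endpoints are arbitrary, since cutting a loop into pieces and changing the base point both lead
    outside a single fundamental group. *)
Definition hpath x y : Type := {eq_quot (@hpath_rel x y)}.

Definition hclass x y (p : {path I from x to y}) : hpath x y :=
  \pi_({eq_quot (@hpath_rel x y)}) p.

Lemma hclassP x y (p q : {path I from x to y}) :
  hclass p = hclass q <-> path_homotopic p q.
Proof.
split=> [pq|pq]; last by apply/eqmodP/asboolP.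
by apply/asboolP; move/eqmodP: pq.
Qed.

Definition hrepr x y (a : hpath x y) : {path I from x to y} := repr a.

Lemma hreprK x y (a : hpath x y) : hclass (hrepr a) = a.
Proof. by rewrite /hclass /hrepr reprK. Qed.

Lemma hclassW x y (P : hpath x y -> Prop) :
  (forall p, P (hclass p)) -> forall a, P a.
Proof. by move=> Pp a; rewrite -(hreprK a). Qed.

Lemma hrepr_hclass x y (p : {path I from x to y}) :
  path_homotopic (hrepr (hclass p)) p.
Proof. by apply/hclassP; rewrite hreprK. Qed.

Lemma itv01_clampK (r : R) : 0 <= r <= 1 -> itv01_val (itv01_clamp r) = r.
Proof.
by move=> /andP[r0 r1]; rewrite /itv01_val /= (min_idPl r1) (max_idPr r0).
Qed.

Lemma concat_path_clamp x y z (p : {path I from x to y})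
    (q : {path I from y to z}) (r : R) :
  concat_path p q (itv01_clamp r) =
  if r <= 2^-1 then p (itv01_clamp (2 * r + 0))
  else q (itv01_clamp (2 * r + -1)).
Proof.
rewrite /concat_path.
have [r0|r0] := lerP r 0.
  rewrite (itv01_clamp_le0 r0) itv01_val0 !ifT; [|lra..].
  by rewrite !itv01_clamp_le0 //; lra.
have [r1|r1] := lerP 1 r.
  rewrite (itv01_clamp_ge1 r1) itv01_val1 !ifF; [|lra..].
  by rewrite !itv01_clamp_ge1 //; lra.
by rewrite itv01_clampK // (ltW r0) (ltW r1).
Qed.

Lemma reverse_path_clamp x y (p : {path I from x to y}) (r : R) :
  reverse_path p (itv01_clamp r) = p (itv01_clamp (-1 * r + 1)).
Proof.
rewrite /reverse_path.
have [r0|r0] := lerP r 0.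
  rewrite (itv01_clamp_le0 r0) itv01_val0 !itv01_clamp_ge1 //; lra.
have [r1|r1] := lerP 1 r.
  rewrite (itv01_clamp_ge1 r1) itv01_val1 !itv01_clamp_le0 //; lra.
by rewrite itv01_clampK // (ltW r0) (ltW r1).
Qed.

Lemma path_clampE x y (p : {path I from x to y}) (t : I) :
  p t = p (itv01_clamp (1 * itv01_val t + 0)).
Proof. by rewrite mul1r addr0 itv01_valK. Qed.

Definition hmul x y z (a : hpath x y) (b : hpath y z) : hpath x z :=
  hclass [the {path I from x to z} of concat_path (hrepr a) (hrepr b)].
Definition hinv x y (a : hpath x y) : hpath y x :=
  hclass [the {path I from y to x} of reverse_path (hrepr a)].
Definition hone x : hpath x x := hclass [the {path I from x to x} of cst x].

Lemma hmulE x y z (p : {path I from x to y}) (q : {path I from y to z}) :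
  hmul (hclass p) (hclass q) =
  hclass [the {path I from x to z} of concat_path p q].
Proof. by apply/hclassP/concat_path_homotopic; exact: hrepr_hclass. Qed.

Let continuous_idR : continuous (@id R). Proof. by move=> t; exact: cvg_id. Qed.

Lemma hmulA x y z w (a : hpath x y) (b : hpath y z) (c : hpath z w) :
  hmul a (hmul b c) = hmul (hmul a b) c.
Proof.
elim/hclassW: a => p; elim/hclassW: b => q; elim/hclassW: c => r.
rewrite !hmulE; apply/esym/hclassP.
(* The change of parameter maps [0, 1/4], [1/4, 1/2] and [1/2, 1] affinely onto [0, 1/2], [1/2, 3/4]
   and [3/4, 1]. *)
apply: (reparam_homotopic (f := [the {path I from x to w} of concat_path p
    [the {path I from y to w} of concat_path q r]])
  (a := fun t => if t <= 2^-1 then (if t <= 4^-1 then 2 * t + 0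
                                    else 1 * t + 4^-1) else 2^-1 * t + 2^-1)
  (b := fun t => 1 * t + 0)) => [|||||].
- apply: (pasting_continuous (c := id)) => //.
  + apply: (pasting_continuous (c := id)) => //.
    * exact: affine_continuous.
    * exact: affine_continuous.
    * by move=> t ->; lra.
  + exact: affine_continuous.
  + by move=> t -> /=; case: lerP => ?; lra.
- exact: affine_continuous.
- by case: (lerP _ 4^-1) => ?; case: lerP => ?; lra.
- by case: (lerP _ 4^-1) => ?; case: lerP => ?; lra.
- move=> t; rewrite -[in LHS](itv01_valK t); move: (itv01_val t) => s.
  rewrite /= !concat_path_clamp /= !concat_path_clamp.
  case: (lerP s 4^-1) => ?; case: (lerP s 2^-1) => ?;
  repeat (case: lerP => ?);
  solve [exfalso; lra | congr (p (itv01_clamp _)); lra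
        | congr (q (itv01_clamp _)); lra | congr (r (itv01_clamp _)); lra].
- exact: path_clampE.
Qed.

Lemma hmul1 x y (a : hpath x y) : hmul (hone x) a = a.
Proof.
elim/hclassW: a => p; rewrite hmulE; apply/hclassP.
apply: (reparam_homotopic (f := p)
  (a := fun t => if t <= 2^-1 then 0 * t + 0 else 2 * t + -1)
  (b := fun t => 1 * t + 0)).
- apply: (pasting_continuous (c := id)) => //.
  + exact: affine_continuous.
  + exact: affine_continuous.
  + by move=> t ->; lra.
- exact: affine_continuous.
- by case: lerP => ?; lra.
- by case: lerP => ?; lra.
- move=> t; rewrite /= /concat_path; case: lerP => // _.
  by rewrite [in RHS]itv01_clamp_le0 ?path_zero //; lra.
- exact: path_clampE.
Qed.

Lemma hmulr1 x y (a : hpath x y) : hmul a (hone y) = a.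
Proof.
elim/hclassW: a => p; rewrite hmulE; apply/hclassP.
apply: (reparam_homotopic (f := p)
  (a := fun t => if t <= 2^-1 then 2 * t + 0 else 0 * t + 1)
  (b := fun t => 1 * t + 0)).
- apply: (pasting_continuous (c := id)) => //.
  + exact: affine_continuous.
  + exact: affine_continuous.
  + by move=> t ->; lra.
- exact: affine_continuous.
- by case: lerP => ?; lra.
- by case: lerP => ?; lra.
- move=> t; rewrite /= /concat_path; case: lerP => // _.
  by rewrite [in RHS]itv01_clamp_ge1 ?path_one //; lra.
- exact: path_clampE.
Qed.

Lemma hmulV x y (a : hpath x y) : hmul a (hinv a) = hone x.
Proof.
rewrite -[in X in hmul X](hreprK a) /hinv hmulE; move: (hrepr a) => p.
apply/hclassP; apply: (reparam_homotopic (f := p)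
  (a := fun t => if t <= 2^-1 then 2 * t + 0 else (- 2) * t + 2)
  (b := fun t => 0 * t + 0)).
- apply: (pasting_continuous (c := id)) => //.
  + exact: affine_continuous.
  + exact: affine_continuous.
  + by move=> t ->; lra.
- exact: affine_continuous.
- by case: lerP => ?; lra.
- by case: lerP => ?; lra.
- move=> t; rewrite /= /concat_path /= reverse_path_clamp; case: lerP => // _.
  by congr (p (itv01_clamp _)); ring.
- by move=> t; rewrite itv01_clamp_le0 ?path_zero //; lra.
Qed.

Lemma hmulVl x y (a : hpath x y) : hmul (hinv a) a = hone y.
Proof.
by rewrite -[LHS]hmulr1 -(hmulV (hinv a)) hmulA -(hmulA (hinv a)) hmulV
  hmulr1 hmulV.
Qed.

Lemma hmulK x y z (a : hpath x y) (b : hpath y z) :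
  hmul (hmul a b) (hinv b) = a.
Proof. by rewrite -hmulA hmulV hmulr1. Qed.

Lemma hmulVK x y z (a : hpath x y) (b : hpath z y) :
  hmul (hmul a (hinv b)) b = a.
Proof. by rewrite -hmulA hmulVl hmulr1. Qed.

Lemma hmulKr x y z (a : hpath x y) (b : hpath y z) :
  hmul (hinv a) (hmul a b) = b.
Proof. by rewrite hmulA hmulVl hmul1. Qed.

Definition pi1_of x (a : hpath x x) : fundamental_group R x :=
  loop_class (hrepr a : loop R x).

Lemma pi1_of_hclass x (p : loop R x) : pi1_of (hclass p) = loop_class p.
Proof. exact/loop_classP/hrepr_hclass. Qed.

Lemma pi1_ofM x (a b : hpath x x) :
  pi1_of (hmul a b) = (pi1_of a * pi1_of b)%g.
Proof.
elim/hclassW: a => p; elim/hclassW: b => q.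
by rewrite hmulE !pi1_of_hclass [RHS]pi1_mulE.
Qed.

Lemma pi1_of_one x : pi1_of (hone x) = 1%g.
Proof. exact: pi1_of_hclass. Qed.

Lemma pi1_of_inj x : injective (@pi1_of x).
Proof.
move=> a b; elim/hclassW: a => p; elim/hclassW: b => q.
by rewrite !pi1_of_hclass => /loop_classP pq; exact/hclassP.
Qed.

(* The class of a path closed up to a loop at [x0] by a chosen family of paths
   from [x0]; it turns path algebra into computations in the fundamental
   group. *)
Definition tethered x0 (c : forall x, hpath x0 x) x y (a : hpath x y) :
    fundamental_group R x0 :=
  pi1_of (hmul (hmul (c x) a) (hinv (c y))).

Lemma tetheredM x0 (c : forall x, hpath x0 x) x y z (a : hpath x y)
    (b : hpath y z) :
  tethered c (hmul a b) = (tethered c a * tethered c b)%g.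
Proof. by rewrite /tethered -pi1_ofM !hmulA hmulVK. Qed.

Lemma base_change x y (c : hpath x y) :
  exists f : fundamental_group R y -> fundamental_group R x,
    {morph f : a b / (a * b)%g} /\ bijective f.
Proof.
pose F a := hmul (hmul c a) (hinv c); pose G a := hmul (hmul (hinv c) a) c.
pose lift z (a : fundamental_group R z) : hpath z z := hclass (loop_repr a).
have liftK z a : pi1_of (@lift z a) = a.
  by rewrite pi1_of_hclass loop_reprK.
have liftM z a b : @lift z (a * b)%g = hmul (lift _ a) (lift _ b).
  by apply: pi1_of_inj; rewrite pi1_ofM !liftK.
have ofK z a : lift _ (@pi1_of z a) = a by apply: pi1_of_inj; rewrite liftK.
exists (fun a => pi1_of (F (lift _ a))); split=> [a b|].
  by rewrite -pi1_ofM liftM /F !hmulA hmulVK.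
exists (fun a => pi1_of (G (lift _ a))) => a.
  by rewrite ofK /F /G -!hmulA hmulKr hmulVl hmulr1 liftK.
by rewrite ofK /F /G -!hmulA hmulV hmulr1 hmulA hmulV hmul1 liftK.
Qed.

(** Two parameter curves in the plane with the same ends are homotopic by linear interpolation, and
    [F] carries this homotopy to [X]. *)
Lemma plane_homotopic x y (F : R * R -> X) (a1 a2 b1 b2 : I -> R)
    (p q : {path I from x to y}) :
  continuous F -> continuous a1 -> continuous a2 ->
  continuous b1 -> continuous b2 ->
  a1 zero = b1 zero -> a2 zero = b2 zero ->
  a1 one = b1 one -> a2 one = b2 one ->
  (forall t, p t = F (a1 t, a2 t)) -> (forall t, q t = F (b1 t, b2 t)) ->
  path_homotopic p q.
Proof.
move=> cF ca1 ca2 cb1 cb2 e10 e20 e11 e21 pE qE.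
pose mix (a b : I -> R) (st : I * I) : R :=
  (1 - itv01_val st.1) * a st.2 + itv01_val st.1 * b st.2.
have cmix a b : continuous a -> continuous b -> continuous (mix a b).
  move=> ca cb st; have c1 := @val_fst_continuous R st.
  have cs (c : I -> R) : continuous c -> {for st, continuous (fun u => c u.2)}.
    move=> cc; apply: continuous_comp; [exact: cvg_snd|exact: cc].
  by apply: cvgD; apply: cvgM;
    [apply: cvgB; [exact: cvg_cst|exact: c1]|exact: cs|exact: c1|exact: cs].
exists (fun st => F (mix a1 b1 st, mix a2 b2 st)); split=> [|t|t|s|s].
- by apply: continuous_compose cF; apply: continuous_pair; apply: cmix.
- by rewrite pE /mix /= itv01_val0; congr (F (_, _)); ring.
- by rewrite qE /mix /= itv01_val1; congr (F (_, _)); ring.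
- rewrite -[RHS](path_zero (s := p)) pE /mix /= -e10 -e20.
  by congr (F (_, _)); ring.
- rewrite -[RHS](path_one (s := p)) pE /mix /= -e11 -e21.
  by congr (F (_, _)); ring.
Qed.

Lemma affine_val_continuous (k d : R) :
  continuous (fun t : I => k * itv01_val t + d).
Proof.
have ca : continuous (fun s : R => k * s + d) by exact: affine_continuous.
exact: continuous_compose (@itv01_val_continuous R) ca.
Qed.

(** The two ways around the unit square: [(u, v)] follows the bottom and right sides, [(v, u)] the
    left and top ones. *)
Lemma square_homotopic x y z w (F : R * R -> X) (p : {path I from x to y})
    (r : {path I from y to w}) (l : {path I from x to z})
    (q : {path I from z to w}) :
  continuous F ->
  (forall t, p t = F (itv01_val t, 0)) -> (forall t, q t = F (itv01_val t, 1)) ->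
  (forall t, l t = F (0, itv01_val t)) -> (forall t, r t = F (1, itv01_val t)) ->
  hmul (hclass p) (hclass r) = hmul (hclass l) (hclass q).
Proof.
move=> cF pE qE lE rE; rewrite !hmulE; apply/hclassP.
pose u (t : I) : R := if itv01_val t <= 2^-1 then 2 * itv01_val t + 0
                      else 0 * itv01_val t + 1.
pose v (t : I) : R := if itv01_val t <= 2^-1 then 0 * itv01_val t + 0
                      else 2 * itv01_val t + -1.
have cu : continuous u.
  apply: pasting_continuous (@itv01_val_continuous R) _ _ _.
  - exact: affine_val_continuous.
  - exact: affine_val_continuous.
  - by move=> t ->; lra.
have cv : continuous v.
  apply: pasting_continuous (@itv01_val_continuous R) _ _ _.
  - exact: affine_val_continuous.
  - exact: affine_val_continuous.
  - by move=> t ->; lra.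
apply: (@plane_homotopic _ _ F u v v u) => //.
- by rewrite /u /v itv01_val0 !ifT; lra.
- by rewrite /u /v itv01_val0 !ifT; lra.
- by rewrite /u /v itv01_val1 !ifF; lra.
- by rewrite /u /v itv01_val1 !ifF; lra.
- move=> t; have /andP[t0 t1] := itv01_valP t.
  rewrite /= /concat_path /u /v; case: lerP => th.
    by rewrite pE itv01_clampK; [congr (F (_, _)); ring|lra].
  by rewrite rE itv01_clampK; [congr (F (_, _)); ring|lra].
- move=> t; have /andP[t0 t1] := itv01_valP t.
  rewrite /= /concat_path /u /v; case: lerP => th.
    by rewrite lE itv01_clampK; [congr (F (_, _)); ring|lra].
  by rewrite qE itv01_clampK; [congr (F (_, _)); ring|lra].
Qed.

Section subpath.
Context (u : R -> X) (cu : continuous u).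

Section def.
Context (a b : R).

Definition subpath_fun (t : I) : X := u ((b - a) * itv01_val t + a).

Fact subpath_zero : subpath_fun zero = u a.
Proof. by rewrite /subpath_fun itv01_val0 mulr0 add0r. Qed.

Fact subpath_one : subpath_fun one = u b.
Proof. by rewrite /subpath_fun itv01_val1 mulr1 subrK. Qed.

Fact subpath_continuous : continuous subpath_fun.
Proof.
apply: continuous_compose cu.
exact: affine_val_continuous.
Qed.

Definition subpath : hpath (u a) (u b) :=
  hclass [the {path I from u a to u b} of
          mk_path subpath_continuous subpath_zero subpath_one].

End def.

Lemma subpathM a b c : hmul (subpath a b) (subpath b c) = subpath a c.
Proof.
rewrite hmulE; apply/hclassP.
pose f (t : I) : R := if itv01_val t <= 2^-1
  then 2 * (b - a) * itv01_val t + a else 2 * (c - b) * itv01_val t + (2 * b - c).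
apply: (@plane_homotopic _ _ (u \o fst) f f
  (fun t => (c - a) * itv01_val t + a) (fun t => (c - a) * itv01_val t + a)).
- by apply: continuous_compose cu => t; exact: cvg_fst.
- apply: pasting_continuous.
  + exact: itv01_val_continuous.
  + exact: affine_val_continuous.
  + exact: affine_val_continuous.
  + by move=> t ->; field.
- apply: pasting_continuous.
  + exact: itv01_val_continuous.
  + exact: affine_val_continuous.
  + exact: affine_val_continuous.
  + by move=> t ->; field.
- exact: affine_val_continuous.
- exact: affine_val_continuous.
- by rewrite /f itv01_val0 ifT; lra.
- by rewrite /f itv01_val0 ifT; lra.
- by rewrite /f itv01_val1 ifF; lra.
- by rewrite /f itv01_val1 ifF; lra.
- move=> t; have /andP[t0 t1] := itv01_valP t.
  rewrite /= /concat_path /f; case: lerP => th.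
    by rewrite /= /mk_path /subpath_fun itv01_clampK; [congr u; ring|lra].
  by rewrite /= /mk_path /subpath_fun itv01_clampK; [congr u; ring|lra].
- by [].
Qed.

End subpath.

End path_groupoid.

(** * Complex numbers in polar form *)

Section complex_topology.
Context (R : realType).
Local Open Scope complex_scope.
Notation C := (R[i]^o).
Notation Re := complex.Re.
Notation Im := complex.Im.
Implicit Types (z w : C) (r a : R).

Lemma Re_continuous : continuous (fun z : C => Re z : R).
Proof.
move=> z; apply/(@cvgrPdist_lt _ R^o _ (nbhs z)) => e e0.
have e0' : 0 < e%:C by rewrite ltcR.
apply: filterS (nbhsx_ballx z _ e0') => w; rewrite -ball_normE /= => zw.
rewrite -ltcR; apply: le_lt_trans zw; rewrite -raddfB; exact: normc_ge_Re.
Qed.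

Lemma Im_continuous : continuous (fun z : C => Im z : R).
Proof.
move=> z; have -> : (fun z : C => Im z : R) = (fun z : C => Re (- 'i * z)).
  by apply/funext => -[x y] /=; ring.
apply: (@continuous_comp C C R (fun z => - 'i * z) (fun z => Re z)).
  exact: (@cvgM R[i] C (nbhs z) _ (fun=> - 'i) id _ _ (cvg_cst _) cvg_id).
exact: Re_continuous.
Qed.

Lemma complex_continuous (T : topologicalType) (f g : T -> R) t :
  {for t, continuous f} -> {for t, continuous g} ->
  {for t, continuous (fun t => f t +i* g t : C)}.
Proof.
move=> cf cg; apply/cvgrPdist_lt => e e0.
have [eE e0'] : e = (Re e)%:C /\ 0 < Re e.
  by move: e0; case: e => x y; rewrite ltcE /= => /andP[/eqP -> ?].
have e2 : 0 < Re e / 2 by rewrite divr_gt0.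
have /cvgrPdist_lt/(_ _ e2) nf := cf; have /cvgrPdist_lt/(_ _ e2) ng := cg.
near=> u.
have fu : `|f t - f u| < Re e / 2 by near: u.
have gu : `|g t - g u| < Re e / 2 by near: u.
have -> : f t +i* g t - f u +i* g u = (f t - f u)%:C + 'i * (g t - g u)%:C.
  by apply/eqP; rewrite eq_complex /=; apply/andP; split; apply/eqP; ring.
apply: le_lt_trans (ler_normD _ _) _; rewrite normrM.
rewrite !normc_def /= !expr0n /= !addr0 !sqrtr_sqr.
rewrite add0r expr1n sqrtr1 mul1r -rmorphD eE ltcR; lra.
Unshelve. all: by end_near. Qed.

Section continuous_operations.
Context (T : topologicalType) (f g : T -> C) (t : T).
Hypotheses (cf : {for t, continuous f}) (cg : {for t, continuous g}).

Lemma continuous_addC : {for t, continuous (fun u => f u + g u : C)}.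
Proof. exact: (@cvgD R[i] C T _ _ f g _ _ cf cg). Qed.

Lemma continuous_subC : {for t, continuous (fun u => f u - g u : C)}.
Proof. exact: (@cvgB R[i] C T _ _ f g _ _ cf cg). Qed.

Lemma continuous_mulC : {for t, continuous (fun u => f u * g u : C)}.
Proof. exact: (@cvgM R[i] T _ _ f g _ _ cf cg). Qed.

Lemma continuous_invC : f t != 0 -> {for t, continuous (fun u => (f u)^-1 : C)}.
Proof. by move=> f0; exact: (@cvgV R[i] T _ _ f _ f0 cf). Qed.

End continuous_operations.

Lemma continuous_cstC (T : topologicalType) (z : C) (t : T) :
  {for t, continuous (fun=> z)}.
Proof. exact: cvg_cst. Qed.

Definition cis a : C := cos a +i* sin a.

Lemma cisD a b : cis (a + b) = cis a * cis b.
Proof. by rewrite /cis cosD sinD; apply/eqP; rewrite eq_complex /=; apply/andP;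
  split; apply/eqP; ring. Qed.

Lemma cis0 : cis 0 = 1. Proof. by rewrite /cis cos0 sin0. Qed.

Lemma cis_neq0 a : cis a != 0.
Proof.
apply/eqP => c0; have /eqP := cisD a (- a).
by rewrite c0 mul0r addrN cis0 oner_eq0.
Qed.

Lemma cisB a b : cis (a - b) = cis a / cis b.
Proof. by rewrite -[in RHS](subrK b a) [in RHS]cisD mulfK // cis_neq0. Qed.

Lemma cis_sin0 a : sin a = 0 -> cis a = (cos a)%:C.
Proof. by rewrite /cis => ->. Qed.

(** Integer multiples of pi appear throughout as the solutions of [sin c = 0]; this turns that
    condition into one on squares. *)
Lemma cis_sqr1 a : (cis a ^+ 2 == 1) = (sin a == 0).
Proof.
rewrite expr2 -cisD /cis eq_complex /= cosD sinD; have := cos2Dsin2 a.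
move: (cos a) (sin a) => x y xy1.
apply/andP/eqP => [[/eqP xy /eqP xy0]|y0]; last first.
  by split; apply/eqP; move: xy1; rewrite y0; nra.
nra.
Qed.

Lemma cis_continuous : continuous cis.
Proof.
by move=> a; apply: complex_continuous;
  [exact: continuous_cos|exact: continuous_sin].
Qed.

(** The modulus of the square roots of [z]. The norm of a complex number is itself a complex number,
    hence [Re]. *)
Definition sqrtmod z : R := Num.sqrt (Re `|z|).

Lemma Re_norm z : (Re `|z|)%:C = `|z|.
Proof. by rewrite [in RHS]normc_def [in LHS]normc_def. Qed.

Lemma Re_norm_ge0 z : 0 <= Re `|z|.
Proof. by rewrite -lecR Re_norm; exact: normr_ge0. Qed.

Lemma sqrtmod_gt0 z : z != 0 -> 0 < sqrtmod z.
Proof.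
by move=> z0; rewrite sqrtr_gt0 -ltcR Re_norm rmorph0 normr_gt0.
Qed.

Lemma sqrtmodM z w : sqrtmod (z * w) = sqrtmod z * sqrtmod w.
Proof.
rewrite /sqrtmod -sqrtrM ?Re_norm_ge0 //; congr Num.sqrt.
by apply: complexI; rewrite rmorphM /= !Re_norm normrM.
Qed.

Lemma sqrtmod_sqr z : sqrtmod z ^+ 2 = Re `|z|.
Proof. by rewrite sqr_sqrtr // Re_norm_ge0. Qed.

Lemma sqrtmod_continuous : continuous sqrtmod.
Proof.
move=> z; apply: (@continuous_comp _ _ _ (fun z : C => Re `|z| : R)); last first.
  exact: sqrt_continuous.
apply: (@continuous_comp _ _ _ (fun z : C => `|z| : C)); last exact: Re_continuous.
exact: (@norm_continuous _ R[i]^o).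
Qed.

Lemma sqrtmod_cis r a : 0 <= r -> sqrtmod ((r%:C * cis a) ^+ 2) = r.
Proof.
move=> r0; rewrite expr2 sqrtmodM -expr2 sqrtmod_sqr normc_def /=.
rewrite (_ : _ + _ = r ^+ 2 * (cos a ^+ 2 + sin a ^+ 2)); last by ring.
by rewrite cos2Dsin2 mulr1 sqrtr_sqr ger0_norm.
Qed.

End complex_topology.

(** * Charts of the plane with two cuts *)

Notation "'\Gamma'" := (free_product Z2group Zgroup) (only parsing).

Definition fp_s : \Gamma := @fp_inl Z2group Zgroup (1%R : 'Z_2).
Definition fp_t : \Gamma := @fp_inr Z2group Zgroup (1%R : int).

Lemma fp_sK : (fp_s * fp_s)%g = 1%g.
Proof.
rewrite -fp_inlM -(morph1 (@fp_inlM Z2group Zgroup)); congr fp_inl.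
exact: val_inj.
Qed.

Lemma fp_sV : (fp_s^-1)%g = fp_s.
Proof. by apply: (mulgI fp_s); rewrite mulgV fp_sK. Qed.

Inductive sheet := Middle | Right | Left.

Definition sheet_opp c :=
  match c with Middle => Middle | Right => Left | Left => Right end.

Section charts.
Context (R : realType).
Notation C := (R[i]^o).
Notation Re := complex.Re.
Notation Im := complex.Im.
Implicit Types (y w : C).

(** [Middle] is the plane without the two closed cuts, star-shaped around 0; the half planes [Right]
    and [Left] are convex and cover the cuts up to the punctures. *)
Definition chart c y : Prop :=
  match c with
  | Middle => Im y <> 0 \/ `|Re y| < 1
  | Right => 1 < Re y
  | Left => Re y < -1
  end.

(** Since a label is locally a constant times the weight, crossing the right cut downwards
    multiplies it by t on the right, crossing the left cut upwards by s t s, and nothing happens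
    inside [Middle]. Points of the right cut count as above it and points of the left cut as below
    it, which is compatible with y -> -y. *)
Definition weight c y : \Gamma :=
  match c with
  | Middle => 1%g
  | Right => if Im y < 0 then fp_t else 1%g
  | Left => if 0 < Im y then (fp_s * fp_t * fp_s)%g else 1%g
  end.

Lemma chart_cover y : y != 1 -> y != -1 -> exists c, chart c y.
Proof.
case: y => a b; rewrite !eq_complex /= oppr0 => y1 yN1.
have [b0|/eqP b0] := eqVneq b 0; last by exists Middle; left.
move: y1 yN1; rewrite b0 eqxx !andbT => a1 aN1.
have [a1'|a1'|a1'] := ltgtP a 1; last by rewrite a1' eqxx in a1.
  have [a2|a2|a2] := ltgtP a (-1); last by rewrite a2 eqxx in aN1.
    by exists Left.
  by exists Middle; right; rewrite /= ltr_norml a2.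
by exists Right.
Qed.

Lemma chart_open c y : chart c y -> \forall w \near y, chart c w.
Proof.
have cRe := @Re_continuous R y; have cIm := @Im_continuous R y.
case: c => /= [[/eqP Im0|Re1]|Re1|Re1].
- have : \forall w \near y,
  Im w != 0 by exact: cIm _ (open_nbhs_nbhs (conj (@open_neq _ _) Im0)).
  by apply: filterS => w /eqP ?; left.
- have : \forall w \near y, `|Re w| < 1.
    have cn : {for y, continuous (fun w => `|Re w|)} by exact: cvg_norm cRe.
    exact: cn _ (lt_nbhsl Re1).
  by apply: filterS => w ?; right.
- exact: cRe _ (lt_nbhsr Re1).
- exact: cRe _ (lt_nbhsl Re1).
Qed.

Lemma weight_near c y :
  Im y <> 0 -> \forall w \near y, weight c w = weight c y.
Proof.
move=> /eqP Im0; have cIm := @Im_continuous R y.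
have : \forall w \near y, ((Im w < 0) = (Im y < 0)) /\ ((0 < Im w) = (0 < Im y)).
  move: Im0; case: ltgtP => // Im0 _.
    have : \forall w \near y, Im w < 0 by exact: cIm _ (lt_nbhsl Im0).
    by apply: filterS => w ?; split; lra.
  have : \forall w \near y, 0 < Im w by exact: cIm _ (lt_nbhsr Im0).
  by apply: filterS => w ?; split; lra.
by apply: filterS => w [l r]; case: c => //=; rewrite ?l ?r.
Qed.

(** Off the real axis every weight is locally constant; on the real axis the three charts are
    disjoint, so the two charts coincide. *)
Lemma weight_transition c c' y : chart c y -> chart c' y ->
  \forall w \near y,
    (weight c w * (weight c' w)^-1 = weight c y * (weight c' y)^-1)%g.
Proof.
have [Im0|Im0] := pselect (Im y = 0).
  case: c c' => [] [] /=;
    try by (move=> *; near=> w; rewrite !mulgV).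
  - by move=> [//|]; rewrite ltr_norml; lra.
  - by move=> [//|]; rewrite ltr_norml; lra.
  - by move=> ? [//|]; rewrite ltr_norml; lra.
  - by lra.
  - by move=> ? [//|]; rewrite ltr_norml; lra.
  - by lra.
move=> _ _; near=> w.
by rewrite (near (weight_near c Im0) w) ?(near (weight_near c' Im0) w).
Unshelve. all: by end_near. Qed.

Lemma chart_opp c y : chart c y -> chart (sheet_opp c) (- y).
Proof.
case: y => a b; case: c => //= [[b0|a1]|?|?]; [left|right|lra|lra].
  by move/eqP; rewrite oppr_eq0 => /eqP.
by rewrite normrN.
Qed.

Lemma weight_opp c y :
  weight (sheet_opp c) (- y) = (fp_s * weight c y * fp_s)%g.
Proof.
case: y => a b; case: c => /=; rewrite ?oppr_gt0 ?oppr_lt0 ?mulg1 ?fp_sK //.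
  by case: ifP; rewrite // mulg1 fp_sK.
case: ifP => _; last by rewrite mulg1 fp_sK.
by rewrite !mulgA fp_sK mul1g -mulgA fp_sK mulg1.
Qed.

End charts.

(** * Lifting configurations *)

Section angles.
Context (R : realType).
Local Open Scope complex_scope.
Notation C := (R[i]^o).
Notation Re := complex.Re.
Notation Im := complex.Im.

(** [a] is the argument of a square root of [p]; for nonzero [p] it is determined modulo pi. *)
Definition polar_sqr (p : C) (a : R) : Prop := p = ((sqrtmod p)%:C * cis a) ^+ 2.

Lemma sqrtmod_neq0 (p : C) : p != 0 -> (sqrtmod p)%:C != 0.
Proof. by move=> /sqrtmod_gt0 r0; rewrite eq_complex /= eqxx andbT gt_eqF. Qed.

Lemma polar_sqrM p q a b :
  polar_sqr p a -> polar_sqr q b -> polar_sqr (p * q) (a + b).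
Proof.
rewrite /polar_sqr => pE qE; rewrite sqrtmodM rmorphM /= cisD {1}pE {1}qE; ring.
Qed.

Lemma polar_sqr_sub p a b : p != 0 -> polar_sqr p a -> polar_sqr p b ->
  sin (a - b) = 0.
Proof.
move=> p0 pa pb; apply/eqP; rewrite -cis_sqr1 cisB expr_div_n.
have r0 : (sqrtmod p)%:C ^+ 2 != 0 by rewrite expf_neq0 // sqrtmod_neq0.
have : (sqrtmod p)%:C ^+ 2 * cis a ^+ 2 = (sqrtmod p)%:C ^+ 2 * cis b ^+ 2.
  by rewrite -!exprMn -pb.
move=> /(mulfI r0) ->.
by rewrite divff // expf_neq0 // cis_neq0.
Qed.

Lemma polar_sqrD p a c : sin c = 0 -> polar_sqr p a -> polar_sqr p (a + c).
Proof.
move=> sc pa; rewrite /polar_sqr cisD mulrA exprMn.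
by move/eqP: sc; rewrite -cis_sqr1 => /eqP ->; rewrite mulr1.
Qed.

Lemma polar_sqr_atan (u : C) : 0 < Re u -> polar_sqr u (atan (Im u / Re u) / 2).
Proof.
case: u => x y /= x0; rewrite /polar_sqr exprMn [X in _ * X]expr2 -cisD -rmorphXn /= sqrtmod_sqr.
rewrite -splitr normc_def /= /cis.
have cp : 0 < cos (atan (y / x)).
  by rewrite cos_gt0_pihalf // atan_gtNpi2 atan_ltpi2.
have tE : sin (atan (y / x)) = y / x * cos (atan (y / x)).
  by have := atanK (y / x); rewrite /tan => {2}<-; rewrite divfK // gt_eqF.
have := cos2Dsin2 (atan (y / x)); rewrite tE.
move: (cos _) cp => c c0 {tE} cE.
(* With [c] the cosine, the sine is (y / x) c, so cos^2 + sin^2 = 1 reads x^2 + y^2 = (x / c)^2. *)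
have -> : Num.sqrt (x ^+ 2 + y ^+ 2) = x / c.
  have -> : x ^+ 2 + y ^+ 2 = (x / c) ^+ 2.
    rewrite -[LHS]mulr1 -cE.
    apply: (mulIf (expf_neq0 2 (lt0r_neq0 c0))).
    rewrite cE mulr1 expr_div_n divfK ?expf_neq0 ?lt0r_neq0 //.
    rewrite -[RHS]mulr1 -cE; field.
    by rewrite gt_eqF.
  by rewrite sqrtr_sqr ger0_norm // ltW // divr_gt0.
by apply/eqP; rewrite eq_complex /=; apply/andP; split; apply/eqP; field;
  rewrite !gt_eqF.
Qed.

(** A rotation by a suitable angle 2b, a multiple of a right angle, brings [p] into the right half
    plane, where the arctangent gives the argument; b is then subtracted. *)
Lemma polar_sqr_exists (p : C) : p != 0 -> exists a, polar_sqr p a.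
Proof.
move=> p0; suff: exists b, 0 < Re (p * cis (b + b)).
  rewrite /= => -[b]; rewrite cisD -expr2 => /polar_sqr_atan; move: (atan _ / 2) => a pa.
  exists (a - b); have cb : polar_sqr (cis (- b) ^+ 2) (- b).
    have r1 : sqrtmod (cis (- b) ^+ 2) = 1.
      by rewrite -[cis (- b)]mul1r (sqrtmod_cis (- b) ler01).
    by rewrite /polar_sqr r1 mul1r.
  have := polar_sqrM pa cb.
  by rewrite -mulrA -exprMn -cisD addrN cis0 expr1n mulr1.
case: p p0 => x y; rewrite eq_complex /= => xy0.
have [x0|x0|x0] := ltgtP x 0.
- exists (pi / 2); rewrite -splitr cospi sinpi /=; lra.
- by exists 0; rewrite addr0 cos0 sin0; lra.
move: xy0; rewrite x0 eqxx /= => y0.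
have [y1|y1|y1] := ltgtP y 0; last by rewrite y1 eqxx in y0.
- exists (pi / 2 / 2); rewrite -splitr cos_pihalf sin_pihalf /=; lra.
- exists (- (pi / 2 / 2)); rewrite -opprD -splitr cosN sinN.
  by rewrite cos_pihalf sin_pihalf /=; lra.
Qed.

Lemma sin_eq0_small (a : R) : `|a| < pi -> sin a = 0 -> a = 0.
Proof.
rewrite ltr_norml => /andP[a1 a2] sa; have [a0|a0|//] := ltgtP a 0.
- have : 0 < sin (- a) by rewrite sin_gt0_pi //; apply/andP; split; lra.
  by rewrite sinN sa oppr0 ltxx.
- have : 0 < sin a by rewrite sin_gt0_pi // a0.
  by rewrite sa ltxx.
Qed.

(* With [q] the square root of [p] of argument [a], the configuration with
   symmetric functions [s] and [p] is [q] times the roots of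
   [z ^+ 2 - 2 v z + 1]. *)
Definition conf_shape (s p : C) (a : R) : C := s / (2 * (sqrtmod p)%:C * cis a).

Lemma conf_shapeE s p a : p != 0 ->
  s = 2 * ((sqrtmod p)%:C * cis a) * conf_shape s p a.
Proof.
move=> p0; rewrite /conf_shape; field.
by rewrite cis_neq0 sqrtmod_neq0 //= pnatr_eq0.
Qed.

(** With p = q^2 and s = 2 q v, the discriminant s^2 - 4 p equals 4 q^2 (v^2 - 1). *)
Lemma conf_shape_sqr_neq1 s p a : p != 0 -> s ^+ 2 != 4 * p -> polar_sqr p a ->
  conf_shape s p a ^+ 2 != 1.
Proof.
move=> p0 + pa; apply: contra_neq => v1.
rewrite {1}(conf_shapeE s a p0) exprMn v1 mulr1 [in RHS]pa; ring.
Qed.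

Lemma conf_shapeD s p a c : sin c = 0 ->
  conf_shape s p (a + c) = (cos c)%:C * conf_shape s p a.
Proof.
move=> sc; have := cis_sqr1 c; rewrite sc eqxx cis_sin0 // => /eqP cc.
have c0 : (cos c)%:C != 0.
  by apply/eqP => c0; move/eqP: cc; rewrite c0 expr0n eq_sym oner_eq0.
have cV : (cos c)%:C^-1 = (cos c)%:C.
  by apply: (mulfI c0); rewrite divff // -expr2 cc.
by rewrite /conf_shape cisD (cis_sin0 sc) mulrA invfM cV mulrA mulrC.
Qed.

Lemma conf_shape_continuous (T : topologicalType) (s p : T -> C) (a : T -> R) t :
  {for t, continuous s} -> {for t, continuous p} -> {for t, continuous a} ->
  p t != 0 -> {for t, continuous (fun u => conf_shape (s u) (p u) (a u) : C)}.
Proof.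
move=> cs cp ca p0.
have cr : {for t, continuous (fun u => (sqrtmod (p u))%:C : C)}.
  apply: complex_continuous; last exact: cvg_cst.
  exact: (continuous_comp cp (@sqrtmod_continuous _ _)).
have cc : {for t, continuous (fun u => cis (a u) : C)}.
  exact: (continuous_comp ca (@cis_continuous _ _)).
have cd : {for t, continuous (fun u => 2 * (sqrtmod (p u))%:C * cis (a u) : C)}.
  by apply: continuous_mulC cc; apply: continuous_mulC cr; exact: continuous_cstC.
have d0 : 2 * (sqrtmod (p t))%:C * cis (a t) != 0.
  by rewrite !mulf_neq0 ?cis_neq0 ?sqrtmod_neq0 // pnatr_eq0.
exact: continuous_mulC cs (continuous_invC cd d0).
Qed.

End angles.

(* A configuration of symmetric functions [s] and [p] is lifted to the argument
   of a square root of [p] together with a label, an element of Z_2 * Z which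
   records, in the charts, how often the conf_shape has crossed the two cuts. *)
Section lifts.
Context (R : realType).
Local Open Scope complex_scope.
Notation C := (R[i]^o).

Definition distinct_roots (s p : C) := p != 0 /\ s ^+ 2 != 4 * p.

(* A label jumps exactly as the weight of any chart does. *)
Definition labelled (T : topologicalType) (v : T -> C) (l : T -> \Gamma) t :=
  forall c, chart c (v t) -> \forall u \near t,
    (l u * (weight c (v u))^-1 = l t * (weight c (v t))^-1)%g.

(** A condition at the single point [t], so that lifts can be glued along lines and pulled back
    along continuous maps. *)
Definition lifts (T : topologicalType) (s p : T -> C) (f : T -> R * \Gamma) t :=
  [/\ {for t, continuous (fun u => (f u).1)},
      \forall u \near t, polar_sqr (p u) (f u).1 &
      labelled (fun u => conf_shape (s u) (p u) (f u).1) (fun u => (f u).2) t].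

Definition deck_label (c : R) : \Gamma := if cos c < 0 then fp_s else 1%g.

(* A half turn of the square root of [p] changes the sign of the shape, which
   exchanges the cuts; [fp_s] on the right compensates for this. *)
Definition deck (g : \Gamma) (c : R) (x : R * \Gamma) : R * \Gamma :=
  (x.1 + c, (g * x.2 * deck_label c)%g).

Lemma deck_labelK c : (deck_label c * deck_label c = 1)%g.
Proof. by rewrite /deck_label; case: ifP; rewrite ?fp_sK ?mulg1. Qed.

(** One chart is enough, because the weights of two charts differ by a locally constant factor on
    their overlap. *)
Lemma labelled_chart (T : topologicalType) (v : T -> C) l t c :
  {for t, continuous v} -> chart c (v t) ->
  (\forall u \near t,
    (l u * (weight c (v u))^-1 = l t * (weight c (v t))^-1)%g) ->
  labelled v l t.
Proof.
move=> cv ct lt c' c't.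
have tr : \forall u \near t, (weight c (v u) * (weight c' (v u))^-1 =
    weight c (v t) * (weight c' (v t))^-1)%g.
  exact: cv _ (weight_transition ct c't).
near=> u.
rewrite -(divgK (weight c (v u)) (l u)) (near lt u) //.
by rewrite -(mulgA _ (weight c (v u))) (near tr u) // mulgA divgK.
Unshelve. all: by end_near. Qed.

Lemma labelled_near_eq (T : topologicalType) (v : T -> C) l l' t :
  v t ^+ 2 != 1 -> labelled v l t -> labelled v l' t ->
  \forall u \near t, l u = l' u <-> l t = l' t.
Proof.
rewrite sqrf_eq1 negb_or => /andP[v1 vN1] lt lt'.
have [c ct] := chart_cover v1 vN1.
apply: filterS2 (lt _ ct) (lt' _ ct) => u H H'.
split=> e.
  by apply: (@mulIg _ (weight c (v t))^-1%g); rewrite -H -H' e.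
by apply: (@mulIg _ (weight c (v u))^-1%g); rewrite H H' e.
Qed.

Section fixed_configuration.
Context (T : topologicalType) (s p : T -> C).
Hypotheses (cs : continuous s) (cp : continuous p).
Hypothesis nd : forall t, distinct_roots (s t) (p t).
Implicit Types (f : T -> R * \Gamma) (t : T).

Let p0 t : p t != 0. Proof. by case: (nd t). Qed.

Lemma lifts_polar f t : lifts s p f t -> polar_sqr (p t) (f t).1.
Proof. by case=> _ /nbhs_singleton. Qed.

Lemma conf_shape_lifts f t : lifts s p f t ->
  {for t, continuous (fun u => conf_shape (s u) (p u) (f u).1 : C)}.
Proof.
by move=> [cf _ _]; exact: conf_shape_continuous (@cs t) (@cp t) cf (p0 t).
Qed.

Lemma lifts_ext f f' t :
  (\forall u \near t, f u = f' u) -> lifts s p f t -> lifts s p f' t.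
Proof.
move=> ff [cf pf lf]; have ft := nbhs_singleton ff; split.
- rewrite /prop_for /continuous_at -ft; apply: cvg_trans cf.
  by apply: near_eq_cvg; apply: filterS ff => u /= ->.
- by apply: filterS2 ff pf => u <-.
- move=> c; rewrite -ft => /lf; apply: filterS2 ff => u <-.
  by [].
Qed.

(** Agreement of two lifts is locally constant. Their angles differ by a multiple of pi: a nonzero
    difference stays nonzero nearby, and a difference that is zero at [t] is smaller than pi nearby,
    hence zero. The shapes then coincide and the labels are compared in one chart. *)
Lemma lifts_near_eq f f' t : lifts s p f t -> lifts s p f' t ->
  \forall u \near t, f u = f' u <-> f t = f' t.
Proof.
move=> Lf Lf'; have [cf pf lf] := Lf; have [cf' pf' lf'] := Lf'.
have cd : {for t, continuous (fun u => (f u).1 - (f' u).1)} by exact: cvgB.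
have [a0|a0] := eqVneq ((f t).1 - (f' t).1) 0; last first.
  have : \forall u \near t, (f u).1 - (f' u).1 != 0.
    exact: cd _ (open_nbhs_nbhs (conj (@open_neq _ _) a0)).
  by apply: filterS => u u0; split=> ff; [move: u0|move: a0];
    rewrite ff subrr eqxx.
have dpi : \forall u \near t, `|(f u).1 - (f' u).1| < pi.
  have cn : {for t, continuous (fun u => `|(f u).1 - (f' u).1|)}.
    exact: cvg_norm cd.
  by apply: (cn _ (lt_nbhsl _)); rewrite a0 normr0 pi_gt0.
have eq1 : \forall u \near t, (f u).1 = (f' u).1.
  apply: filterS3 dpi pf pf' => u upi pu pu'; apply: subr0_eq.
  exact: sin_eq0_small upi (polar_sqr_sub (p0 u) pu pu').
have eq1t := nbhs_singleton eq1.
pose v u : C := conf_shape (s u) (p u) (f u).1.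
have v1 : v t ^+ 2 != 1.
  exact: conf_shape_sqr_neq1 (p0 t) (nd t).2 (lifts_polar Lf).
have {}lf' : labelled v (fun u => (f' u).2) t.
  move=> c; rewrite /v eq1t => /lf'; apply: filterS2 eq1 => u ->.
  by [].
have := labelled_near_eq v1 lf lf'; apply: filterS2 eq1 => u.
case: (f u) (f' u) => [a l] [a' l'] /= ->.
move: eq1t; case: (f t) (f' t) => [b k] [b' k'] /= ->.
by move=> [lk kl]; split=> -[e]; rewrite ?(lk e) ?(kl e).
Qed.

(** If [cos c = -1] the shape changes sign, so it is read in the opposite chart, whose weight is
    conjugated by [fp_s]; the factor [fp_s] on the right of the label absorbs one side of the
    conjugation and the two constants absorb the other. *)
Lemma lifts_deck f g c t : sin c = 0 -> lifts s p f t ->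
  lifts s p (deck g c \o f) t.
Proof.
move=> sc Lf; have [cf pf lf] := Lf; split.
- by apply: cvgD; [exact: cf|exact: cvg_cst].
- by apply: filterS pf => u; exact: polar_sqrD.
move=> d /=; rewrite conf_shapeD // => dt.
have [c1|c1] : cos c = 1 \/ cos c = -1.
  have := cos2Dsin2 c; rewrite sc expr0n addr0 => /eqP.
  by rewrite sqrf_eq1 => /orP[] /eqP; [left|right].
- have E u : (cos c)%:C * conf_shape (s u) (p u) (f u).1 =
             conf_shape (s u) (p u) (f u).1 by rewrite c1 mul1r.
  move: dt; rewrite E => /lf; apply: filterS => u ut.
  rewrite conf_shapeD // !E /deck_label c1 ltr10 !mulg1 -!mulgA.
  by congr (g * _)%g.
have E u : (cos c)%:C * conf_shape (s u) (p u) (f u).1 =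
           - conf_shape (s u) (p u) (f u).1.
  by rewrite c1 rmorphN rmorph1 mulN1r.
move: dt; rewrite E => /chart_opp; rewrite opprK => /lf.
apply: filterS => u ut.
have W y : weight d (- y) = (fp_s * weight (sheet_opp d) y * fp_s)%g.
  by rewrite -weight_opp; case: (d).
rewrite conf_shapeD // !E /deck_label c1 ltrN10 !W !invgM !fp_sV -!mulgA.
congr (g * _)%g.
by rewrite ![(fp_s * (fp_s * _))%g]mulgA fp_sK !mul1g !mulgA ut.
Qed.

(** Deck transformations are transitive on the lifts of one configuration: the difference of angles
    gives [c], and then [g] solves an equation in the group. *)
Lemma lifts_deck_trans f f' t : lifts s p f t -> lifts s p f' t ->
  exists g c, sin c = 0 /\ deck g c (f' t) = f t.
Proof.
move=> Lf Lf'.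
exists ((f t).2 * deck_label ((f t).1 - (f' t).1) * ((f' t).2)^-1)%g.
exists ((f t).1 - (f' t).1); split.
  exact: polar_sqr_sub (p0 t) (lifts_polar Lf) (lifts_polar Lf').
rewrite /deck addrC subrK mulgVK -mulgA deck_labelK mulg1.
by case: (f t).
Qed.

Lemma lifts_exists t : exists f, \forall u \near t, lifts s p f u.
Proof.
have [a pa] := polar_sqr_exists (p0 t).
(* The quotient is 1 at [t], so near [t] it lies in the right half plane and its argument is a
   continuous arctangent. *)
pose q u : C := p u / p t.
have cq : continuous q.
  by move=> u; exact: (continuous_mulC (@cp u) (@continuous_cstC _ _ _ _)).
pose th u : R := a + atan (complex.Im (q u) / complex.Re (q u)) / 2.
have nq : \forall u \near t, 0 < complex.Re (q u).
  have cr : {for t, continuous (fun u => complex.Re (q u))}.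
    exact: (continuous_comp (@cq t) (@Re_continuous R _)).
  by apply: (cr _ (lt_nbhsr _)); rewrite /q divff ?p0 //= ltr01.
have pth u : 0 < complex.Re (q u) -> polar_sqr (p u) (th u).
  move=> q0; rewrite -(divfK (p0 t) (p u)) mulrC.
  exact: polar_sqrM pa (polar_sqr_atan q0).
have cth u : 0 < complex.Re (q u) -> {for u, continuous th}.
  move=> q0; apply: cvgD; first exact: cvg_cst.
  apply: cvgM; last exact: cvg_cst.
  have cat : {for u, continuous (fun w => complex.Im (q w) / complex.Re (q w))}.
    apply: cvgM; first exact: (continuous_comp (@cq u) (@Im_continuous R _)).
    apply: cvgV; first by rewrite gt_eqF.
    exact: (continuous_comp (@cq u) (@Re_continuous R _)).
  exact: (continuous_comp cat (@continuous_atan R _)).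
pose v u : C := conf_shape (s u) (p u) (th u).
have cv u : 0 < complex.Re (q u) -> {for u, continuous v}.
  move=> q0; exact: conf_shape_continuous (@cs u) (@cp u) (cth u q0) (p0 u).
have q1 : 0 < complex.Re (q t) := nbhs_singleton nq.
have := conf_shape_sqr_neq1 (p0 t) (nd t).2 (pth t q1).
rewrite sqrf_eq1 negb_or => /andP[v1 vN1].
have [c ct] := chart_cover v1 vN1.
have nc : \forall u \near t, chart c (v u) := cv t q1 _ (chart_open ct).
exists (fun u => (th u, weight c (v u))).
(* Lifting at a nearby point [u] concerns a neighbourhood of [u], so the condition on [q] is needed
   around each such [u]. *)
have nqq := near_join nq.
apply: filterS3 nqq nc nq => u nqu cu qu; split.
- exact: cth.
- by apply: filterS nqu => w; exact: pth.
- apply: (labelled_chart (c := c)) (cv u qu) cu _.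
  by near=> w; rewrite !mulgV.
Unshelve. all: by end_near. Qed.

End fixed_configuration.

Lemma lifts_comp (T T' : topologicalType) (s p : T -> C) (s' p' : T' -> C)
    f (h : T' -> T) t :
  {for t, continuous h} -> (forall u, s' u = s (h u)) ->
  (forall u, p' u = p (h u)) -> lifts s p f (h t) -> lifts s' p' (f \o h) t.
Proof.
move=> ch /funext -> /funext -> [cf pf lf]; split.
- exact: (continuous_comp ch cf).
- exact: ch _ pf.
- by move=> c ct; exact: ch _ (lf c ct).
Qed.

End lifts.

Lemma near_itv (R : realType) (x : R) (P : R -> Prop) :
  (\forall r \near x, P r) ->
  exists2 e, 0 < e & forall r, x - e < r -> r < x + e -> P r.
Proof.
move=> /nbhs_ballP[e /= e0 He]; exists e => // r xr rx; apply: He.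
by rewrite -ball_normE /= ltr_norml; lra.
Qed.

(** * Gluing local lifts into a lift over a square *)

Section lift_existence.
Context (R : realType).
Notation C := (R[i]^o).

Section lifting.
Context (T : topologicalType) (s p : T -> C).
Hypothesis nd : forall t, distinct_roots (s t) (p t).
Implicit Types (f : T -> R * \Gamma) (t : T).

Lemma lifts_line_eq f f' (h : R -> T) a b : continuous h -> a <= b ->
  (forall r, a <= r <= b -> lifts s p f (h r) /\ lifts s p f' (h r)) ->
  f (h a) = f' (h a) -> f (h b) = f' (h b).
Proof.
move=> ch ab L.
apply: (interval_induction (Q := fun x y => f (h x) = f' (h x) ->
  f (h y) = f' (h y))) ab _ _ => [x xab|x y z _ _ xy yz /xy //].
have [Lf Lf'] := L x xab.
have : \forall r \near x, f (h r) = f' (h r) <-> f (h x) = f' (h x).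
  have N := lifts_near_eq nd Lf Lf'; exact: (ch x _ N).
move=> /near_itv[e e0 He]; exists e => // u v xu uv vx.
by rewrite !He //; lra.
Qed.

(** On the wall [k t = b] both lifts agree at [t], hence near [t], so the glued function coincides
    there with [f] on both sides. *)
Lemma lifts_glue f f' (k : T -> R) b t : continuous k ->
  (k t <= b -> lifts s p f t) -> (b <= k t -> lifts s p f' t) ->
  (k t = b -> f t = f' t) ->
  lifts s p (fun u => if k u <= b then f u else f' u) t.
Proof.
move=> ck L L' ff; have [kb|kb|kb] := ltgtP (k t) b.
- have nk : \forall u \near t, k u < b := ck t _ (lt_nbhsl kb).
  apply: lifts_ext (L (ltW kb)); apply: filterS nk => u ub.
  by rewrite (ltW ub).
- have nk : \forall u \near t, b < k u := ck t _ (lt_nbhsr kb).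
  apply: lifts_ext (L' (ltW kb)); apply: filterS nk => u ub.
  by rewrite leNgt ub.
- have Lt : lifts s p f t by apply: L; rewrite kb.
  have Lt' : lifts s p f' t by apply: L'; rewrite kb.
  apply: lifts_ext (Lt); apply: filterS (lifts_near_eq nd Lt Lt') => u e.
  by rewrite e.2 ?if_same //; exact: ff.
Qed.

End lifting.

Section square.
Context (s p : R * R -> C).
Hypotheses (cs : continuous s) (cp : continuous p).
Hypothesis nd : forall t, distinct_roots (s t) (p t).

Let liftable (a b c d : R) := exists f, forall x y, a <= x <= b -> c <= y <= d ->
  lifts s p f (x, y).

(** A deck transformation makes the second lift agree with the first at the corner (b, c);
    uniqueness along the common side does the rest. *)
Let glue_fst a b e c d : a <= b -> b <= e -> c <= d ->
  liftable a b c d -> liftable b e c d -> liftable a e c d.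
Proof.
move=> ab be cd [f Lf] [f' Lf'].
have [||g [k [sk gk]]] := @lifts_deck_trans _ _ s p nd f f' (b, c).
- by apply: Lf; rewrite ?ab ?lexx.
- by apply: Lf'; rewrite ?be ?lexx.
have Ld x y : b <= x <= e -> c <= y <= d -> lifts s p (deck g k \o f') (x, y).
  by move=> xb yc; apply: lifts_deck sk _; exact: Lf'.
exists (fun u => if u.1 <= b then f u else (deck g k \o f') u) => x y xae ycd.
apply: (@lifts_glue _ s p nd f (deck g k \o f') fst b (x, y)).
- by move=> u; exact: cvg_fst.
- by rewrite /= => xb; apply: Lf => //; lra.
- by rewrite /= => xb; apply: Ld => //; lra.
- rewrite /= => xb; have /andP[cy yd] := ycd.
  have ch : continuous (fun r : R => (b, r)).
    have cb : continuous (fun _ : R => b) by move=> ?; exact: cvg_cst.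
    have ci : continuous (@id R) by move=> ?; exact: cvg_id.
    exact: continuous_pair cb ci.
  rewrite xb; apply: (lifts_line_eq (f' := deck g k \o f') nd ch cy) => [r rcd|].
    split; first by apply: Lf; lra.
    by apply: Ld; lra.
  by rewrite /= gk.
Qed.

Let glue_snd a b c d e : a <= b -> c <= d -> d <= e ->
  liftable a b c d -> liftable a b d e -> liftable a b c e.
Proof.
move=> ab cd de [f Lf] [f' Lf'].
have [||g [k [sk gk]]] := @lifts_deck_trans _ _ s p nd f f' (a, d).
- by apply: Lf; rewrite ?cd ?lexx.
- by apply: Lf'; rewrite ?de ?lexx.
have Ld x y : a <= x <= b -> d <= y <= e -> lifts s p (deck g k \o f') (x, y).
  by move=> xb yc; apply: lifts_deck sk _; exact: Lf'.
exists (fun u => if u.2 <= d then f u else (deck g k \o f') u) => x y xab yce.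
apply: (@lifts_glue _ s p nd f (deck g k \o f') snd d (x, y)).
- by move=> u; exact: cvg_snd.
- by rewrite /= => yd; apply: Lf => //; lra.
- by rewrite /= => yd; apply: Ld => //; lra.
- rewrite /= => yd; have /andP[ax xb] := xab.
  have ch : continuous (fun r : R => (r, d)).
    have cb : continuous (fun _ : R => d) by move=> ?; exact: cvg_cst.
    have ci : continuous (@id R) by move=> ?; exact: cvg_id.
    exact: continuous_pair ci cb.
  rewrite yd; apply: (lifts_line_eq (f' := deck g k \o f') nd ch ax) => [r rab|].
    split; first by apply: Lf; lra.
    by apply: Ld; lra.
  by rewrite /= gk.
Qed.

Lemma lifts_square : exists f, forall x y, 0 <= x <= 1 -> 0 <= y <= 1 ->
  lifts s p f (x, y).
Proof.
have loc x y : exists2 e, 0 < e & forall a b c d,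
    x - e < a -> b < x + e -> y - e < c -> d < y + e -> liftable a b c d.
  have [f /nbhs_ballP[e /= e0 He]] := lifts_exists cs cp nd (x, y).
  exists e => // a b c d xa bx yc dy; exists f => u v uab vcd; apply: He.
  by split; rewrite -ball_normE /= ltr_norml; lra.
have strip x : exists2 e, 0 < e & forall a b,
    x - e < a -> a <= b -> b < x + e -> liftable a b 0 1.
  (* The strip width is part of the property: stacking two rectangles keeps the smaller of their
     widths. *)
  apply: (interval_induction (Q := fun c d => exists2 e, 0 < e & forall a b,
    x - e < a -> a <= b -> b < x + e -> liftable a b c d)) => //.
  - move=> y _; have [e e0 He] := loc x y; exists e => // c d yc cd dy.
    by exists e => // a b xa ab bx; exact: He.
  - move=> c d h cd dh [e e0 He] [e' e'0 He'].
    exists (Num.min e e'); first by rewrite lt_min e0.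
    move=> a b xa ab bx; have := ge_min e e e'; have := ge_min e' e e'.
    rewrite !lexx orbT /= => m1 m2.
    by apply: (@glue_snd _ _ _ d) => //; [apply: He|apply: He']; lra.
apply: (interval_induction (Q := fun a b => liftable a b 0 1)) => //.
by move=> a b e ab be; exact: glue_fst.
Qed.

End square.
End lift_existence.

(** * Monodromy of loops *)

Section deck_theory.
Context (R : realType).
Implicit Types (c : R) (g : \Gamma).

Lemma deck_labelD c c' : sin c = 0 -> sin c' = 0 ->
  deck_label (c + c') = (deck_label c * deck_label c')%g.
Proof.
have cpm (d : R) : sin d = 0 -> cos d = 1 \/ cos d = -1.
  have := cos2Dsin2 d => + sd; rewrite sd expr0n addr0 => /eqP.
  by rewrite sqrf_eq1 => /orP[] /eqP; [left|right].
move=> sc sc'; rewrite /deck_label cosD sc mul0r subr0.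
by case: (cpm c sc) (cpm c' sc') => [->|->] [->|->];
  rewrite ?mulr1 ?mul1r ?mulrNN ?mulr1 ?ltr10 ?ltrN10 ?mulg1 ?mul1g ?fp_sK.
Qed.

Lemma deckM g g' c c' x : sin c = 0 -> sin c' = 0 ->
  deck g c (deck g' c' x) = deck (g * g')%g (c + c') x.
Proof.
move=> sc sc'; rewrite /deck /= (addrC c c') deck_labelD // !mulgA.
by congr (_, _); rewrite addrA.
Qed.

Lemma deck_inj g g' c c' x : deck g c x = deck g' c' x -> (g, c) = (g', c').
Proof.
by rewrite /deck => -[/addrI -> /mulIg/mulIg ->].
Qed.

Lemma deck_exists (p : R[i]^o) (x y : R * \Gamma) : p != 0 ->
  polar_sqr p x.1 -> polar_sqr p y.1 ->
  exists g c, sin c = 0 /\ deck g c x = y.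
Proof.
move=> p0 px py; exists (y.2 * deck_label (y.1 - x.1) * x.2^-1)%g, (y.1 - x.1).
split; first exact: polar_sqr_sub p0 py px.
rewrite /deck addrC subrK mulgVK -mulgA deck_labelK mulg1.
by case: (y).
Qed.

End deck_theory.

Section monodromy.
Context (R : realType).
Notation C := (R[i]^o).
Notation I := (unit_interval R).
Context (X : topologicalType) (s p : X -> C).
Hypotheses (cs : continuous s) (cp : continuous p).
Hypothesis nd : forall x, distinct_roots (s x) (p x).

Let p0 x : p x != 0. Proof. by case: (nd x). Qed.

Definition path_lift (g : I -> X) (f : I -> R * \Gamma) :=
  forall t, lifts (s \o g) (p \o g) f t.

Let clampE : (@itv01_clamp R 0 = zero) * (@itv01_clamp R 1 = one).
Proof. by split; [rewrite itv01_clamp_le0|rewrite itv01_clamp_ge1]. Qed.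

(** Clamping extends [K] to the whole plane, where the gluing of rectangles takes place. *)
Lemma square_lift_exists (K : I * I -> X) : continuous K ->
  exists F, forall st, lifts (s \o K) (p \o K) F st.
Proof.
move=> cK.
pose k (u : R * R) := K (itv01_clamp u.1, itv01_clamp u.2).
have ck : continuous k.
  apply: continuous_compose cK; apply: continuous_pair => u.
    exact: (continuous_comp (@cvg_fst _ _ _ _ _) (@itv01_clamp_continuous R _)).
  exact: (continuous_comp (@cvg_snd _ _ _ _ _) (@itv01_clamp_continuous R _)).
have cks : continuous (s \o k) by exact: continuous_compose ck cs.
have ckp : continuous (p \o k) by exact: continuous_compose ck cp.
have [f Lf] := lifts_square cks ckp (fun u => nd (k u)).
pose h (st : I * I) : R * R := (itv01_val st.1, itv01_val st.2).
have ch : continuous h.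
  exact: continuous_pair (@val_fst_continuous R) (@val_snd_continuous R).
have kh st : K st = k (h st) by rewrite /k /h /= !itv01_valK; case: st.
exists (f \o h) => st.
apply: lifts_comp (ch st) _ _ (Lf _ _ (itv01_valP st.1) (itv01_valP st.2)) => u.
  by rewrite /= kh.
by rewrite /= kh.
Qed.

Lemma path_lift_exists (g : I -> X) : continuous g -> exists f, path_lift g f.
Proof.
move=> cg; have cK : continuous (fun st : I * I => g st.2).
  by apply: continuous_compose cg => st; exact: cvg_snd.
have [F LF] := square_lift_exists cK.
have ch : continuous (fun t : I => (zero : I, t)).
  have c0 : continuous (fun _ : I => zero : I) by exact: cst_continuous.
  have ci : continuous (@id I) by move=> ?; exact: cvg_id.
  exact: continuous_pair c0 ci.
exists (F \o (fun t => (zero, t))) => t.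
by apply: lifts_comp (ch t) _ _ (LF (zero, t)).
Qed.

Lemma path_lift_deck g f (h : \Gamma) c : sin c = 0 -> path_lift g f ->
  path_lift g (deck h c \o f).
Proof. by move=> sc Lf t; exact: lifts_deck sc (Lf t). Qed.

Lemma path_lift_from (g : I -> X) (x : R * \Gamma) : continuous g ->
  polar_sqr (p (g zero)) x.1 -> exists2 f, path_lift g f & f zero = x.
Proof.
move=> cg px; have [f Lf] := path_lift_exists cg.
have [h [c [sc <-]]] := deck_exists (p0 (g zero)) (lifts_polar (Lf zero)) px.
by exists (deck h c \o f); [exact: path_lift_deck|].
Qed.

Lemma path_lift_unique (g : I -> X) f f' : path_lift g f -> path_lift g f' ->
  f zero = f' zero -> f one = f' one.
Proof.
move=> Lf Lf' ff.
have := lifts_line_eq (fun t => nd (g t)) (@itv01_clamp_continuous R)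
  (@ler01 R) (fun r _ => conj (Lf (itv01_clamp r)) (Lf' (itv01_clamp r))).
by rewrite !clampE => H; exact: H.
Qed.

Lemma path_lift_cst (x : X) y : polar_sqr (p x) y.1 -> path_lift (cst x) (cst y).
Proof.
move=> py t; split; first exact: (@cst_continuous _ _ y.1 t).
  by near=> u.
by move=> c _; near=> u.
Unshelve. all: by end_near. Qed.

Section base_point.
Context (b : X) (a : R).
Hypothesis pa : polar_sqr (p b) a.

Let x0 : R * \Gamma := (a, 1%g).

Let lift_of (l : loop R b) :
  exists gc : \Gamma * R, sin gc.2 = 0 /\
  exists2 f, path_lift l f & f zero = x0 /\ f one = deck gc.1 gc.2 x0.
Proof.
have [|f Lf f0] := @path_lift_from l x0 (@cts_fun _ _ l).
  by rewrite path_zero.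
have := lifts_polar (Lf one); rewrite /= path_one => p1.
have [g [c [sc E]]] := deck_exists (p0 b) (pa : polar_sqr (p b) x0.1) p1.
by exists (g, c); split=> //; exists f.
Qed.

Definition monodromy (l : loop R b) : \Gamma * R := projT1 (cid (lift_of l)).

Lemma sin_monodromy l : sin (monodromy l).2 = 0.
Proof. by rewrite /monodromy; case: cid => gc []. Qed.

Lemma monodromy_lift (l : loop R b) : exists2 f, path_lift l f &
  f zero = x0 /\ f one = deck (monodromy l).1 (monodromy l).2 x0.
Proof. by rewrite /monodromy; case: cid => gc []. Qed.

Lemma monodromyE (l : loop R b) f g c : path_lift l f -> f zero = x0 ->
  f one = deck g c x0 -> monodromy l = (g, c).
Proof.
move=> Lf f0 f1; have [f' Lf' [f'0 f'1]] := monodromy_lift l.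
have := path_lift_unique Lf Lf'; rewrite f0 f'0 => /(_ erefl).
by rewrite f1 f'1 => /deck_inj ->; case: (monodromy l).
Qed.

(** The homotopy is lifted as a whole. Its two sides over the base point lift constant paths, so the
    lift is constant there, and the lifts of [l] and [l'] have the same ends. *)
Lemma monodromy_homotopic (l l' : loop R b) : path_homotopic l l' ->
  monodromy l = monodromy l'.
Proof.
move=> [K [cK K0 K1 Kx Ky]].
have [F LF] := square_lift_exists cK.
have [g [c [sc F00]]] : exists g c, sin c = 0 /\ deck g c (F (zero, zero)) = x0.
  apply: (deck_exists (p0 b)) => //.
  by have := lifts_polar (LF (zero, zero)); rewrite /= Kx.
pose G := deck g c \o F.
have LG st : lifts (s \o K) (p \o K) G st by exact: lifts_deck sc (LF st).
have restrict (h : I -> I * I) (q : I -> X) : continuous h ->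
    K \o h = q -> path_lift q (G \o h).
  by move=> ch <- t; apply: lifts_comp (ch t) _ _ (LG (h t)).
have ci : continuous (@id I) by move=> ?; exact: cvg_id.
have cc (x : I) : continuous (fun _ : I => x) by exact: cst_continuous.
have L0 : path_lift l (G \o (fun t => (zero, t))).
  apply: restrict; first exact: continuous_pair (cc _) ci.
  by apply/funext.
have L1 : path_lift l' (G \o (fun t => (one, t))).
  apply: restrict; first exact: continuous_pair (cc _) ci.
  by apply/funext.
have Lx : path_lift (cst b) (G \o (fun t => (t, zero))).
  apply: restrict; first exact: continuous_pair ci (cc _).
  by apply/funext.
have Ly : path_lift (cst b) (G \o (fun t => (t, one))).
  apply: restrict; first exact: continuous_pair ci (cc _).
  by apply/funext.
have cst_end f : path_lift (cst b) f -> f one = f zero.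
  move=> Lf; have pf : polar_sqr (p b) (f zero).1 := lifts_polar (Lf zero).
  exact: path_lift_unique Lf (path_lift_cst pf) _.
have G10 : G (one, zero) = x0 by rewrite [LHS](cst_end _ Lx).
have G11 : G (one, one) = G (zero, one) := cst_end _ Ly.
have [f' Lf' [f'0 f'1]] := monodromy_lift l'.
case E : (monodromy l') => [h d]; apply: (monodromyE L0) => //=.
rewrite -G11 -[G _]/((G \o (fun t => (one, t))) one).
by rewrite (path_lift_unique L1 Lf') ?f'0 // f'1 E.
Qed.

(** The second half of a lift of the product starts where the lift of [l] ends, so it is the lift of
    [l'] moved by the deck transformation of [l]. *)
Lemma monodromyM (l l' : loop R b) : monodromy (loop_mul l l') =
  ((monodromy l).1 * (monodromy l').1, ((monodromy l).2 + (monodromy l').2)%R)%g.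
Proof.
have [f Lf [f0 f1]] := monodromy_lift l.
have [f' Lf' [f'0 f'1]] := monodromy_lift l'.
have [F LF [F0 F1]] := monodromy_lift (loop_mul l l').
pose hl (t : I) : I := itv01_clamp (2^-1 * itv01_val t + 0).
pose hr (t : I) : I := itv01_clamp (2^-1 * itv01_val t + 2^-1).
have cl : continuous hl.
  exact/clamp_affine_continuous/itv01_val_continuous.
have cr : continuous hr.
  exact/clamp_affine_continuous/itv01_val_continuous.
have Ll : path_lift l (F \o hl).
  suff E u : l u = loop_mul l l' (hl u).
    by move=> t; apply: lifts_comp (cl t) _ _ (LF (hl t)) => u; rewrite /= E.
  have /andP[u0 u1] := itv01_valP u.
  rewrite (loop_mul_clamp l l') ifT; last by lra.
  by rewrite -[in LHS](itv01_valK u); congr (l (itv01_clamp _)); field.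
have Lr : path_lift l' (F \o hr).
  suff E u : l' u = loop_mul l l' (hr u).
    by move=> t; apply: lifts_comp (cr t) _ _ (LF (hr t)) => u; rewrite /= E.
  have /andP[u0 u1] := itv01_valP u.
  rewrite (loop_mul_clamp l l'); case: ifP => u2; last first.
    by rewrite -[in LHS](itv01_valK u); congr (l' (itv01_clamp _)); field.
  have -> : u = zero.
    by rewrite -(itv01_valK u) (_ : itv01_val u = 0) ?clampE //; lra.
  by rewrite itv01_val0 itv01_clamp_ge1 ?path_one ?path_zero //; lra.
have half0 : hl zero = zero.
  by rewrite /hl itv01_val0 mulr0 addr0 clampE.
have half1 : hr one = one.
  by rewrite /hr itv01_val1 mulr1 itv01_clamp_ge1 //; lra.
have halfm : hl one = hr zero.
  by congr itv01_clamp; rewrite itv01_val0 itv01_val1; ring.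
apply: (monodromyE LF F0).
have := path_lift_unique Ll Lf; rewrite /= half0 halfm => /(_ _)/=.
rewrite F0 f0 => /(_ erefl) Fm.
have := path_lift_unique Lr (path_lift_deck _ (sin_monodromy l) Lf').
move=> /(_ (monodromy l).1) /=; rewrite half1 Fm f'0 f1 => /(_ erefl) ->.
by rewrite f'1 deckM // sin_monodromy.
Qed.

Definition pi1_monodromy (x : fundamental_group R b) : \Gamma * R :=
  monodromy (loop_repr x).

Lemma pi1_monodromy_class l : pi1_monodromy (loop_class l) = monodromy l.
Proof. exact/monodromy_homotopic/loop_repr_class. Qed.

Lemma pi1_monodromyM x y : pi1_monodromy (x * y)%g =
  ((pi1_monodromy x).1 * (pi1_monodromy y).1,
   ((pi1_monodromy x).2 + (pi1_monodromy y).2)%R)%g.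
Proof. by rewrite [LHS]pi1_monodromy_class monodromyM. Qed.

End base_point.
End monodromy.

(** * Loops in the twice punctured plane *)

Section integer_powers.
Local Open Scope group_scope.
Context (G : groupType).
Implicit Types (x : G).

Definition zexpg x (n : int) : G :=
  match n with Posz k => x ^+ k | Negz k => x ^- k.+1 end.

Lemma zexpgS x n : zexpg x (n + 1)%R = zexpg x n * x.
Proof.
case: n => [n|[|n]]; first by rewrite /= addn1 expgSr.
  by rewrite /= expg1 mulVg.
have -> : (Negz n.+1 + 1)%R = Negz n by rewrite !NegzE -addn1 PoszD; ring.
by rewrite /= (expgS x n.+1) invgM mulgVK.
Qed.

Lemma zexpgD x m n : zexpg x (m + n)%R = zexpg x m * zexpg x n.
Proof.
elim/int_rect: n => [|n IH|n IH]; first by rewrite addr0 mulg1.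
  by rewrite -addn1 PoszD addrA !zexpgS IH mulgA.
apply: (@mulIg _ x); rewrite -zexpgS -mulgA -zexpgS.
rewrite (_ : - n.+1%:Z + 1 = - n%:Z)%R -?IH; last by rewrite -addn1 PoszD; ring.
by congr zexpg; rewrite -addn1 PoszD; ring.
Qed.

Section dihedral_action.
Variables (alpha beta : G).

(* The subgroup of index two generated by [fp_t] and [fp_s * fp_t * fp_s] is
   free.  The following action of [Z_2 * Z] is induced from the right action of
   that subgroup on [G] in which the generators multiply by [alpha] and [beta]. *)
Definition swap_act (x : G * bool) (a : Z2group) : G * bool :=
  (x.1, x.2 (+) odd (a : 'Z_2)).

(** The boolean names a coset, which [fp_s] switches. From the coset [false], [fp_t] thus multiplies
    by [alpha] and [fp_s * fp_t * fp_s] by [beta]. *)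
Definition power_act (x : G * bool) (n : Zgroup) : G * bool :=
  (x.1 * zexpg (if x.2 then beta else alpha) n, x.2).

Definition gamma_act : G * bool -> \Gamma -> G * bool :=
  fp_act swap_act power_act.

Let swap1 (x : G * bool) : swap_act x 1 = x.
Proof. by case: x => f e; rewrite /swap_act addbF. Qed.

Let swapM (x : G * bool) a b : swap_act x (a * b) = swap_act (swap_act x a) b.
Proof.
case: x => f e; rewrite /swap_act /= -addbA; congr (_, _ (+) _).
by case: a b => [[|[|?]] ?] [[|[|?]] ?].
Qed.

Let power1 (x : G * bool) : power_act x 1 = x.
Proof. by case: x => f e; rewrite /power_act /= mulg1. Qed.

Let powerM (x : G * bool) a b : power_act x (a * b) = power_act (power_act x a) b.
Proof. by case: x => f e; rewrite /power_act /= zexpgD mulgA. Qed.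

Lemma gamma_actM (x : G * bool) g h : gamma_act x (g * h)
  = gamma_act (gamma_act x g) h.
Proof. exact: fp_actM. Qed.

Lemma gamma_act1 (x : G * bool) : gamma_act x 1 = x.
Proof. exact: fp_act1. Qed.

Lemma gamma_act_s f e : gamma_act (f, e) fp_s = (f, ~~ e).
Proof.
rewrite /gamma_act (fp_act_inl swap1 power1 swapM powerM) /swap_act.
by congr (f, _); case: e.
Qed.

Lemma gamma_act_t f e :
  gamma_act (f, e) fp_t = (f * (if e then beta else alpha), e).
Proof. by rewrite /gamma_act (fp_act_inr swap1 power1 swapM powerM) /power_act /= expg1. Qed.

Lemma gamma_act_eqV (x y : G * bool) g : gamma_act x g = y -> gamma_act y g^-1 = x.
Proof. by move=> <-; rewrite -gamma_actM mulgV gamma_act1. Qed.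

End dihedral_action.
End integer_powers.

Section punctured_plane.
Context (R : realType).
Local Open Scope complex_scope.
Notation C := (R[i]^o).
Notation I := (unit_interval R).
Notation Re := complex.Re.
Notation Im := complex.Im.

Definition punctured_plane : Type := set_type [set z : C | z ^+ 2 != 1].
HB.instance Definition _ := Topological.on punctured_plane.
Notation Y := punctured_plane.

Definition plane_val (y : Y) : C := \val y.

Lemma plane_valP y : plane_val y ^+ 2 != 1.
Proof. exact: (set_mem (valP y)). Qed.

Lemma plane_val_continuous : continuous plane_val.
Proof. exact: initial_continuous. Qed.

Lemma plane_val_inj : injective plane_val.
Proof. exact: val_inj. Qed.

Fact zero_punctured : (0 : C) \in [set z : C | z ^+ 2 != 1].
Proof. by rewrite inE /= expr0n eq_sym oner_eq0. Qed.

Definition plane_zero : Y := exist _ (0 : C) zero_punctured.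

Definition to_plane (z : C) : Y := insubd plane_zero z.

Lemma to_planeK z : z ^+ 2 != 1 -> plane_val (to_plane z) = z.
Proof. by move=> z1; rewrite /plane_val /to_plane insubdK // inE. Qed.

Lemma to_plane_continuous (T : topologicalType) (F : T -> C) :
  continuous F -> (forall t, F t ^+ 2 != 1) -> continuous (to_plane \o F).
Proof.
move=> cF F1; apply: continuous_comp_initial.
rewrite (_ : _ \o _ = F) //; apply/funext => t /=; exact: to_planeK.
Qed.

End punctured_plane.

(** * Straight paths, hubs of the charts, and tethers *)

Section straight_paths.
Context (R : realType).
Local Open Scope complex_scope.
Notation C := (R[i]^o).
Notation I := (unit_interval R).
Notation Re := complex.Re.
Notation Im := complex.Im.
Notation Y := (punctured_plane R).
Implicit Types (y z w : Y) (c : sheet).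

Definition on_line (z w : C) (t : R) : C := z + t%:C * (w - z).

Lemma on_lineRe (z w : C) t : Re (on_line z w t) = Re z + t * (Re w - Re z).
Proof. by case: z w => a b [a' b'] /=; ring. Qed.

Lemma on_lineIm (z w : C) t : Im (on_line z w t) = Im z + t * (Im w - Im z).
Proof. by case: z w => a b [a' b'] /=; ring. Qed.

Lemma on_line0 (z w : C) : on_line z w 0 = z.
Proof. by rewrite /on_line mul0r addr0. Qed.

Lemma on_line1 (z w : C) : on_line z w 1 = w.
Proof. by rewrite /on_line mul1r addrC subrK. Qed.

Lemma on_line_continuous (T : topologicalType) (f g : T -> C) (h : T -> R) :
  continuous f -> continuous g -> continuous h ->
  continuous (fun t => on_line (f t) (g t) (h t) : C).
Proof.
move=> cf cg ch t.
have cH : {for t, continuous (fun t => (h t)%:C : C)}.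
  by apply: complex_continuous; [exact: ch|exact: cvg_cst].
have cB : {for t, continuous (fun t => g t - f t : C)}.
  exact: continuous_subC (cg t) (cf t).
exact: continuous_addC (cf t) (continuous_mulC cH cB).
Qed.

Lemma sqr_neq1 (z : C) : Im z != 0 \/ Re z ^+ 2 != 1 -> z ^+ 2 != 1.
Proof.
case: z => a b /= ab; rewrite expr2 eq_complex /=.
apply/negP => /andP[/eqP e1 /eqP e2].
have {}e2 : a * b = 0 by nra.
move/eqP: e2; rewrite mulf_eq0 => /orP[|] /eqP e0.
  by move: e1; rewrite e0; nra.
by case: ab => /eqP; apply=> //; rewrite expr2; nra.
Qed.

Lemma chart_sqr_neq1 c (z : C) : chart c z -> z ^+ 2 != 1.
Proof.
move=> cz; apply: sqr_neq1; move: cz; case: c => /= [[/eqP|]|z1|z1].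
- by left.
- rewrite ltr_norml => /andP[z1 z2]; right; apply/eqP; nra.
- by right; apply/eqP; nra.
- by right; apply/eqP; nra.
Qed.

Definition straight z w (p : {path I from z to w}) :=
  forall t, plane_val (p t) = on_line (plane_val z) (plane_val w) (itv01_val t).

Lemma straight_exists z w :
  (forall t, 0 <= t <= 1 ->
     on_line (plane_val z) (plane_val w) t ^+ 2 != 1) ->
  exists p : {path I from z to w}, straight p.
Proof.
move=> zw.
pose f (t : I) := to_plane (on_line (plane_val z) (plane_val w) (itv01_val t)).
have fE t : plane_val (f t) = on_line (plane_val z) (plane_val w) (itv01_val t).
  by apply: to_planeK; apply: zw; exact: itv01_valP.
have cf : continuous f.
  apply: to_plane_continuous => [|t]; last by apply: zw; exact: itv01_valP.
  by apply: on_line_continuous; [exact: cst_continuous|exact: cst_continuous|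
    exact: itv01_val_continuous].
have f0 : f zero = z.
  by apply: plane_val_inj; rewrite fE itv01_val0 on_line0.
have f1 : f one = w.
  by apply: plane_val_inj; rewrite fE itv01_val1 on_line1.
by exists [the {path I from z to w} of mk_path cf f0 f1].
Qed.

Lemma straight_hclass z w (p q : {path I from z to w}) :
  straight p -> straight q -> hclass p = hclass q.
Proof.
move=> sp sq; congr hclass; apply/path_eqP => t.
by apply: plane_val_inj; rewrite sp sq.
Qed.

(** The cone from [z] over [p] lies in the punctured plane; read as a square with one side collapsed
    to [z], it gives the relation. *)
Lemma straight_hmul z x y (p : {path I from x to y}) (l : {path I from z to x})
    (l' : {path I from z to y}) :
  (forall t r, 0 <= r <= 1 ->
     on_line (plane_val z) (plane_val (p t)) r ^+ 2 != 1) ->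
  straight l -> straight l' -> hmul (hclass l) (hclass p) = hclass l'.
Proof.
move=> star sl sl'.
pose F0 (u : R * R) : C := on_line (plane_val z)
  (plane_val (p (itv01_clamp u.1))) (itv01_val (itv01_clamp u.2)).
have cF0 : continuous F0.
  apply: on_line_continuous.
  - exact: cst_continuous.
  - have cp : continuous (fun u : R * R => p (itv01_clamp u.1)).
      apply: continuous_compose (@cts_fun _ _ p) => u.
      exact: (continuous_comp (@cvg_fst _ _ _ _ _) (@itv01_clamp_continuous R _)).
    exact: continuous_compose cp (@plane_val_continuous R).
  - have cc : continuous (fun u : R * R => itv01_clamp u.2).
      move=> u.
      exact: (continuous_comp (@cvg_snd _ _ _ _ _) (@itv01_clamp_continuous R _)).
    exact: continuous_compose cc (@itv01_val_continuous R).
have F01 u : F0 u ^+ 2 != 1 by apply: star; exact: itv01_valP.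
have cF := to_plane_continuous cF0 F01.
have val0 : itv01_val (@itv01_clamp R 0) = 0.
  by rewrite itv01_clampK // lexx ler01.
have val1 : itv01_val (@itv01_clamp R 1) = 1.
  by rewrite itv01_clampK // lexx ler01.
have c0 : @itv01_clamp R 0 = zero by rewrite itv01_clamp_le0.
have c1 : @itv01_clamp R 1 = one by rewrite itv01_clamp_ge1.
rewrite -[RHS]hmul1 /hone; apply/esym; apply: (square_homotopic cF) => t;
  apply: plane_val_inj; rewrite /= to_planeK // /F0 /=.
- by rewrite val0 on_line0.
- by rewrite val1 on_line1 itv01_valK.
- by rewrite sl c0 path_zero itv01_valK.
- by rewrite sl' c1 path_one itv01_valK.
Qed.

(** Centres for which the charts are star-shaped. The outer ones are off the real axis, hence also
    in [Middle], and on the side of their cut where the weight is 1. *)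
Definition hub_val c : C :=
  match c with Middle => 0 | Right => 2 +i* 1 | Left => -2 -i* 1 end.

Lemma chart_hub c : chart c (hub_val c).
Proof.
case: c => /=; first by right; rewrite normr0.
  by rewrite ltr1n.
by rewrite ltrN2 ltr1n.
Qed.

Definition hub c : Y := to_plane (hub_val c).

Lemma hubE c : plane_val (hub c) = hub_val c.
Proof. exact/to_planeK/chart_sqr_neq1/chart_hub. Qed.

Lemma chart_star c (z : C) r : chart c z -> 0 <= r <= 1 ->
  chart c (on_line (hub_val c) z r).
Proof.
move=> cz /andP[r0 r1]; move: cz; case: c => /=.
- rewrite on_lineRe on_lineIm /= !add0r !subr0 => -[zI|zR].
    have [->|rn0] := eqVneq r 0; first by right; rewrite mul0r normr0.
    by left; apply/eqP; rewrite mulf_neq0 //; exact/eqP.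
  right; rewrite normrM (ger0_norm r0); apply: le_lt_trans zR.
  by rewrite ler_piMl.
- rewrite on_lineRe /= => zR.
  have [->|r1'] := eqVneq r 1; first by lra.
  have {r1'} : r < 1 by rewrite lt_neqAle r1' r1.
  nra.
- rewrite on_lineRe /= => zR.
  have [->|r1'] := eqVneq r 1; first by lra.
  have {r1'} : r < 1 by rewrite lt_neqAle r1' r1.
  nra.
Qed.

Lemma straight_hub c y : chart c (plane_val y) ->
  exists l : {path I from hub c to y}, straight l.
Proof.
move=> cy; apply: straight_exists => t t01; rewrite hubE.
exact/chart_sqr_neq1/chart_star.
Qed.

Lemma chart_hmul c x y (p : {path I from x to y})
    (l : {path I from hub c to x}) (l' : {path I from hub c to y}) :
  (forall t, chart c (plane_val (p t))) ->
  straight l -> straight l' -> hmul (hclass l) (hclass p) = hclass l'.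
Proof.
move=> cp; apply: straight_hmul => t r r01; rewrite hubE.
exact/chart_sqr_neq1/chart_star.
Qed.

Notation origin := (hub Middle).

(* Paths inside the middle chart are trivial for these tethers, and so are the
   straight paths from the hub of an outer chart to the points of its cut. *)
Definition tether_spec y (a : hpath R origin y) : Prop :=
  (chart Middle (plane_val y) ->
     forall l : {path I from origin to y}, straight l -> a = hclass l) /\
  (~ chart Middle (plane_val y) -> forall c, chart c (plane_val y) ->
     forall (l0 : {path I from origin to hub c})
       (l1 : {path I from hub c to y}), straight l0 -> straight l1 ->
     a = hmul (hclass l0) (hclass l1)).

Lemma middle_hub c : chart Middle (hub_val c).
Proof.
case: c => /=; first by right; rewrite normr0.
  by left; apply/eqP; rewrite oner_eq0.
by left; apply/eqP; rewrite oppr_eq0 oner_eq0.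
Qed.

Lemma plane_cover y : exists c, chart c (plane_val y).
Proof.
have := plane_valP y; rewrite sqrf_eq1 negb_or => /andP[y1 yN1].
exact: chart_cover.
Qed.

Lemma tether_exists y : exists a : hpath R origin y, tether_spec a.
Proof.
have [My|nMy] := pselect (chart Middle (plane_val y)).
  have [l sl] := straight_hub My.
  by exists (hclass l); split=> // _ l' sl'; exact: straight_hclass.
have [c cy] := plane_cover y.
have [l0 sl0] : exists l0 : {path I from origin to hub c}, straight l0.
  by apply: straight_hub; rewrite hubE; exact: middle_hub.
have [l1 sl1] := straight_hub cy.
exists (hmul (hclass l0) (hclass l1)); split=> // _ c' c'y.
(* Outside [Middle] the outer chart is determined, the two half planes being disjoint. *)
have -> : c' = c.
  by move: cy c'y nMy; case: c c' {l0 sl0 l1 sl1} => -[] //= *; exfalso; lra.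
by move=> m0 m1 s0 s1; rewrite (straight_hclass s0 sl0) (straight_hclass s1 sl1).
Qed.

Definition tether y : hpath R origin y := projT1 (cid (tether_exists y)).

Lemma tetherP y : tether_spec (tether y).
Proof. exact: projT2 (cid (tether_exists y)). Qed.

Lemma tether_origin : tether origin = hone R origin.
Proof.
have [] := tetherP origin; rewrite hubE => /(_ (middle_hub Middle)) + _.
move=> /(_ [the {path I from origin to origin} of cst origin]); apply=> t.
by rewrite /on_line subrr mulr0 addr0.
Qed.

End straight_paths.

(** * The label of a path determines its tethered class *)

Section label_trivial_loops.
Context (R : realType).
Local Open Scope complex_scope.
Notation C := (R[i]^o).
Notation I := (unit_interval R).
Notation Re := complex.Re.
Notation Im := complex.Im.
Notation Y := (punctured_plane R).
Notation hub := (@hub R).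
Notation hub_val := (@hub_val R).
Notation origin := (hub Middle).
Notation T := (tethered (@tether R)).
Implicit Types (x y z w : Y) (c : sheet).

Lemma tethered_middle x y (p : {path I from x to y}) :
  (forall t, chart Middle (plane_val (p t))) -> T (hclass p) = 1%g.
Proof.
move=> Mp; have := Mp zero; have := Mp one.
rewrite path_zero path_one => My Mx.
have [l sl] := straight_hub Mx; have [l' sl'] := straight_hub My.
rewrite /tethered ((tetherP x).1 Mx _ sl) ((tetherP y).1 My _ sl').
by rewrite (chart_hmul Mp sl sl') hmulV pi1_of_one.
Qed.

(** The endpoints are on the same side of the real axis, so the segment avoids it. *)
Lemma straight_middle z w (p : {path I from z to w}) :
  0 < Im (plane_val z) * Im (plane_val w) -> straight p ->
  T (hclass p) = 1%g.
Proof.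
move=> zw sp; apply: tethered_middle => t; left; rewrite sp on_lineIm.
have /andP[t0 t1] := itv01_valP t; move: (itv01_val t) t0 t1 => r r0 r1.
move: (Im (plane_val z)) (Im (plane_val w)) zw => a b ab e.
have : a * (a + r * (b - a)) = 0 by rewrite e mulr0.
have a0 : 0 < a ^+ 2 by rewrite exprn_even_gt0 //=; apply/eqP => a0; nra.
rewrite (_ : _ * _ = (1 - r) * a ^+ 2 + r * (a * b)); last by ring.
have [->|rn1] := eqVneq r 1; first by lra.
have {rn1} : r < 1 by rewrite lt_neqAle rn1 r1.
nra.
Qed.

(** For an outer chart, the segment from the hub to its conjugate crosses the cut once. *)
Definition mirror c : Y := to_plane (hub_val c)^*.

Lemma mirrorE c : plane_val (mirror c) = (hub_val c)^*.
Proof.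
apply/to_planeK/sqr_neq1; case: c => /=; first by right; apply/eqP; lra.
- by left; apply/eqP; lra.
- by left; apply/eqP; lra.
Qed.

Lemma chart_mirror c : chart c (plane_val (mirror c)).
Proof.
rewrite mirrorE; case: c => /=; first by right; rewrite normr0.
  by lra.
by lra.
Qed.

(* The loop around the puncture of an outer chart. *)
Definition cut_loop c : fundamental_group R origin :=
  T (hclass (projT1 (cid (straight_hub (@chart_mirror c))))).

(** The counterpart of [weight] in the fundamental group: the sign condition says that [z] lies
    across the cut from the hub, which is where the weight is not 1. *)
Definition crossing c (z : C) : fundamental_group R origin :=
  if Im (hub_val c) * Im z < 0 then cut_loop c else 1%g.

(** On the cut, the tether of [y] passes through the hub and cancels with [l]. On the hub's side of
    the cut, [l] stays in [Middle]. On the other side, [l] is deformed in the half plane to the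
    segment to [mirror c], giving [cut_loop c], followed by a segment on one side of the axis. *)
Lemma tethered_straight c y (l : {path I from hub c to y}) :
  chart c (plane_val y) -> straight l -> T (hclass l) = crossing c (plane_val y).
Proof.
move=> cy sl; rewrite /crossing.
have [My|nMy] := pselect (chart Middle (plane_val y)); last first.
  have Im0 : Im (plane_val y) = 0.
    by apply/eqP; apply/negPn/negP => /eqP y0; apply: nMy; left.
  rewrite Im0 mulr0 ltxx.
  have Mc : chart Middle (plane_val (hub c)).
    by rewrite hubE; exact: middle_hub.
  have [l0 sl0] := straight_hub Mc.
  rewrite /tethered ((tetherP (hub c)).1 Mc _ sl0).
  by rewrite ((tetherP y).2 nMy c cy _ _ sl0 sl) hmulV pi1_of_one.
have [neg|pos|zero0] := ltgtP (Im (hub_val c) * Im (plane_val y)) 0.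
- rewrite /cut_loop; case: cid => l1 sl1 /=.
  have [p sp] : exists p : {path I from mirror c to y}, straight p.
    apply: straight_exists => t t01; apply: (@chart_sqr_neq1 _ c).
    move: t01 cy (@chart_mirror c) neg => /andP[t0 t1].
    case: c {sl l l1 sl1} => /=; rewrite ?mul0r ?ltxx // on_lineRe => + + _.
      have [->|t1'] := eqVneq t 1; first by lra.
      by have {t1'} : t < 1 by [rewrite lt_neqAle t1' t1]; nra.
    have [->|t1'] := eqVneq t 1; first by lra.
    by have {t1'} : t < 1 by [rewrite lt_neqAle t1' t1]; nra.
  have cp t : chart c (plane_val (p t)).
    rewrite sp; have /andP[t0 t1] := itv01_valP t.
    move: (itv01_val t) t0 t1 => r r0 r1.
    move: cy (@chart_mirror c) neg.
    case: c {sl l l1 sl1 p sp} => /=; rewrite ?mul0r ?ltxx // on_lineRe => + + _.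
      have [->|t1'] := eqVneq r 1; first by lra.
      by have {t1'} : r < 1 by [rewrite lt_neqAle t1' r1]; nra.
    have [->|t1'] := eqVneq r 1; first by lra.
    by have {t1'} : r < 1 by [rewrite lt_neqAle t1' r1]; nra.
  rewrite -(chart_hmul cp sl1 sl) tetheredM (straight_middle _ sp) ?mulg1 //.
  by rewrite mirrorE; case: (hub_val c) neg => a b /=; nra.
- by apply: straight_middle sl; rewrite hubE.
- move: zero0; case: c cy l sl => cy l sl /=.
  + by move=> _; apply: tethered_middle => t; rewrite sl hubE;
      apply: chart_star => //; exact: itv01_valP.
  + move=> y0; have {}y0 : Im (plane_val y) = 0 by lra.
    by move: cy My; rewrite /= y0 ltr_norml => ? -[|?]; [|exfalso; lra].
  + move=> y0; have {}y0 : Im (plane_val y) = 0 by lra.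
    by move: cy My; rewrite /= y0 ltr_norml => ? -[|?]; [|exfalso; lra].
Qed.

Lemma tethered_chart c x y (p : {path I from x to y}) :
  (forall t, chart c (plane_val (p t))) ->
  T (hclass p) = ((crossing c (plane_val x))^-1 * crossing c (plane_val y))%g.
Proof.
move=> cp; have := cp zero; have := cp one.
rewrite path_zero path_one => cy cx.
have [l sl] := straight_hub cx; have [l' sl'] := straight_hub cy.
rewrite -(tethered_straight cx sl) -(tethered_straight cy sl').
by rewrite -(chart_hmul cp sl sl') tetheredM mulKg.
Qed.

Notation act := (gamma_act (cut_loop Right) (cut_loop Left)).

(** The dictionary between the two sides: a weight preserves the coset [false] and acts there as the
    corresponding crossing. *)
Lemma gamma_act_weight f c (z : C) :
  act (f, false) (weight c z) = ((f * crossing c z)%g, false).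
Proof.
rewrite /crossing; case: c => /=.
- by rewrite mul0r ltxx gamma_act1 mulg1.
- rewrite mul1r; case: ifP => _; first exact: gamma_act_t.
  by rewrite gamma_act1 mulg1.
- rewrite mulN1r oppr_lt0; case: ifP => _; last by rewrite gamma_act1 mulg1.
  by rewrite !gamma_actM gamma_act_s gamma_act_t gamma_act_s.
Qed.

Lemma gamma_act_weightV f c (z : C) :
  act (f, false) (weight c z)^-1%g = ((f * (crossing c z)^-1)%g, false).
Proof. by apply: gamma_act_eqV; rewrite gamma_act_weight mulgVK. Qed.

(** Inside one chart the change of label is a quotient of weights and the tethered class is the same
    quotient of crossings; both sides are multiplicative under subdivision. Quantifying over [f]
    lets consecutive pieces be chained. *)
Lemma labelled_subpath (u : R -> Y) (cu : continuous u) (l : R -> \Gamma) :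
  (forall r, labelled (@plane_val R \o u) l r) ->
  forall f, act (f, false) ((l 0%R)^-1 * l 1%R)%g =
    ((f * T (subpath cu 0%R 1%R))%g, false).
Proof.
move=> Ll.
apply: (interval_induction (Q := fun a b => forall f,
  act (f, false) ((l a)^-1 * l b)%g = ((f * T (subpath cu a b))%g, false)))
  => [|x _|a b e _ _ ab be f].
- exact: ler01.
- have [c cx] := plane_cover (u x).
  have cpu : continuous (@plane_val R \o u).
    exact: continuous_compose cu (@plane_val_continuous R).
  have nc : \forall r \near x, chart c (plane_val (u r)).
    exact: (cpu x _ (chart_open cx)).
  have [e e0 He] := near_itv (filterI nc (Ll x c cx)).
  exists e => // a b xa ab bx f.
  have [ca la] := He a ltac:(lra) ltac:(lra).
  have [cb lb] := He b ltac:(lra) ltac:(lra).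
  have -> : ((l a)^-1 * l b = (weight c (plane_val (u a)))^-1 *
      weight c (plane_val (u b)))%g.
    rewrite -[l b](mulgVK (weight c (plane_val (u b)))).
    by rewrite [X in (_ * (X * _))%g](etrans lb (esym la)) /= -!mulgA mulKg.
  rewrite gamma_actM gamma_act_weightV gamma_act_weight -mulgA.
  rewrite (tethered_chart (c := c)) // => t /=.
  have /andP[t0 t1] := itv01_valP t.
  apply: (He _ _ _).1; nra.
- rewrite -(mulgK (l b) (l a)^-1)%g -mulgA.
  rewrite gamma_actM ab be.
  by rewrite -(subpathM cu a b e) tetheredM mulgA.
Qed.

Lemma labelled_loop_trivial (v : {path I from origin to origin})
    (l : I -> \Gamma) :
  (forall t, labelled (@plane_val R \o v) l t) -> l zero = l one ->
  hclass v = hone R origin.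
Proof.
move=> Ll l01.
pose u := v \o (@itv01_clamp R).
have cu : continuous u.
  exact: continuous_compose (@itv01_clamp_continuous R) (@cts_fun _ _ v).
have Lu r : labelled (@plane_val R \o u) (l \o @itv01_clamp R) r.
  by move=> c cr; exact: (@itv01_clamp_continuous R r _ (Ll _ c cr)).
have := labelled_subpath cu Lu 1%g.
have c0 : @itv01_clamp R 0 = zero by rewrite itv01_clamp_le0.
have c1 : @itv01_clamp R 1 = one by rewrite itv01_clamp_ge1.
rewrite /= c0 c1 l01 mulVg gamma_act1 mul1g => -[T1].
(* The ends [u 0] and [u 1] equal the origin only by a proof, so the class of the subpath has to be
   transported to the type of loops. *)
have cast x y (p : {path I from x to y}) : x = origin -> y = origin ->
    p =1 v -> T (hclass p) = T (hclass v).
  move=> xo yo; subst x y => pv; congr (T (hclass _)); exact/path_eqP.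
have {}T1 : T (hclass v) = 1%g.
  rewrite T1; apply/esym/cast.
  - by rewrite /u /= c0 path_zero.
  - by rewrite /u /= c1 path_one.
  - by move=> t; rewrite /= /mk_path /subpath_fun /u /= subr0 mul1r addr0 itv01_valK.
apply: pi1_of_inj; rewrite pi1_of_one -T1 /tethered tether_origin hmul1.
by rewrite -[X in pi1_of X](hmulK _ (hone R origin)) hmulr1.
Qed.

End label_trivial_loops.

(** * Configurations as roots of polynomials *)

Section pointwise_continuity.
Context (T : topologicalType) (t : T).

(** Pointwise form, for maps such as the inverse coordinate, whose continuity is known only at
    nonzero points. *)
Lemma continuous_at_initial (S : choiceType) (Z : topologicalType) (w : S -> Z)
    (f : T -> initial_topology w) :
  {for t, continuous (w \o f)} -> {for t, continuous f}.
Proof.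
move=> cf U [_ /= [[W oW <-]]] /= Wsfz /filterS; apply; apply: cf.
exact: open_nbhs_nbhs.
Qed.

Lemma continuous_at_ptws (J : Type) (M : topologicalType)
    (f : T -> {ptws J -> M}) :
  (forall j, {for t, continuous (fun u => f u j)}) -> {for t, continuous f}.
Proof.
move=> cf; apply/cvg_sup => j U [_ /= [[W oW <-]]] /= Wsfz /filterS.
by apply; apply: (cf j); exact: open_nbhs_nbhs.
Qed.

Lemma continuous_at_near (Z : topologicalType) (f g : T -> Z) :
  (\forall u \near t, f u = g u) -> {for t, continuous f} ->
  {for t, continuous g}.
Proof.
move=> fg cf; rewrite /prop_for /continuous_at -(nbhs_singleton fg).
by apply: cvg_trans cf; apply: near_eq_cvg; apply: filterS fg.
Qed.

End pointwise_continuity.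

Lemma ptws_eval_continuous (J : Type) (M : topologicalType) (j : J) :
  continuous (fun f : {ptws J -> M} => f j).
Proof.
move=> f; have /cvg_sup/(_ j) cf : nbhs f --> f by exact: cvg_id.
move=> A /(@initial_continuous _ _ (fun g : J -> M => g j) f) /cf.
by [].
Qed.

Section complex_square_root.
Context (R : realType).
Notation C := (R[i]^o).
Local Open Scope complex_scope.

Definition right_sqrt (u : C) : C :=
  (sqrtmod u)%:C * cis (atan (complex.Im u / complex.Re u) / 2).

Lemma right_sqrtK (u : C) : 0 < complex.Re u -> right_sqrt u ^+ 2 = u.
Proof. by move=> /polar_sqr_atan; rewrite /polar_sqr => <-. Qed.

Lemma right_sqrt_continuous (u : C) : 0 < complex.Re u ->
  {for u, continuous right_sqrt}.
Proof.
move=> u0; have ci : {for u, continuous (fun w : C => complex.Im w : R)}.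
  exact: Im_continuous.
have cr : {for u, continuous (fun w : C => complex.Re w : R)}.
  exact: Re_continuous.
have cq : {for u, continuous (fun w : C => complex.Im w / complex.Re w)}.
  apply: (@cvgM R C (nbhs u) _ (fun w : C => complex.Im w)
    (fun w : C => (complex.Re w)^-1) _ _ ci).
  by apply: (@cvgV R C (nbhs u) _ _ _ _ cr); rewrite gt_eqF.
have ca : {for u, continuous (fun w : C => atan (complex.Im w / complex.Re w) / 2)}.
  apply: (@cvgM R C (nbhs u) _ (fun w : C => atan (complex.Im w / complex.Re w))
    (fun=> 2^-1) _ _ _ (@cvg_cst _ _ _ _ _)).
  exact: (continuous_comp cq (@continuous_atan R _)).
apply: continuous_mulC; last exact: (continuous_comp ca (@cis_continuous R _)).
apply: complex_continuous; last exact: (@cst_continuous C R 0 u).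
exact: sqrtmod_continuous.
Qed.

End complex_square_root.

(** * Unordered pairs in a space identified by [f] and [g] with the nonzero complex numbers,
    described by their sum and product *)

Section configurations.
Context (R : realType) (M : topologicalType).
Notation C := (R[i]^o).
Notation X := (unordered_configuration 2 M).
Context (f : M -> C) (g : C -> M).
Hypothesis cf : continuous f.
Hypothesis f0 : forall m, f m != 0.
Hypothesis fK : cancel f g.
Hypothesis gK : forall z : C, z != 0 -> f (g z) = z.
Hypothesis cg : forall z : C, z != 0 -> {for z, continuous g}.
Context (b : X).
Implicit Types (x : X) (m : M) (y : ordered_configuration 2 M).

Let f_inj : injective f. Proof. exact: can_inj fK. Qed.

Definition config_at y (j : 'I_2) : C := f (\val y j).

Lemma config_at_continuous j : continuous (config_at^~ j).
Proof.
move=> y; have cv : {for y, continuous (fun y => \val y j)}.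
  apply: (@continuous_comp _ _ _ (fun y => \val y : {ptws 'I_2 -> M})
    (fun h => h j)); first exact: initial_continuous.
  exact: ptws_eval_continuous.
exact: (continuous_comp cv (@cf _)).
Qed.

Definition ord_sum y : C := config_at y ord0 + config_at y ord_max.
Definition ord_prod y : C := config_at y ord0 * config_at y ord_max.

Definition proj_config y : X := \pi_({eq_quot (@permuted_rel 2 M)}) y.

Lemma proj_config_continuous : continuous proj_config.
Proof.
exact: (@pi_continuous (ordered_configuration 2 M)
  {eq_quot (@permuted_rel 2 M)}).
Qed.

Lemma proj_configP y y' : proj_config y = proj_config y' <-> permuted y y'.
Proof.
split=> [yy|yy]; last by apply/eqmodP/asboolP.
by apply/asboolP; move/eqmodP: yy.
Qed.

Let ord2 (j : 'I_2) : j = ord0 \/ j = ord_max.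
Proof. by case: j => [[|[|//]]] H; [left|right]; exact: val_inj. Qed.

Let perm_ord2 (s : 'S_2) : (s ord0 = ord0 /\ s ord_max = ord_max) \/
  (s ord0 = ord_max /\ s ord_max = ord0).
Proof.
have s01 : s ord0 <> s ord_max by move/perm_inj.
case: (ord2 (s ord0)) (ord2 (s ord_max)) => e0 [] e1; move: s01; rewrite e0 e1 //.
  by left.
by right.
Qed.

Lemma ord_sum_permuted y y' : permuted y y' -> ord_sum y = ord_sum y'.
Proof.
move=> [s sP]; rewrite /ord_sum /config_at !sP.
by case: (perm_ord2 s) => -[-> ->] //; rewrite addrC.
Qed.

Lemma ord_prod_permuted y y' : permuted y y' -> ord_prod y = ord_prod y'.
Proof.
move=> [s sP]; rewrite /ord_prod /config_at !sP.
by case: (perm_ord2 s) => -[-> ->] //; rewrite mulrC.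
Qed.

Definition root_sum (x : X) : C := ord_sum (repr x).
Definition root_prod (x : X) : C := ord_prod (repr x).

Lemma root_sum_proj y : root_sum (proj_config y) = ord_sum y.
Proof.
by apply: ord_sum_permuted; apply/proj_configP; rewrite /proj_config reprK.
Qed.

Lemma root_prod_proj y : root_prod (proj_config y) = ord_prod y.
Proof.
by apply: ord_prod_permuted; apply/proj_configP; rewrite /proj_config reprK.
Qed.

Lemma root_sum_continuous : continuous root_sum.
Proof.
apply: (@repr_comp_continuous _ _ _ ord_sum) => [y|y y' /eqP yy].
  exact: continuous_addC (@config_at_continuous _ y) (@config_at_continuous _ y).
by apply/eqP/ord_sum_permuted/proj_configP.
Qed.

Lemma root_prod_continuous : continuous root_prod.
Proof.
apply: (@repr_comp_continuous _ _ _ ord_prod) => [y|y y' /eqP yy].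
  exact: continuous_mulC (@config_at_continuous _ y) (@config_at_continuous _ y).
by apply/eqP/ord_prod_permuted/proj_configP.
Qed.

Lemma proj_config_ex x : exists y, x = proj_config y.
Proof. by exists (repr x); rewrite /proj_config reprK. Qed.

Lemma root_distinct x : distinct_roots (root_sum x) (root_prod x).
Proof.
have [y ->] := proj_config_ex x; rewrite root_sum_proj root_prod_proj.
split; first by rewrite mulf_neq0 // f0.
rewrite -subr_eq0 (_ : _ - _ = (config_at y ord0 - config_at y ord_max) ^+ 2).
  rewrite expf_neq0 // subr_eq0; apply/eqP => /f_inj.
  exact: (set_mem (valP y)).
rewrite /ord_sum /ord_prod; ring.
Qed.

Lemma root_inj x x' : root_sum x = root_sum x' -> root_prod x = root_prod x' ->
  x = x'.
Proof.
have [y ->] := proj_config_ex x; have [y' ->] := proj_config_ex x'.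
rewrite !root_sum_proj !root_prod_proj /ord_sum /ord_prod /config_at => S P.
apply/proj_configP.
move: S P; move E0 : (f (\val y ord0)) => z0; move E1 : (f (\val y ord_max)) => z1.
move E0' : (f (\val y' ord0)) => z0'; move E1' : (f (\val y' ord_max)) => z1' S P.
(* [z0'] is a root of the monic polynomial with roots [z0] and [z1], since the coefficients
   agree. *)
have : (z0' - z0) * (z0' - z1) == 0.
  rewrite (_ : _ * _ = z0' ^+ 2 - z0' * (z0 + z1) + z0 * z1); last by ring.
  by rewrite S P; apply/eqP; ring.
rewrite mulf_eq0 !subr_eq0 => /orP[] /eqP e0.
  have e1 : z1' = z1 by apply: (addrI z0'); rewrite -S e0.
  exists 1%g => j; rewrite perm1; apply: f_inj.
  by case: (ord2 j) => ->; rewrite ?E0 ?E1 ?E0' ?E1'.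
have e1 : z1' = z0 by apply: (addrI z0'); rewrite -S e0 addrC.
exists (tperm ord0 ord_max) => j; apply: f_inj.
by case: (ord2 j) => ->; rewrite ?tpermL ?tpermR ?E0 ?E1 ?E0' ?E1'.
Qed.

Definition config_pair (z1 z2 : C) : {ptws 'I_2 -> M} :=
  fun j => if j == ord0 then g z1 else g z2.

(** [b] provides the default value for pairs that are not configurations. *)
Definition pair_config (z1 z2 : C) : ordered_configuration 2 M :=
  insubd (repr b : ordered_configuration 2 M) (config_pair z1 z2).

Definition of_roots (z1 z2 : C) : X := proj_config (pair_config z1 z2).

Lemma val_pair_config z1 z2 : z1 != 0 -> z2 != 0 -> z1 != z2 ->
  \val (pair_config z1 z2) = config_pair z1 z2.
Proof.
move=> z10 z20 z12; rewrite /pair_config insubdK // inE /= => i j ij e.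
have {e} : f (config_pair z1 z2 i) = f (config_pair z1 z2 j) by rewrite e.
rewrite /config_pair; move: ij.
case: (ord2 i) (ord2 j) => -> [] -> //= _; rewrite !gK // => /eqP; last first.
  by rewrite eq_sym (negbTE z12).
by rewrite (negbTE z12).
Qed.

Lemma root_sum_of_roots z1 z2 : z1 != 0 -> z2 != 0 -> z1 != z2 ->
  root_sum (of_roots z1 z2) = z1 + z2.
Proof.
move=> z10 z20 z12; rewrite /of_roots root_sum_proj /ord_sum /config_at.
by rewrite val_pair_config // /config_pair /= !gK.
Qed.

Lemma root_prod_of_roots z1 z2 : z1 != 0 -> z2 != 0 -> z1 != z2 ->
  root_prod (of_roots z1 z2) = z1 * z2.
Proof.
move=> z10 z20 z12; rewrite /of_roots root_prod_proj /ord_prod /config_at.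
by rewrite val_pair_config // /config_pair /= !gK.
Qed.

Lemma near_neq0 (T : topologicalType) (h : T -> C) t :
  {for t, continuous h} -> h t != 0 -> \forall u \near t, h u != 0.
Proof.
move=> ch h0.
have cN : {for t, continuous (fun u => sqrtmod (h u))}.
  exact: (continuous_comp ch (@sqrtmod_continuous R _)).
have N : \forall u \near t, 0 < sqrtmod (h u) := cN _ (lt_nbhsr (sqrtmod_gt0 h0)).
apply: filterS N => u; apply: contraTneq => ->.
by rewrite /sqrtmod normr0 /= sqrtr0 ltxx.
Qed.

Lemma of_roots_continuous (T : topologicalType) (h1 h2 : T -> C) t :
  {for t, continuous h1} -> {for t, continuous h2} ->
  h1 t != 0 -> h2 t != 0 -> h1 t != h2 t ->
  {for t, continuous (fun u => of_roots (h1 u) (h2 u))}.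
Proof.
move=> ch1 ch2 h10 h20 h12.
have n12 : \forall u \near t, h1 u - h2 u != 0.
  by apply: near_neq0 (continuous_subC ch1 ch2) _; rewrite subr_eq0.
have cpair : {for t, continuous (fun u => config_pair (h1 u) (h2 u))}.
  apply: continuous_at_ptws => j; rewrite /config_pair; case: (j == ord0).
    exact: (continuous_comp ch1 (cg h10)).
  exact: (continuous_comp ch2 (cg h20)).
have cins : {for t, continuous (fun u => pair_config (h1 u) (h2 u))}.
  apply: continuous_at_initial; apply: continuous_at_near cpair.
  apply: filterS3 (near_neq0 ch1 h10) (near_neq0 ch2 h20) n12 => u u1 u2.
  by rewrite subr_eq0 => u12; exact/esym/val_pair_config.
exact: (continuous_comp cins (@proj_config_continuous _)).
Qed.

(* [d] is meant to be a square root of the discriminant. *)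
Definition of_coefs_with (d s p : C) : X :=
  of_roots ((s + d) / 2) ((s - d) / 2).

Definition of_coefs (s p : C) : X :=
  of_coefs_with (sqrtc (s ^+ 2 - 4 * p)) s p.

Lemma coefs_roots (d s p : C) : distinct_roots s p -> d ^+ 2 = s ^+ 2 - 4 * p ->
  [/\ (s + d) / 2 != 0, (s - d) / 2 != 0 & (s + d) / 2 != (s - d) / 2].
Proof.
move=> [p0 sp] dE; have d0 : d != 0.
  by apply: contra_neq sp => d0; apply/eqP; rewrite -subr_eq0 -dE d0 expr0n.
have pE : (s + d) / 2 * ((s - d) / 2) = p.
  rewrite (_ : _ * _ = (s ^+ 2 - d ^+ 2) / 4); last by field.
  by rewrite dE; field.
have : (s + d) / 2 * ((s - d) / 2) != 0 by rewrite pE.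
rewrite mulf_eq0 negb_or => /andP[? ?]; split=> //.
rewrite -subr_eq0 (_ : _ - _ = d) //; by field.
Qed.

Lemma of_coefs_withP (d s p : C) : distinct_roots s p -> d ^+ 2 = s ^+ 2 - 4 * p ->
  root_sum (of_coefs_with d s p) = s /\ root_prod (of_coefs_with d s p) = p.
Proof.
move=> sp dE; have [r1 r2 r12] := coefs_roots sp dE.
rewrite root_sum_of_roots // root_prod_of_roots //; split; first by field.
rewrite (_ : _ * _ = (s ^+ 2 - d ^+ 2) / 4); last by field.
by rewrite dE; field.
Qed.

Lemma of_coefsP (s p : C) : distinct_roots s p ->
  root_sum (of_coefs s p) = s /\ root_prod (of_coefs s p) = p.
Proof. by move=> sp; apply: of_coefs_withP => //; exact: sqr_sqrtc. Qed.

Lemma of_coefsK x : of_coefs (root_sum x) (root_prod x) = x.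
Proof. by have [] := of_coefsP (root_distinct x); exact: root_inj. Qed.

(** [sqrtc] has jumps, but the other square root of the discriminant only exchanges the two roots.
    Near [t] it may therefore be replaced by a continuous root, a fixed root at [t] times
    [right_sqrt] of a quotient close to 1. *)
Lemma of_coefs_continuous (T : topologicalType) (s p : T -> C) t :
  {for t, continuous s} -> {for t, continuous p} ->
  distinct_roots (s t) (p t) ->
  {for t, continuous (fun u => of_coefs (s u) (p u))}.
Proof.
move=> cs cp sp; have [p0 sp0] := sp.
pose D u : C := s u * s u - 4 * p u.
have DE u : D u = s u ^+ 2 - 4 * p u by rewrite /D expr2.
have cD : {for t, continuous D}.
  exact: (continuous_subC (continuous_mulC cs cs)
    (continuous_mulC (@continuous_cstC _ _ _ _) cp)).
have D0 : D t != 0 by rewrite DE subr_eq0.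
pose q u : C := D u / D t.
have cq : {for t, continuous q}.
  exact: continuous_mulC cD (@continuous_cstC _ _ _ _).
have qt : q t = 1 by rewrite /q divff.
have q0 : 0 < complex.Re (q t) by rewrite qt /= ltr01.
pose d u : C := sqrtc (D t) * right_sqrt (q u).
have cd : {for t, continuous d}.
  have cr : {for t, continuous (fun u => right_sqrt (q u))}.
    exact: (continuous_comp cq (right_sqrt_continuous q0)).
  exact: continuous_mulC (@continuous_cstC _ _ _ _) cr.
have nq : \forall u \near t, 0 < complex.Re (q u).
  have cr : {for t, continuous (fun u => complex.Re (q u))}.
    exact: (continuous_comp cq (@Re_continuous R _)).
  exact: cr _ (lt_nbhsr q0).
have dE u : 0 < complex.Re (q u) -> d u ^+ 2 = s u ^+ 2 - 4 * p u.
  by move=> u0; rewrite exprMn sqr_sqrtc right_sqrtK // /q mulrC divfK.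
have [r1 r2 r12] := coefs_roots sp (dE t q0).
have c2 : {for t, continuous (fun _ : T => 2^-1 : C)} by exact: continuous_cstC.
have cw : {for t, continuous (fun u => of_coefs_with (d u) (s u) (p u))}.
  exact: of_roots_continuous (continuous_mulC (continuous_addC cs cd) c2)
    (continuous_mulC (continuous_subC cs cd) c2) r1 r2 r12.
apply: continuous_at_near cw.
have nsp : \forall u \near t, D u != 0 by exact: near_neq0.
apply: filterS3 nq nsp (near_neq0 cp p0) => u qu Du pu.
have spu : distinct_roots (s u) (p u) by split=> //; rewrite -subr_eq0 -DE.
have [S1 P1] := of_coefs_withP spu (dE u qu); have [S2 P2] := of_coefsP spu.
by apply: root_inj; rewrite ?S1 ?S2 ?P1 ?P2.
Qed.

End configurations.

(** * The braid group *)

Section braids_of_punctured_line.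
Context (R : realType) (M : topologicalType).
Local Open Scope complex_scope.
Notation C := (R[i]^o).
Notation I := (unit_interval R).
Notation X := (unordered_configuration 2 M).
Context (f : M -> C) (g : C -> M).
Hypothesis cf : continuous f.
Hypothesis f0 : forall m, f m != 0.
Hypothesis fK : cancel f g.
Hypothesis gK : forall z : C, z != 0 -> f (g z) = z.
Hypothesis cg : forall z : C, z != 0 -> {for z, continuous g}.
Context (b : X).

Let S : X -> C := root_sum f.
Let P : X -> C := root_prod f.
Let cS : continuous S := root_sum_continuous cf.
Let cP : continuous P := root_prod_continuous cf.
Let nd x : distinct_roots (S x) (P x) := root_distinct f0 fK x.

(* The inverse of [conf_shape]: [r%:C * cis a] is the square root of [p]. *)
Definition polar_config (v : C) (r a : R) : X :=
  of_coefs g b (2 * (r%:C * cis a) * v) ((r%:C * cis a) ^+ 2).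

Lemma polar_neq0 (r a : R) : 0 < r -> r%:C * cis a != 0 :> C.
Proof.
move=> r0; rewrite mulf_neq0 ?cis_neq0 // eq_complex /= eqxx andbT.
by rewrite gt_eqF.
Qed.

Lemma polar_config_distinct (v : C) (r a : R) : v ^+ 2 != 1 -> 0 < r ->
  distinct_roots (2 * (r%:C * cis a) * v) ((r%:C * cis a) ^+ 2).
Proof.
move=> v1 r0; have q0 := polar_neq0 a r0; split; first by rewrite expf_neq0.
rewrite -subr_eq0.
rewrite (_ : _ - _ = 4 * (r%:C * cis a) ^+ 2 * (v ^+ 2 - 1)); last by ring.
apply: mulf_neq0; last by rewrite subr_eq0.
by apply: mulf_neq0; [rewrite pnatr_eq0|exact: expf_neq0].
Qed.

Lemma polar_configP (v : C) (r a : R) : v ^+ 2 != 1 -> 0 < r ->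
  [/\ P (polar_config v r a) = (r%:C * cis a) ^+ 2,
      polar_sqr (P (polar_config v r a)) a &
      conf_shape (S (polar_config v r a)) (P (polar_config v r a)) a = v].
Proof.
move=> v1 r0; have q0 := polar_neq0 a r0.
have [SE PE] := of_coefsP gK b (polar_config_distinct a v1 r0).
rewrite /S /P /polar_config SE PE /polar_sqr /conf_shape sqrtmod_cis ?(ltW r0) //.
split=> //; field; rewrite cis_neq0 eq_complex /= eqxx andbT.
by rewrite gt_eqF //= pnatr_eq0.
Qed.

Lemma polar_config_shape x a : polar_sqr (P x) a ->
  polar_config (conf_shape (S x) (P x) a) (sqrtmod (P x)) a = x.
Proof.
move=> pa; rewrite /polar_config -pa -conf_shapeE ?(nd x).1 //.
exact: (of_coefsK f0 fK gK).
Qed.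

Lemma polar_config_continuous (T : topologicalType)
    (v : T -> punctured_plane R) (r a : T -> R) :
  continuous v -> continuous r -> continuous a -> (forall t, 0 < r t) ->
  continuous (fun t => polar_config (plane_val (v t)) (r t) (a t)).
Proof.
move=> cv cr ca r0 t.
have crC : {for t, continuous (fun t => (r t)%:C : C)}.
  by apply: complex_continuous; [exact: cr|exact: (@cst_continuous T R 0 t)].
have cq : {for t, continuous (fun t => (r t)%:C * cis (a t) : C)}.
  exact: continuous_mulC crC (continuous_comp (ca t) (@cis_continuous R _)).
have cq2 : {for t, continuous (fun t => ((r t)%:C * cis (a t)) ^+ 2 : C)}.
  exact: (continuous_mulC cq cq).
have cpv : {for t, continuous (fun t => plane_val (v t) : C)}.
  exact: (continuous_comp (cv t) (@plane_val_continuous R _)).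
have cs : {for t, continuous
    (fun t => 2 * ((r t)%:C * cis (a t)) * plane_val (v t) : C)}.
  exact: (continuous_mulC (continuous_mulC (@continuous_cstC _ _ _ _) cq) cpv).
have dist := polar_config_distinct (a t) (plane_valP (v t)) (r0 t).
exact: (of_coefs_continuous fK gK cg cs cq2 dist).
Qed.

Let o : punctured_plane R := hub R Middle.
Let oE : plane_val o = 0 := hubE R Middle.

(** In the coordinate [f] this is the pair of roots of z^2 + 1. Its shape is 0, the hub of [Middle],
    where the tether is constant. *)
Definition base_config : X := polar_config 0 1 0.

Let o_sqr : (0 : C) ^+ 2 != 1.
Proof. by rewrite -oE plane_valP. Qed.

Lemma polar_config_base a : sin a = 0 -> polar_config 0 1 a = base_config.
Proof.
move=> sa; rewrite /base_config /polar_config !mulr0 !mul1r.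
by congr of_coefs; rewrite cis0 expr1n; apply/eqP; rewrite cis_sqr1 sa.
Qed.

Lemma base_polar : polar_sqr (P base_config) 0.
Proof. by have [] := polar_configP 0 o_sqr ltr01. Qed.

Definition braid_monodromy : fundamental_group R base_config -> \Gamma * R :=
  pi1_monodromy cS cP nd base_polar.

(** The converse of lifting: a shape, an angle and a label prescribed along a path, with the square
    root kept of modulus 1, define a braid. The factor [deck_label (a one)] comes from comparing the
    end with the image of the start under a deck transformation. *)
Lemma braid_monodromy_realized (v : I -> punctured_plane R) (a : I -> R)
    (l : I -> \Gamma) (h : \Gamma) :
  continuous v -> continuous a -> v zero = o -> v one = o -> a zero = 0 ->
  sin (a one) = 0 -> (forall t, labelled (@plane_val R \o v) l t) ->
  l zero = 1%g -> l one = (h * deck_label (a one))%g ->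
  exists x, braid_monodromy x = (h, a one).
Proof.
move=> cv ca v0 v1 a0 sa Ll l0 l1.
pose c t := polar_config (plane_val (v t)) 1 (a t).
have cc : continuous c.
  apply: polar_config_continuous => // t; exact: cst_continuous.
have c0 : c zero = base_config by rewrite /c v0 oE a0 /base_config.
have c1 : c one = base_config by rewrite /c v1 oE polar_config_base.
pose L : loop R base_config :=
  [the {path I from base_config to base_config} of mk_path cc c0 c1].
exists (loop_class L).
rewrite /braid_monodromy pi1_monodromy_class.
apply: (@monodromyE _ _ _ _ cS cP nd _ _ base_polar L (fun t => (a t, l t))).
- move=> t; have cP' u := polar_configP (a u) (plane_valP (v u)) (@ltr01 R).
  split=> /=; first exact: ca.
    by near=> u; have [] := cP' u.
  suff -> : (fun u => conf_shape ((S \o L) u) ((P \o L) u) (a u)) =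
      @plane_val R \o v by exact: Ll.
  by apply/funext => u; have [_ _ ->] := cP' u.
- by rewrite a0 l0.
- by rewrite /deck /= add0r mulg1 l1.
Unshelve. all: by end_near. Qed.

(** Rotating the base pair by a half turn exchanges its two points; the shape stays at 0 and crosses
    no cut, so the whole contribution is the [deck_label] of pi. *)
Lemma braid_monodromy_s : exists x, (braid_monodromy x).1 = fp_s.
Proof.
have [x xE] : exists x, braid_monodromy x = (fp_s, 1 * pi + 0).
  pose a (t : I) : R := pi * itv01_val t + 0.
  have a1 : a one = 1 * pi + 0 by rewrite /a itv01_val1 mulrC.
  rewrite -a1; apply: (@braid_monodromy_realized (cst o) a (cst 1%g)) => //.
  - exact: cst_continuous.
  - exact: affine_val_continuous.
  - by rewrite /a itv01_val0 mulr0 addr0.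
  - by rewrite a1 mul1r addr0 sinpi.
  - by move=> t c _; near=> u.
  - by rewrite a1 mul1r addr0 /deck_label cospi ltrN10 fp_sK.
by exists x; rewrite xE.
Unshelve. all: by end_near. Qed.

(* The shape describes a loop around [1]: its real part goes from 0 to 2 and
   back, while its imaginary part is first negative, then positive. *)
Lemma braid_monodromy_t : exists x, (braid_monodromy x).1 = (fp_t^-1)%g.
Proof.
pose h (t : I) : C := (8 * (itv01_val t * (1 - itv01_val t))) +i*
  (16 * ((2 * itv01_val t - 1) * (itv01_val t * (1 - itv01_val t)))).
have cx : continuous (@itv01_val R) := @itv01_val_continuous R.
have cst1 (k : R) : continuous (fun _ : I => k) by exact: cst_continuous.
have ch : continuous h.
  move=> t.
  have c1 : {for t, continuous (fun u : I => itv01_val u * (1 - itv01_val u))}.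
    exact: cvgM (cx t) (cvgB (cst1 1 t) (cx t)).
  have c0 : {for t, continuous
      (fun u : I => 8 * (itv01_val u * (1 - itv01_val u)))}.
    exact: cvgM (cst1 8 t) c1.
  have c2 : {for t, continuous (fun u : I => 2 * itv01_val u - 1)}.
    exact: cvgB (cvgM (cst1 2 t) (cx t)) (cst1 1 t).
  have c3 : {for t, continuous (fun u : I =>
      16 * ((2 * itv01_val u - 1) * (itv01_val u * (1 - itv01_val u))))}.
    exact: cvgM (cst1 16 t) (cvgM c2 c1).
  exact: complex_continuous c0 c3.
have hM t : itv01_val t != 2^-1 -> chart Middle (h t).
  rewrite /h; have /andP[t0 t1] := itv01_valP t.
  move: (itv01_val t) t0 t1 => r r0 r1 r2 /=.
  have [->|rn0] := eqVneq r 0; first by right; rewrite mul0r mulr0 normr0.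
  have [->|rn1] := eqVneq r 1; first by right; rewrite subrr !mulr0 normr0.
  left; apply/eqP; apply: mulf_neq0; first by rewrite pnatr_eq0.
  apply: mulf_neq0; first by apply: contra_neq r2 => e; lra.
  by apply: mulf_neq0 => //; rewrite subr_eq0 eq_sym.
have hR t : itv01_val t = 2^-1 -> chart Right (h t).
  by move=> e; rewrite /h /= e; lra.
have h1 t : h t ^+ 2 != 1.
  by have [/hR|/hM] := eqVneq (itv01_val t) 2^-1; exact: chart_sqr_neq1.
(* The cut is crossed upwards, at the point 2 and parameter 1/2. The new value is taken at 1/2
   itself because points of the right cut count as above it. *)
pose l (t : I) : \Gamma := if itv01_val t < 2^-1 then 1%g else (fp_t^-1)%g.
have [|||||||||x xE] := @braid_monodromy_realized (@to_plane R \o h) (cst 0)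
  l (fp_t^-1)%g.
- exact: to_plane_continuous.
- exact: cst_continuous.
- apply: plane_val_inj; rewrite /= to_planeK // oE /h itv01_val0.
  by rewrite !mul0r !mulr0.
- apply: plane_val_inj; rewrite /= to_planeK // oE /h itv01_val1 subrr.
  by rewrite !mulr0.
- by [].
- exact: sin0.
- suff Ll t : labelled h l t.
    rewrite (_ : _ \o _ = h) //; apply/funext => t /=; exact: to_planeK.
  have [/eqP e|ne] := eqVneq (itv01_val t) 2^-1; last first.
    apply: (labelled_chart (c := Middle) (ch t) (hM t ne)).
    have : \forall u \near t, l u = l t.
      move: ne; rewrite /l; case: ltgtP => // ne _.
        have N : \forall u \near t, itv01_val u < 2^-1 := cx t _ (lt_nbhsl ne).
        by apply: filterS N => u ->.
      have N : \forall u \near t, 2^-1 < itv01_val u := cx t _ (lt_nbhsr ne).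
      by apply: filterS N => u; case: ltgtP.
    by apply: filterS => u ->.
  move/eqP: e => e; apply: (labelled_chart (c := Right) (ch t) (hR t e)).
  have N : \forall u \near t, 0 < itv01_val u.
    by apply: (cx t _ (lt_nbhsr _)); rewrite e; lra.
  have N' : \forall u \near t, itv01_val u < 1.
    by apply: (cx t _ (lt_nbhsl _)); rewrite e; lra.
  have val u : 0 < itv01_val u -> itv01_val u < 1 ->
      (l u * (weight Right (h u))^-1 = fp_t^-1)%g.
    move=> u0 u1; rewrite /l /h /=; move: (itv01_val u) u0 u1 => r r0 r1.
    have rr : 0 < r * (1 - r) by rewrite mulr_gt0 // subr_gt0.
    case: ltP => r2; case: ltP => r3.
    - by rewrite mul1g.
    - by exfalso; nra.
    - by exfalso; nra.
    - by rewrite invg1 mulg1.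
  by apply: filterS2 N N' => u u0 u1; rewrite !val //; rewrite e; lra.
- by rewrite /l itv01_val0 ifT // invr_gt0 ltr0n.
- rewrite /l itv01_val1 ifF; last by lra.
  by rewrite /deck_label cos0 ltr10 mulg1.
by exists x; rewrite xE.
Qed.

Lemma braid_monodromy_surjective : (fst \o braid_monodromy) @` setT = setT.
Proof.
have bM x y : (braid_monodromy (x * y)%g).1 =
    ((braid_monodromy x).1 * (braid_monodromy y).1)%g.
  by rewrite /braid_monodromy pi1_monodromyM.
have b1 : (braid_monodromy 1%g).1 = 1%g by exact: morph1 bM.
pose A : set \Gamma := (fst \o braid_monodromy) @` setT.
have AM x y : A x -> A y -> A (x * y)%g.
  by move=> [u _ <-] [v _ <-]; exists (u * v)%g => //; exact: bM.
have A1 : A 1%g by exists 1%g.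
have AV x : A x -> A (x^-1)%g.
  by move=> [u _ <-]; exists u^-1%g => //; exact: (morphV bM).
have As : A fp_s by have [x <-] := braid_monodromy_s; exists x.
have At : A fp_t.
  by rewrite -[fp_t]invgK; apply: AV; have [x <-] := braid_monodromy_t; exists x.
apply: free_product_subgroupT => // [a|n].
  have [->|->] : a = (1%g : Z2group) \/ a = ((1%R : 'Z_2) : Z2group).
    by case: a => [[|[|//]]] H; [left|right]; exact: val_inj.
  - by rewrite (morph1 (@fp_inlM Z2group Zgroup)).
  - exact: As.
have AN m : A (fp_inr Z2group (m%:Z : Zgroup)).
  elim: m => [|m IH]; first by rewrite (morph1 (@fp_inrM Z2group Zgroup)).
  rewrite (_ : (m.+1%:Z : Zgroup) = (((1%R : int) : Zgroup) * (m%:Z : Zgroup))%g).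
    by rewrite fp_inrM; exact: AM.
  by rewrite -addn1 PoszD addrC.
case: n => n; first exact: AN.
rewrite (_ : (Negz n : Zgroup) = ((n.+1%:Z : Zgroup)^-1)%g); last by rewrite NegzE.
by rewrite (morphV (@fp_inrM Z2group Zgroup)); exact: AV.
Qed.

(** The contraction moves the shape along a null-homotopy [K], while the modulus of the square root
    goes linearly to 1 and its angle linearly to 0. Trivial monodromy makes the angle 0 at both ends
    of the loop, so the ends stay at the base configuration. *)
Lemma braid_monodromy_injective x : braid_monodromy x = (1%g, 0) -> x = 1%g.
Proof.
elim/loop_classW: x => L; rewrite /braid_monodromy pi1_monodromy_class => L1.
have [F LF [F0 F1]] := monodromy_lift cS cP nd base_polar L.
rewrite L1 /deck /= addr0 mul1g mul1g /deck_label cos0 ltr10 in F1.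
have cF : continuous (fun t => (F t).1) by move=> t; case: (LF t).
have pF t : polar_sqr (P (L t)) (F t).1 := lifts_polar (LF t).
pose v t := conf_shape (S (L t)) (P (L t)) (F t).1.
have cL : continuous L := @cts_fun _ _ L.
have cSL : continuous (S \o L) by exact: continuous_compose cL cS.
have cPL : continuous (P \o L) by exact: continuous_compose cL cP.
have cv : continuous v.
  move=> t; exact: (conf_shape_lifts cSL cPL (fun u => nd (L u)) (LF t)).
have v1 t : v t ^+ 2 != 1.
  exact: conf_shape_sqr_neq1 (nd (L t)).1 (nd (L t)).2 (pF t).
have [Pb _ vb] := polar_configP 0 o_sqr ltr01.
have cw := to_plane_continuous cv v1.
have w0 : (@to_plane R \o v) zero = o.
  by apply: plane_val_inj; rewrite /= to_planeK // oE /v path_zero F0.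
have w1 : (@to_plane R \o v) one = o.
  by apply: plane_val_inj; rewrite /= to_planeK // oE /v path_one F1.
pose w : loop R o := [the {path I from o to o} of mk_path cw w0 w1].
have wE t : plane_val (w t) = v t by exact: to_planeK.
have [K [cK K0 K1 Kx Ky]] : path_homotopic w (loop_one R o).
  apply/hclassP; apply: (@labelled_loop_trivial _ w (fun t => (F t).2)).
    move=> t; rewrite (_ : _ \o _ = v); last by apply/funext => u; exact: wE.
    by case: (LF t).
  by rewrite F0 F1.
have r1 : sqrtmod (P base_config) = 1.
  by rewrite Pb sqrtmod_cis.
pose r (st : I * I) : R :=
  (1 - itv01_val st.1) * sqrtmod (P (L st.2)) + itv01_val st.1.
pose a (st : I * I) : R := (1 - itv01_val st.1) * (F st.2).1.
have c1 : continuous (fun st : I * I => 1 - itv01_val st.1).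
  move=> st; exact: (cvgB (@cst_continuous (I * I)%type R 1 st)
    (@val_fst_continuous R st)).
have csnd : continuous (fun st : I * I => st.2) by move=> st; exact: cvg_snd.
have cr : continuous r.
  have cm : continuous (fun st : I * I => sqrtmod (P (L st.2))).
    have cPL2 := continuous_compose csnd cPL.
    exact: continuous_compose cPL2 (@sqrtmod_continuous R).
  by move=> st; exact: (cvgD (cvgM (c1 st) (cm st)) (@val_fst_continuous R st)).
have ca : continuous a.
  have cF2 := continuous_compose csnd cF.
  by move=> st; exact: (cvgM (c1 st) (cF2 st)).
have r0 st : 0 < r st.
  rewrite /r; have := sqrtmod_gt0 (nd (L st.2)).1.
  have /andP[s0 s1] := itv01_valP st.1.
  move: (itv01_val st.1) (sqrtmod _) s0 s1 => s m s0 s1 m0.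
  have [->|s1'] := eqVneq s 1; first by lra.
  have {s1'} : s < 1 by rewrite lt_neqAle s1' s1.
  nra.
apply/loop_classP.
exists (fun st => polar_config (plane_val (K st)) (r st) (a st)); split.
- exact: polar_config_continuous.
- move=> t; rewrite K0 wE /r /a /= itv01_val0 subr0 !mul1r addr0.
  exact: polar_config_shape.
- by move=> t; rewrite K1 /r /a /= itv01_val1 subrr !mul0r add0r oE.
- move=> s; rewrite Kx /r /a /= path_zero F0 oE mulr0 r1.
  by rewrite mulr1 subrK.
- move=> s; rewrite Ky /r /a /= path_one F1 oE mulr0 r1.
  by rewrite mulr1 subrK.
Qed.

(** The shape follows a tether from 0, and the modulus and angle vary affinely. Any two base points
    thus give isomorphic groups. *)
Lemma base_config_connected : exists c : hpath R base_config b, True.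
Proof.
have [a pa] := polar_sqr_exists (nd b).1.
have v1 : conf_shape (S b) (P b) a ^+ 2 != 1.
  exact: conf_shape_sqr_neq1 (nd b).1 (nd b).2 pa.
pose y : punctured_plane R := to_plane (conf_shape (S b) (P b) a).
pose v := hrepr (tether y); pose m := sqrtmod (P b).
pose r (t : I) : R := (m - 1) * itv01_val t + 1.
pose th (t : I) : R := a * itv01_val t + 0.
have m0 : 0 < m := sqrtmod_gt0 (nd b).1.
have r0 t : 0 < r t.
  rewrite /r; have /andP[t0 t1] := itv01_valP t.
  move: (itv01_val t) t0 t1 => s s0 s1.
  have [->|s1'] := eqVneq s 1; first by lra.
  have {s1'} : s < 1 by rewrite lt_neqAle s1' s1.
  nra.
have cc := polar_config_continuous (@cts_fun _ _ v)
  (@affine_val_continuous R _ _ : continuous r)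
  (@affine_val_continuous R _ _ : continuous th) r0.
have c0 : polar_config (plane_val (v zero)) (r zero) (th zero) = base_config.
  by rewrite path_zero oE /r /th itv01_val0 !mulr0 !add0r.
have c1 : polar_config (plane_val (v one)) (r one) (th one) = b.
  rewrite path_one /r /th itv01_val1 !mulr1 addr0 subrK to_planeK //.
  exact: polar_config_shape.
by exists (hclass [the {path I from base_config to b} of mk_path cc c0 c1]).
Qed.

Lemma isomorphic_derived_braid_group i : (0 < i)%N ->
  isomorphic_subgroups (derived_series (braid_group R 2 M b) i)
    (derived_series \Gamma i).
Proof.
move=> i0; have [c _] := base_config_connected.
have [h [hM [h' hK h'K]]] := base_change c.
apply: (@isomorphic_derived_series _ _ R (fun x => (braid_monodromy (h x)).1)
  (fun x => (braid_monodromy (h x)).2)) => //.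
- by move=> x y; rewrite hM /braid_monodromy pi1_monodromyM.
- apply/seteqP; split=> // x _.
  have : [set: \Gamma] x by [].
  rewrite -braid_monodromy_surjective => -[u _ <-].
  by exists (h' u) => //=; rewrite h'K.
- by move=> x y; rewrite hM /braid_monodromy pi1_monodromyM.
- move=> x x1 x2; apply: (can_inj hK).
  rewrite (morph1 hM); apply: braid_monodromy_injective.
  by case: (braid_monodromy _) x1 x2 => ? ? /= -> ->.
Qed.

End braids_of_punctured_line.

(** * The twice punctured sphere *)

Section stereographic_projection.
Context (R : realType).
Local Open Scope complex_scope.
Notation C := (R[i]^o).
Notation V := 'rV[R]_3.
Notation Re := complex.Re.
Notation Im := complex.Im.
Implicit Types (u v d : V).

Definition dot u v : R := \sum_i u 0 i * v 0 i.

Let i0 : 'I_3 := ord0.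
Let i1 : 'I_3 := lift ord0 ord0.
Let i2 : 'I_3 := lift ord0 (lift ord0 ord0).

Lemma dotE u v : dot u v = u 0 i0 * v 0 i0 + u 0 i1 * v 0 i1 + u 0 i2 * v 0 i2.
Proof. by rewrite /dot !big_ord_recl big_ord0 addr0 addrA. Qed.

Lemma ord3P (j : 'I_3) : [\/ j = i0, j = i1 | j = i2].
Proof.
case: j => [[|[|[|//]]]] H; [apply: Or31|apply: Or32|apply: Or33];
  exact: val_inj.
Qed.

Definition vec3 (x y z : R) : V :=
  \row_(j < 3) (if j == i0 then x else if j == i1 then y else z).

Lemma vec3E x y z :
  (vec3 x y z 0 i0 = x) * (vec3 x y z 0 i1 = y) * (vec3 x y z 0 i2 = z).
Proof. by rewrite !mxE. Qed.

(* For [d = 0] this is the identity, since then [2 * _ / 0 *: 0 = 0]. *)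
Definition reflection d u : V := u - (2 * dot u d / dot d d) *: d.

Lemma dot_eq0 d : dot d d = 0 -> d = 0.
Proof.
rewrite dotE -!expr2 => d0; apply/rowP => j; rewrite mxE.
have := sqr_ge0 (d 0 i0); have := sqr_ge0 (d 0 i1); have := sqr_ge0 (d 0 i2).
move=> p2 p1 p0.
by case: (ord3P j) => ->; apply/eqP; rewrite -sqrf_eq0; apply/eqP; lra.
Qed.

Lemma reflection0 u : reflection 0 u = u.
Proof. by rewrite /reflection scaler0 subr0. Qed.

Lemma reflection_dot d u : dot (reflection d u) (reflection d u) = dot u u.
Proof.
have [/dot_eq0 ->|d0] := eqVneq (dot d d) 0; first by rewrite reflection0.
have [k kE] : exists k, k = 2 * dot u d / dot d d by eexists.
have {}kE' : k * dot d d = 2 * dot u d by rewrite kE divfK.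
apply/eqP; rewrite -subr_eq0; apply/eqP.
have -> : dot (reflection d u) (reflection d u) - dot u u =
    k * (k * dot d d - 2 * dot u d).
  by rewrite /reflection -kE !dotE !mxE; ring.
by rewrite kE' subrr mulr0.
Qed.

Lemma reflectionK d : involutive (reflection d).
Proof.
move=> u; have [/dot_eq0 ->|d0] := eqVneq (dot d d) 0.
  by rewrite !reflection0.
have [k kE] : exists k, k = 2 * dot u d / dot d d by eexists.
have kE' : k * dot d d = 2 * dot u d by rewrite kE divfK.
rewrite {1}/reflection (_ : 2 * _ / _ = - k).
  by rewrite /reflection -kE scaleNr opprK subrK.
apply: (mulIf d0); rewrite divfK // mulNr kE'.
rewrite (_ : dot (reflection d u) d = dot u d - k * dot d d).
  by rewrite kE'; ring.
by rewrite /reflection -kE !dotE !mxE; ring.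
Qed.

(** For vectors of equal length 2 u.(u - v) = |u - v|^2, so the reflection subtracts exactly u -
    v. *)
Lemma reflection_sub u v : dot u u = dot v v -> reflection (u - v) u = v.
Proof.
move=> uv; have [/dot_eq0 uv0|d0] := eqVneq (dot (u - v) (u - v)) 0.
  by rewrite uv0 reflection0; apply/eqP; rewrite -subr_eq0 uv0.
rewrite /reflection (_ : 2 * _ = dot (u - v) (u - v)).
  by rewrite divff // scale1r subKr.
apply/eqP; rewrite -subr_eq0; apply/eqP.
rewrite (_ : _ - _ = dot u u - dot v v); first by rewrite uv subrr.
by rewrite !dotE !mxE; ring.
Qed.

Definition pole : V := vec3 0 0 1.

Lemma dot_pole : dot pole pole = 1.
Proof. by rewrite dotE !vec3E; ring. Qed.

Definition stereo u : C :=
  (u 0 i0 / (1 - u 0 i2)) +i* (u 0 i1 / (1 - u 0 i2)).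

Definition unstereo (z : C) : V :=
  let n := Re z ^+ 2 + Im z ^+ 2 + 1 in
  vec3 (2 * Re z / n) (2 * Im z / n) ((n - 2) / n).

Lemma norm1_gt0 (z : C) : 0 < Re z ^+ 2 + Im z ^+ 2 + 1.
Proof. by rewrite ltr_wpDl ?ltr01 // addr_ge0 // sqr_ge0. Qed.

Lemma dot_unstereo z : dot (unstereo z) (unstereo z) = 1.
Proof.
have n0 := lt0r_neq0 (norm1_gt0 z); rewrite dotE !vec3E; field.
by [].
Qed.

Lemma unstereo2 z : 1 - unstereo z 0 i2 = 2 / (Re z ^+ 2 + Im z ^+ 2 + 1).
Proof. by have n0 := lt0r_neq0 (norm1_gt0 z); rewrite !vec3E; field. Qed.

Lemma unstereo_neq_pole z : unstereo z <> pole.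
Proof.
move=> e; have := unstereo2 z; rewrite e !vec3E subrr => /esym/eqP.
by rewrite mulf_eq0 invr_eq0 (gt_eqF (norm1_gt0 z)) orbF pnatr_eq0.
Qed.

Lemma unstereoK : cancel unstereo stereo.
Proof.
move=> z; have n0 := lt0r_neq0 (norm1_gt0 z).
rewrite /stereo unstereo2 !vec3E; case: z n0 => a b /= n0.
by congr (_ +i* _); field.
Qed.

Lemma coord2_neq1 u : dot u u = 1 -> u <> pole -> 1 - u 0 i2 != 0.
Proof.
move=> u1 up; rewrite subr_eq0; apply/eqP => e; apply: up; apply/rowP => j.
move: u1; rewrite dotE -e.
have := sqr_ge0 (u 0 i0); have := sqr_ge0 (u 0 i1) => p1 p0 u1.
case: (ord3P j) => ->; rewrite !vec3E //; apply/eqP; rewrite -sqrf_eq0; apply/eqP;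
  rewrite expr2; nra.
Qed.

Lemma stereoK u : dot u u = 1 -> u <> pole -> unstereo (stereo u) = u.
Proof.
move=> u1 up; have c2 := coord2_neq1 u1 up.
have n0 := lt0r_neq0 (norm1_gt0 (stereo u)).
(* With h the third coordinate, the first two squares sum to (1 - h)(1 + h) on the sphere; dividing
   by (1 - h)^2 and adding 1 gives 2 / (1 - h). *)
have nE : Re (stereo u) ^+ 2 + Im (stereo u) ^+ 2 + 1 = 2 / (1 - u 0 i2).
  move: u1; rewrite /stereo /= dotE => u1.
  apply: (mulIf (expf_neq0 2 c2)).
  rewrite [RHS](_ : _ = 2 * (1 - u 0 i2)); last by field.
  rewrite [LHS](_ : _ = u 0 i0 * u 0 i0 + u 0 i1 * u 0 i1 + (1 - u 0 i2) ^+ 2).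
    have -> : u 0 i0 * u 0 i0 + u 0 i1 * u 0 i1 = 1 - u 0 i2 * u 0 i2.
      by rewrite -u1; ring.
    by ring.
  by field.
apply/rowP => j; rewrite /unstereo nE; case: (ord3P j) => ->; rewrite !vec3E;
  rewrite /stereo /=; field; rewrite ?c2 //=.
Qed.

Lemma continuous_at_rV (T : topologicalType) (h : T -> V) t :
  (forall j, {for t, continuous (fun s => h s 0 j : R)}) ->
  {for t, continuous h}.
Proof.
move=> ch A [Q nQ sQA].
have : \forall s \near t, forall j, Q 0 j (h s 0 j).
  apply: filter_forall => j; exact: (ch j _ (nQ 0 j)).
by apply: filterS => s hs; apply: sQA => i j; rewrite (ord1 i).
Qed.

Lemma coord_continuous_at (T : topologicalType) (h : T -> V) t j :
  {for t, continuous h} -> {for t, continuous (fun s => h s 0 j : R)}.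
Proof. by move=> ch; exact: (continuous_comp ch (@coord_continuous R _ _ 0 j _)). Qed.

Section continuity.
Context (T : topologicalType) (t : T).

Lemma reflection_continuous d (h : T -> V) : {for t, continuous h} ->
  {for t, continuous (fun s => reflection d (h s))}.
Proof.
move=> ch; have cj j := @coord_continuous_at _ h t j ch.
have cst_at (k : R) : {for t, continuous (fun _ : T => k)}.
  exact: (@cst_continuous T R k t).
have cd : {for t, continuous (fun s => dot (h s) d)}.
  have -> : (fun s => dot (h s) d) = (fun s =>
      h s 0 i0 * d 0 i0 + h s 0 i1 * d 0 i1 + h s 0 i2 * d 0 i2).
    by apply/funext => s; rewrite dotE.
  exact: (cvgD (cvgD (cvgM (cj i0) (cst_at _)) (cvgM (cj i1) (cst_at _)))
    (cvgM (cj i2) (cst_at _))).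
apply: continuous_at_rV => j.
have -> : (fun s => reflection d (h s) 0 j) =
    (fun s => h s 0 j - 2 * dot (h s) d * (dot d d)^-1 * d 0 j).
  by apply/funext => s; rewrite !mxE.
exact: (cvgB (cj j) (cvgM (cvgM (cvgM (cst_at 2) cd) (cst_at _)) (cst_at _))).
Qed.

Lemma stereo_continuous (h : T -> V) : {for t, continuous h} ->
  1 - h t 0 i2 != 0 -> {for t, continuous (fun s => stereo (h s) : C)}.
Proof.
move=> ch h2; have cj j := @coord_continuous_at _ h t j ch.
have cst_at (k : R) : {for t, continuous (fun _ : T => k)}.
  exact: (@cst_continuous T R k t).
have ci : {for t, continuous (fun s => (1 - h s 0 i2)^-1)}.
  exact: (cvgV h2 (cvgB (cst_at 1) (cj i2))).
exact: complex_continuous (cvgM (cj i0) ci) (cvgM (cj i1) ci).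
Qed.

Lemma unstereo_continuous (h : T -> C) : {for t, continuous h} ->
  {for t, continuous (fun s => unstereo (h s))}.
Proof.
move=> ch.
have cst_at (k : R) : {for t, continuous (fun _ : T => k)}.
  exact: (@cst_continuous T R k t).
have cr : {for t, continuous (fun s => Re (h s))}.
  exact: (continuous_comp ch (@Re_continuous R _)).
have ci : {for t, continuous (fun s => Im (h s))}.
  exact: (continuous_comp ch (@Im_continuous R _)).
pose n s := Re (h s) * Re (h s) + Im (h s) * Im (h s) + 1.
have nE s : Re (h s) ^+ 2 + Im (h s) ^+ 2 + 1 = n s by rewrite /n !expr2.
have cn : {for t, continuous n}.
  exact: (cvgD (cvgD (cvgM cr cr) (cvgM ci ci)) (cst_at 1)).
have n0 : n t != 0 by rewrite -nE lt0r_neq0 // norm1_gt0.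
have cV : {for t, continuous (fun s => (n s)^-1)} by exact: cvgV n0 cn.
apply: continuous_at_rV => j; case: (ord3P j) => ->.
- have -> : (fun s => unstereo (h s) 0 i0) = (fun s => 2 * Re (h s) * (n s)^-1).
    by apply/funext => s; rewrite vec3E nE.
  exact: (cvgM (cvgM (cst_at 2) cr) cV).
- have -> : (fun s => unstereo (h s) 0 i1) = (fun s => 2 * Im (h s) * (n s)^-1).
    by apply/funext => s; rewrite vec3E nE.
  exact: (cvgM (cvgM (cst_at 2) ci) cV).
- have -> : (fun s => unstereo (h s) 0 i2) = (fun s => (n s - 2) * (n s)^-1).
    by apply/funext => s; rewrite vec3E nE.
  exact: (cvgM (cvgB cn (cst_at 2)) cV).
Qed.

End continuity.

Section twice_punctured_sphere.
Context (x1 x2 : sphere2 R).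
Hypothesis x12 : x1 <> x2.
Notation M := (twice_punctured_sphere x1 x2).

Definition sphere_val (x : sphere2 R) : V := \val x.

Lemma sphere_valP x : dot (sphere_val x) (sphere_val x) = 1.
Proof.
by have := set_mem (valP x); rewrite /= => <-; apply: eq_bigr => i _; rewrite expr2.
Qed.

Lemma sphere_val_inj : injective sphere_val.
Proof. exact: val_inj. Qed.

Lemma sphere_val_continuous : continuous sphere_val.
Proof. exact: initial_continuous. Qed.

Definition to_sphere u : sphere2 R := insubd x1 u.

Lemma to_sphereK u : dot u u = 1 -> sphere_val (to_sphere u) = u.
Proof.
move=> u1; rewrite /sphere_val /to_sphere insubdK // inE /= -u1.
by apply: eq_bigr => i _; rewrite expr2.
Qed.

Definition punctured_val (m : M) : sphere2 R := \val m.

Lemma punctured_val1 m : punctured_val m <> x1.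
Proof. by move=> e; have := set_mem (valP m); apply; left. Qed.

Lemma punctured_val2 m : punctured_val m <> x2.
Proof. by move=> e; have := set_mem (valP m); apply; right. Qed.

Lemma punctured_val_continuous : continuous punctured_val.
Proof. exact: initial_continuous. Qed.

Let d := sphere_val x1 - pole.

(* A reflection takes [x1] to the pole of the stereographic projection. *)
Definition chart_point (x : sphere2 R) : V := reflection d (sphere_val x).

Lemma dot_chart_point x : dot (chart_point x) (chart_point x) = 1.
Proof. by rewrite reflection_dot sphere_valP. Qed.

Lemma chart_point_inj : injective chart_point.
Proof. by move=> x y /(inv_inj (reflectionK d)) /sphere_val_inj. Qed.

Lemma chart_point1 : chart_point x1 = pole.
Proof. by apply: reflection_sub; rewrite sphere_valP dot_pole. Qed.

Lemma chart_point_neq x : x <> x1 -> chart_point x <> pole.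
Proof. by move=> xx1; rewrite -chart_point1 => /chart_point_inj. Qed.

(** The reflection and projection send [x1] to infinity; the translation then puts [x2] at 0, so the
    coordinate identifies [M] with the nonzero complex numbers. *)
Definition plane_coord (m : M) : C :=
  stereo (chart_point (punctured_val m)) - stereo (chart_point x2).

Definition plane_point (m0 : M) (z : C) : M :=
  insubd m0 (to_sphere (reflection d (unstereo (z + stereo (chart_point x2))))).

Let stereo_chart_inj x y : x <> x1 -> y <> x1 ->
  stereo (chart_point x) = stereo (chart_point y) -> x = y.
Proof.
move=> xx yy e; apply: chart_point_inj.
rewrite -(stereoK (dot_chart_point x) (chart_point_neq xx)) e.
by rewrite stereoK //; [exact: dot_chart_point|exact: chart_point_neq].
Qed.

Lemma plane_coord_neq0 m : plane_coord m != 0.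
Proof.
rewrite subr_eq0; apply/eqP => e; apply: (@punctured_val2 m).
by apply: stereo_chart_inj e; [exact: punctured_val1|move=> /esym].
Qed.

Lemma plane_coordK m0 : cancel plane_coord (plane_point m0).
Proof.
move=> m; rewrite /plane_point /plane_coord subrK stereoK; last 2 first.
- exact: dot_chart_point.
- exact/chart_point_neq/punctured_val1.
rewrite reflectionK (_ : to_sphere _ = punctured_val m); first exact: valKd.
by apply: sphere_val_inj; rewrite to_sphereK // sphere_valP.
Qed.

Lemma plane_point_val m0 (z : C) : z != 0 -> punctured_val (plane_point m0 z) =
  to_sphere (reflection d (unstereo (z + stereo (chart_point x2)))).
Proof.
move=> z0; rewrite /punctured_val insubdK // inE /=.
set w := z + _.
have sE : sphere_val (to_sphere (reflection d (unstereo w))) =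
    reflection d (unstereo w).
  by rewrite to_sphereK // reflection_dot dot_unstereo.
case=> e.
  apply: (@unstereo_neq_pole w); rewrite -(reflectionK d (unstereo w)) -sE e.
  exact: chart_point1.
move/eqP: z0; apply; apply: (addIr (stereo (chart_point x2))).
by rewrite add0r -/w -(unstereoK w) -(reflectionK d (unstereo w)) -sE e.
Qed.

Lemma plane_pointK m0 (z : C) : z != 0 -> plane_coord (plane_point m0 z) = z.
Proof.
move=> z0; rewrite /plane_coord plane_point_val // /chart_point.
rewrite to_sphereK; last by rewrite reflection_dot dot_unstereo.
by rewrite reflectionK unstereoK addrK.
Qed.

Lemma plane_coord_continuous : continuous plane_coord.
Proof.
move=> m.
have cv : {for m, continuous (fun m => sphere_val (punctured_val m))}.
  exact: (continuous_comp (@punctured_val_continuous m)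
    (@sphere_val_continuous _)).
have cs : {for m, continuous (fun m => stereo (chart_point (punctured_val m)) : C)}.
  apply: stereo_continuous; first exact: reflection_continuous.
  apply: coord2_neq1; first exact: dot_chart_point.
  exact/chart_point_neq/punctured_val1.
exact: continuous_subC cs (@continuous_cstC _ _ _ _).
Qed.

Lemma plane_point_continuous m0 (z : C) : z != 0 ->
  {for z, continuous (plane_point m0)}.
Proof.
move=> z0.
have cz : {for z, continuous (fun w : C => w + stereo (chart_point x2) : C)}.
  exact: (continuous_addC (@cvg_id _ _) (@continuous_cstC _ _ _ _)).
have cu := @reflection_continuous _ _ d _ (unstereo_continuous cz).
have cid : {for z, continuous (id : C -> C)} by exact: cvg_id.
apply: continuous_at_initial; apply: continuous_at_initial.
apply: continuous_at_near cu; apply: filterS (near_neq0 cid z0) => w w0.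
rewrite -[RHS]/(sphere_val (punctured_val (plane_point m0 w))).
by rewrite plane_point_val // to_sphereK // reflection_dot dot_unstereo.
Qed.

End twice_punctured_sphere.
End stereographic_projection.

Theorem corollary53 (R : realType) (x1 x2 : sphere2 R) (x1_neq_x2 : x1 <> x2)
    (b : unordered_configuration 2 (twice_punctured_sphere x1 x2))
    (i : nat) (i_ge1 : (1 <= i)%N) :
  isomorphic_subgroups
    (derived_series (braid_group R 2 (twice_punctured_sphere x1 x2) b) i)
    (mod2_first @` derived_series (free_product Zgroup Zgroup) i).
Proof.
have mod2M : {morph mod2_first : x y / (x * y)%g} by exact: gmulfM.
rewrite (image_derived_series mod2M _ mod2_first_surjective).
(* A point of the surface, taken from the base configuration, as default value of the inverse
   coordinate. *)
pose m0 : twice_punctured_sphere x1 x2 :=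
  \val (repr b : ordered_configuration 2 (twice_punctured_sphere x1 x2)) ord0.
exact: (isomorphic_derived_braid_group (@plane_coord_continuous R x1 x2)
  (plane_coord_neq0 x1_neq_x2) (plane_coordK m0) (plane_pointK m0)
  (@plane_point_continuous R x1 x2 m0) b i_ge1).
Qed.
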